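(* Let $k$ be a knotoid with index polynomial $F_k$. Any attainable sign sequence for $k$ must have a consecutive subsequence adding up to $\deg^+(F_k)$, and a consecutive subsequence adding up to $-\deg^-(F_k)$, where terms $+$ are treated as $+1$ and terms $-$ as $-1$.
   Context: A knotoid diagram $K$ is an immersion of a closed interval into the oriented sphere $S^2$ whose only singularities are transverse double crossings (the endpoints are not crossing points), together with over/under information at each crossing; it is oriented from its tail $v_0$ to its head $v_1$. A knotoid is a class of knotoid diagrams up to isotopy of $S^2$ and the Reidemeister moves I, II, III performed away from the endpoints (no strand may be moved over or under an endpoint). A shortcut for $K$ is an embedded path $a$ in $S^2$ from $v_0$ to $v_1$ that intersects $K$ transversely and does not pass through crossings of $K$. The common endpoints $v_0,v_1$ are not counted as intersections. Orienting $a$ from $v_0$ to $v_1$, an intersection of an oriented strand with $a$ is positive ($+$) if the strand crosses $a$ from the right of $a$ to the left of $a$, and negative ($-$) otherwise. A pair $(K,a)$ is a shortcut diagram, representing the knotoid represented by $K$. A sign sequence is a finite sequence with values in $\{+,-\}$. $\mathrm{Seq}(K,a)$ is the sign sequence listing the signs of the intersections of $K$ with $a$ in the order they appear along $K$ from $v_0$ to $v_1$. A sign sequence is attainable for $k$ if it equals $\mathrm{Seq}(K,a)$ for some shortcut diagram representing $k$. Consecutive subsequences are allowed to be empty (with sum $0$). For a crossing $c$ of $K$, the unique orientation-respecting smoothing of $c$ yields an interval with the same endpoints as $K$ and a loop $L$ (the segment of $K$ from $c$ to $c$). The intersection index $\mathrm{Ind}(c)\in\mathbb Z$ is the winding number of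 $L$ around the twice-punctured sphere $S^2-\{v_0,v_1\}$, i.e. the algebraic intersection number of $L$ with any shortcut for $K$, with the sign convention above. For $n\neq 0$, the $n$-writhe $J_n(K)$ is half the sum of the (usual) signs of the crossings of $K$ of index $n$; it is known to be an integer and an invariant $J_n(k)$ of the knotoid $k$. The index polynomial of $k$ is $$F_k(t)=\sum_{n\ne 0}J_n(k)(t^n-1)\in\mathbb Z[t,t^{-1}].$$ For a nonzero Laurent polynomial $p(t)$ with largest exponent $\mathrm{maxdeg}(p)$ and smallest exponent $\mathrm{mindeg}(p)$, put $\deg^+(p)=\max\{\mathrm{maxdeg}(p),0\}$ and $\deg^-(p)=\max\{-\mathrm{mindeg}(p),0\}$; also $\deg^\pm(0)=0$. *)

(* Defs.v *)
From HB Require Import structures.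
From mathcomp Require Import all_boot all_order all_algebra.
From mathcomp Require Import all_classical all_reals all_analysis.
From mathcomp Require Import finmap.
From mathcomp Require Import -(notations) monalg.

Set Implicit Arguments.
Unset Strict Implicit.
Unset Printing Implicit Defensive.

Import Order.TTheory GRing.Theory Num.Theory.
Import numFieldNormedType.Exports.

Local Open Scope classical_set_scope.
Local Open Scope ring_scope.

(* Laurent polynomials with integer coefficients: [mkmalgU n c] is the monomial
   c t^n.  Only the additive structure of Z[t, t^-1] is used, so the multiplicative
   monoid structure on the exponents is not set up. *)
Definition laurent : zmodType := monalg.malg int int.

Definition laurent_monomial (n : int) : laurent := monalg.mkmalgU n 1.

(* [head 0 _] is an arbitrary exponent of p, used only to start the iteration:
   these are the largest and the smallest exponents of a nonzero p. *)
Definition maxdeg (p : laurent) : int :=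
  let s := enum_fset (monalg.msupp p) in \big[Num.max/head 0 s]_(n <- s) n.

Definition mindeg (p : laurent) : int :=
  let s := enum_fset (monalg.msupp p) in \big[Num.min/head 0 s]_(n <- s) n.

Definition deg_plus (p : laurent) : int :=
  if p == 0 then 0 else Num.max (maxdeg p) 0.

Definition deg_minus (p : laurent) : int :=
  if p == 0 then 0 else Num.max (- mindeg p) 0.

(* Signs are booleans: [true] is + and [false] is -. *)
Definition int_of_sign (b : bool) : int := if b then 1 else -1.

Definition sign_sum (s : seq bool) : int := \sum_(b <- s) int_of_sign b.

Section Sphere.
Variable R : realType.
Local Notation V := 'rV[R]_3.

Definition dot (u v : V) : R := \sum_(i < 3) u 0 i * v 0 i.

Definition det3 (u v w : V) : R := \det (\matrix_(i < 3) nth 0 [:: u; v; w] i).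

(* The sphere is oriented by its outward normal: a basis (u, v) of the tangent
   plane at x is positive when 0 < det3 x u v. *)
Definition S2 : set V := [set x | dot x x = 1].

(* C^1 immersion of [0, 1] in the sphere.  The values of g outside [0, 1] are
   irrelevant, except that g extends differentiably past the endpoints. *)
Definition immersed_arc (g : R -> V) : Prop :=
  [/\ forall t, 0 <= t <= 1 -> S2 (g t),
      forall t, 0 <= t <= 1 -> derivable g t 1,
      {within `[0, 1], continuous (derive1 g)} &
      forall t, 0 <= t <= 1 -> derive1 g t != 0].

(* A crossing is a pair (o, u) of times: o is the time of the overpass and u the
   time of the underpass.  [dcurve 0] is the tail and [dcurve 1] the head. *)
Record diagram := Diagram {
  dcurve :> R -> V;
  crossings : seq (R * R);
  diagram_immersed : immersed_arc dcurve;
  crossings_uniq : uniq crossings;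
  crossings_asym : forall s t, (s, t) \in crossings -> (t, s) \notin crossings;
  crossings_inner : forall c, c \in crossings -> 0 < c.1 < 1 /\ 0 < c.2 < 1;
  crossingsP : forall s t, 0 <= s <= 1 -> 0 <= t <= 1 ->
    (s <> t /\ dcurve s = dcurve t) <->
    (s, t) \in crossings \/ (t, s) \in crossings;
  crossings_double : forall r s t, 0 <= r <= 1 -> 0 <= s <= 1 -> 0 <= t <= 1 ->
    dcurve r = dcurve s -> dcurve s = dcurve t -> [\/ r = s, s = t | r = t];
  crossings_transverse : forall c, c \in crossings ->
    det3 (dcurve c.1) (derive1 dcurve c.1) (derive1 dcurve c.2) != 0 }.

(* Usual sign of a crossing: + when (overpass, underpass) is a positive frame. *)
Definition crossing_sign (K : diagram) (c : R * R) : int :=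
  int_of_sign (0 < det3 (K c.1) (derive1 K c.1) (derive1 K c.2)).

(* [hits] lists, in the order along K, the pairs (t, u) with K t = scurve u other
   than the two common endpoints. *)
Record shortcut (K : diagram) := Shortcut {
  scurve :> R -> V;
  hits : seq (R * R);
  shortcut_immersed : immersed_arc scurve;
  shortcut_injective : forall u v, 0 <= u <= 1 -> 0 <= v <= 1 ->
    scurve u = scurve v -> u = v;
  shortcut_tail : scurve 0 = K 0;
  shortcut_head : scurve 1 = K 1;
  hits_sorted : sorted <%R [seq h.1 | h <- hits];
  hitsP : forall t u, (t, u) \in hits <->
    [/\ 0 < t < 1, 0 < u < 1 & K t = scurve u];
  hits_transverse : forall h, h \in hits ->
    det3 (K h.1) (derive1 scurve h.2) (derive1 K h.1) != 0;
  shortcut_avoids_crossings : forall c u, c \in crossings K -> 0 <= u <= 1 ->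
    scurve u <> K c.1 }.

(* K crosses a from right to left exactly when (direction of a, direction of K) is
   a positive frame. *)
Definition hit_sign (K : diagram) (a : shortcut K) (h : R * R) : bool :=
  0 < det3 (K h.1) (derive1 a h.2) (derive1 K h.1).

Definition Seq (K : diagram) (a : shortcut K) : seq bool :=
  [seq hit_sign a h | h <- hits a].

(* Algebraic intersection number of a with the loop of K from c to c; it does not
   depend on the choice of the shortcut a. *)
Definition Ind (K : diagram) (a : shortcut K) (c : R * R) : int :=
  \sum_(h <- hits a | Num.min c.1 c.2 < h.1 < Num.max c.1 c.2)
    int_of_sign (hit_sign a h).

(* The sum is known to be even when n != 0, so the division is exact. *)
Definition diagram_writhe (K : diagram) (a : shortcut K) (n : int) : int :=
  ((\sum_(c <- crossings K | Ind a c == n) crossing_sign K c) %/ 2)%Z.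

(* C^1 isotopy phi_t (0 <= t <= 1) of the sphere, starting at the identity.  Each
   phi_t is given on a neighbourhood of the sphere in R^3 in order to speak of its
   differential (e.g. by radial extension); only its values on the sphere and its
   differential on tangent vectors matter. *)
Definition isotopy (phi : R -> V -> V) : Prop :=
  let dom := [set p : R * V | 0 <= p.1 <= 1 /\ S2 p.2] in
  [/\ forall x, S2 x -> phi 0 x = x,
      forall t, 0 <= t <= 1 -> set_bij S2 S2 (phi t),
      {within dom, continuous (fun p : R * V => phi p.1 p.2)},
      forall t x, 0 <= t <= 1 -> S2 x -> differentiable (phi t) x &
      (forall v : V,
        {within dom, continuous (fun p : R * V => 'd (phi p.1) (p.2) v)}) /\
      (forall t x v, 0 <= t <= 1 -> S2 x -> dot x v = 0 -> v != 0 ->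
        'd (phi t) x v != 0)].

Definition reparametrization (h : R -> R) : Prop :=
  [/\ h 0 = 0, h 1 = 1 &
      forall t, 0 <= t <= 1 -> derivable h t 1 /\ 0 < derive1 h t].

Definition isotopic (K K' : diagram) : Prop :=
  exists phi : R -> V -> V, exists h : R -> R,
    [/\ isotopy phi, reparametrization h,
        forall t, 0 <= t <= 1 -> K' (h t) = phi 1 (K t) &
        perm_eq (crossings K') [seq (h c.1, h c.2) | c <- crossings K]].

Definition inside (J : R * R) (t : R) : bool := J.1 < t < J.2.

Definition in_arcs (I : seq (R * R)) (t : R) : bool :=
  has (fun J => J.1 <= t <= J.2) I.

Definition inner_crossings (I : seq (R * R)) (K : diagram) : seq (R * R) :=
  [seq c <- crossings K | in_arcs I c.1].

Definition outer_crossings (I : seq (R * R)) (K : diagram) : seq (R * R) :=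
  [seq c <- crossings K | ~~ in_arcs I c.1].

(* K and K' coincide outside the round disc D = {x in S2 | h <= dot e x}, which
   misses the endpoints; both meet D in proper arcs parametrized by the disjoint time
   intervals of I, listed in any order along K.  Since any disc in the sphere is
   isotopic to a round one, local moves in round discs suffice up to isotopy. *)
Definition local_change (I : seq (R * R)) (K K' : diagram) : Prop :=
  exists e : V, exists h : R,
    [/\ S2 e,
        (forall J, J \in I -> [/\ 0 < J.1, J.1 < J.2 & J.2 < 1]) /\
        pairwise (fun J J' : R * R => (J.2 < J'.1) || (J'.2 < J.1)) I,
        forall t, 0 <= t <= 1 -> ~~ has (inside^~ t) I -> K' t = K t,
        (forall t, 0 <= t <= 1 -> ~~ in_arcs I t -> dot e (K t) < h) /\
        (forall t, has (inside^~ t) I ->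
           h < dot e (K t) /\ h < dot e (K' t)) &
        perm_eq (outer_crossings I K') (outer_crossings I K)].

(* Arcs in a disc with fixed ends and with a single self-crossing form an empty
   kink; two arcs crossing exactly twice form an empty bigon; three arcs crossing
   pairwise once form an empty triangle, with two possible positions.  Hence the
   three Reidemeister moves can be described by the crossings present in the disc,
   each pattern being the standard picture up to isotopy of the disc.  The
   conditions on signs are automatic. *)
Definition reidemeister1 (K K' : diagram) : Prop :=
  exists J : R * R,
    let I := [:: J] in
    [/\ local_change I K K', inner_crossings I K = [::] &
        exists c, [/\ inner_crossings I K' = [:: c], inside J c.1 & inside J c.2]].

Definition reidemeister2 (K K' : diagram) : Prop :=
  exists Jo Ju : R * R,
    let I := [:: Jo; Ju] in
    [/\ local_change I K K', inner_crossings I K = [::] &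
        exists c d,
          [/\ perm_eq (inner_crossings I K') [:: c; d],
              inside Jo c.1 && inside Ju c.2,
              inside Jo d.1 && inside Ju d.2 &
              crossing_sign K' c = - crossing_sign K' d]].

Definition reidemeister3 (K K' : diagram) : Prop :=
  exists Jt Jm Jb : R * R,
    let I := [:: Jt; Jm; Jb] in
    let pattern K c1 c2 c3 :=
      [/\ perm_eq (inner_crossings I K) [:: c1; c2; c3],
          inside Jt c1.1 && inside Jm c1.2,
          inside Jt c2.1 && inside Jb c2.2 &
          inside Jm c3.1 && inside Jb c3.2] in
    local_change I K K' /\
    exists c1 c2 c3 c1' c2' c3',
      [/\ pattern K c1 c2 c3, pattern K' c1' c2' c3' &
          [/\ crossing_sign K c1 = crossing_sign K' c1',
              crossing_sign K c2 = crossing_sign K' c2' &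
              crossing_sign K c3 = crossing_sign K' c3']].

Inductive knotoid_equiv : diagram -> diagram -> Prop :=
| equiv_isotopic K K' : isotopic K K' -> knotoid_equiv K K'
| equiv_R1 K K' : reidemeister1 K K' -> knotoid_equiv K K'
| equiv_R2 K K' : reidemeister2 K K' -> knotoid_equiv K K'
| equiv_R3 K K' : reidemeister3 K K' -> knotoid_equiv K K'
| equiv_refl K : knotoid_equiv K K
| equiv_sym K K' : knotoid_equiv K K' -> knotoid_equiv K' K
| equiv_trans K K' K'' :
    knotoid_equiv K K' -> knotoid_equiv K' K'' -> knotoid_equiv K K''.

Record knotoid := Knotoid {
  represents : set diagram;
  knotoid_class : exists K, represents = knotoid_equiv K }.

Definition attainable (k : knotoid) (s : seq bool) : Prop :=
  exists K : diagram, represents k K /\ exists a : shortcut K, s = Seq a.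

(* The n-writhe of any shortcut diagram representing k. *)
Definition writhe (k : knotoid) (n : int) : int :=
  xget 0 [set m | exists K : diagram, represents k K /\
                  exists a : shortcut K, m = diagram_writhe a n].

(* The sum is over the finitely many n with a nonzero term. *)
Definition index_polynomial (k : knotoid) : laurent :=
  \sum_(n \in [set n : int | n != 0])
    (laurent_monomial n - laurent_monomial 0) *~ writhe k n.

End Sphere.

(* Main.v *)
(* The index of a crossing c is the winding number of its loop around the punctured
   sphere S^2 - {v_0, v_1}: projecting stereographically from v_1, this is the winding
   number around the image of v_0, and it no longer refers to a shortcut.

   It agrees with [Ind a c]: writing F for the projection, the map
   (t, u) |-> F (K t) - F (a u) on [c.1, c.2] x [0, u1] vanishes exactly at the hits of
   the loop with the shortcut a, where its local degree is the sign of the hit.  The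
   argument principle equates the number of turns of this map along the boundary of the
   rectangle with the sum of these signs; the two vertical sides cancel, the bottom side
   contributes the winding number around F (v_0), and for u1 close to 1 the top side
   contributes 0.

   The signed count of the crossings of index n <> 0 is then a knotoid invariant.  An
   isotopy moves the loops and the punctures continuously, together with a frame of the
   tangent plane at v_1.  A local move takes place in a round disc that misses v_0 and
   v_1, whose image under F is separated from F (v_0) by a line; so the argument of
   F (K t) - F (v_0) varies by less than pi within the disc, and integrality shows that
   the indices of corresponding crossings agree, that the two crossings of a second move
   have the same index, and that the crossing of a first move has index 0.

   Hence, if J_n(k) <> 0, any shortcut diagram (K, a) of k has a crossing c of index n,
   and the hits met by the loop at c form a consecutive subsequence of Seq (K, a). *)
Require Import Defs.
From mathcomp Require Import finmap.
From mathcomp Require Import -(notations) monalg.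
From mathcomp Require Import all_boot all_order all_algebra.
From mathcomp Require Import all_classical all_reals all_analysis.
From mathcomp Require Import ring lra.
Import Order.TTheory GRing.Theory Num.Theory numFieldNormedType.Exports.
Local Open Scope classical_set_scope.
Local Open Scope ring_scope.
Set Implicit Arguments.
Unset Strict Implicit.
Unset Printing Implicit Defensive.

(** * Arguments of complex numbers *)

(** A local move changes the diagram but carries no shortcut along, and a shortcut of one diagram
    need not be one of the next; this forces an index that is defined without shortcuts. Every
    winding number below is the variation of a continuous argument, and arguments are determined
    only up to multiples of [2 * pi]. So each equality of indices is proved in one of two ways: two
    variations that are multiples of [2 * pi] differ by less than [2 * pi], or such a multiple
    varies continuously along a family. The projection is used with its denominators cleared. They
    are positive, so arguments do not change, and the coordinates become polynomial in the points of
    the curves. The map whose zeros are counted is only real differentiable. Its local factors are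
    therefore invertible real-linear maps of the plane, whose determinants give the signs of the
    zeros. *)

Section Polar.
Variable R : realType.
Implicit Types a b c d x y u v : R.
Local Notation tau := (2 * @pi R).

(* [x] is an argument of the complex number [a + i b]. *)
Definition polar a b x : Prop :=
  exists2 r : R, 0 < r & a = r * cos x /\ b = r * sin x.

Lemma cosDint x (n : int) : cos (x + tau * n%:~R) = cos x.
Proof.
have cper (k : nat) z : cos (z + tau * k%:R) = cos z :> R.
  have -> : tau * k%:R = (pi *+ 2) *+ k :> R.
    by rewrite -[pi *+ 2]mulr_natl -[RHS]mulr_natr.
  by rewrite (periodicn (@cosD2pi R)).
case: n => k; first exact: cper.
rewrite NegzE mulrNz mulrN.
by have := cper k.+1 (x - tau * k.+1%:R); rewrite subrK => <-.
Qed.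

Lemma cos_int (n : int) : cos (tau * n%:~R) = 1.
Proof. by rewrite -[tau * _]add0r cosDint cos0. Qed.

(** Reduce [x] to [y] in [[0, tau)]. If [y] were nonzero, [sin (y / 2)] would be positive, against
    [cos y = 1 - 2 * sin (y / 2) ^+ 2]. *)
Lemma cos_eq1 x : cos x = 1 -> exists n : int, x = tau * n%:~R.
Proof.
move=> cx.
pose n := Num.floor (x / tau).
have pi2 : 0 < tau by rewrite mulr_gt0 ?pi_gt0.
pose y := x - tau * n%:~R.
have yb : 0 <= y < tau.
  rewrite /y subr_ge0 ltrBlDr; apply/andP; split.
    by rewrite mulrC -ler_pdivlMr // floor_le.
  have -> : tau + tau * n%:~R = (n + 1)%:~R * tau.
    by rewrite mulrzDr; ring.
  by rewrite -ltr_pdivrMr // floorD1_gt.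
have cy : cos y = 1 by rewrite /y -mulrN -mulrNz cosDint.
have [y0|y0] := eqVneq y 0.
  by exists n; apply/eqP; rewrite -subr_eq0; apply/eqP.
have s0 : 0 < sin (y / 2) by apply: sin_gt0_pi; lra.
have E : cos y = cos (y / 2) ^+ 2 *+ 2 - 1.
  by rewrite -cos_mulr2n mulr2n -splitr.
rewrite cy in E.
have := sin2cos2 (y / 2) => E'.
have : 0 < sin (y / 2) ^+ 2 by rewrite exprn_gt0.
by rewrite E'; move: E; rewrite mulr2n; lra.
Qed.

Lemma sin_cos1 x : cos x = 1 -> sin x = 0.
Proof. by move=> cx; apply: cos1sin0; rewrite cx normr1. Qed.

Lemma polar_exists a b : (a != 0) || (b != 0) -> exists x, polar a b x.
Proof.
move=> ab0.
have n0 : 0 < a ^+ 2 + b ^+ 2.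
  rewrite lt_def addr_ge0 ?sqr_ge0 // andbT paddr_eq0 ?sqr_ge0 //.
  by rewrite !sqrf_eq0 negb_and.
pose r := Num.sqrt (a ^+ 2 + b ^+ 2).
have r0 : 0 < r by rewrite sqrtr_gt0.
have r2 : r ^+ 2 = a ^+ 2 + b ^+ 2 by rewrite sqr_sqrtr // ltW.
have ar : -1 <= a / r <= 1.
  rewrite ler_pdivlMr // ler_pdivrMr // mulN1r mul1r -ler_norml.
  rewrite -(@ler_pXn2r _ 2) ?nnegrE ?normr_ge0 ?(ltW r0) //.
  by rewrite real_normK ?num_real // r2 lerDl sqr_ge0.
have sr : sin (acos (a / r)) = `|b| / r.
  rewrite sin_acos //.
  have -> : 1 - (a / r) ^+ 2 = (`|b| / r) ^+ 2.
    rewrite !exprMn !exprVn real_normK ?num_real // r2.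
    by field; rewrite gt_eqF // -r2 exprn_gt0.
  by rewrite sqrtr_sqr ger0_norm // divr_ge0 // ltW.
have cr : cos (acos (a / r)) = a / r by rewrite acosK.
have rn0 : r != 0 by rewrite gt_eqF.
have [b0|b0] := leP 0 b.
  exists (acos (a / r)), r => //.
  by rewrite cr sr ger0_norm // !(mulrC r) !divfK.
exists (- acos (a / r)), r => //.
by rewrite cosN sinN cr sr ltr0_norm // mulNr opprK !(mulrC r) !divfK.
Qed.

(** The conjugate of the first number times the second has argument [y - x]; its real part is the
    inner product and its imaginary part the determinant. *)
Lemma polar_cosB a b c d x y : polar a b x -> polar c d y ->
  exists2 r : R, 0 < r & a * c + b * d = r * cos (y - x) /\ a * d - b * c = r * sin (y - x).
Proof.
move=> [r r0 [-> ->]] [s s0 [-> ->]]; exists (r * s); first exact: mulr_gt0.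
by rewrite cosB sinB; split; ring.
Qed.

Lemma polar_cos_gt0 a b c d x y : polar a b x -> polar c d y ->
  0 < a * c + b * d -> 0 < cos (y - x).
Proof.
move=> h1 h2; have [r r0 [-> _]] := polar_cosB h1 h2.
by rewrite pmulr_rgt0.
Qed.

Lemma polar_sin_gt0 a b c d x y : polar a b x -> polar c d y ->
  0 < a * d - b * c -> 0 < sin (y - x).
Proof.
move=> h1 h2; have [r r0 [_ ->]] := polar_cosB h1 h2.
by rewrite pmulr_rgt0.
Qed.

Lemma polar_neq0 a b x : polar a b x -> 0 < a ^+ 2 + b ^+ 2.
Proof.
move=> [r r0 [-> ->]].
by rewrite !exprMn -mulrDr cos2Dsin2 mulr1 exprn_gt0.
Qed.

Lemma polar_uniq a b x y : polar a b x -> polar a b y -> cos (y - x) = 1.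
Proof.
move=> h1 h2; have [r r0 [E1 E2]] := polar_cosB h1 h2.
have c0 : 0 < cos (y - x).
  by apply: (polar_cos_gt0 h1 h2); rewrite -!expr2; apply: polar_neq0 h1.
have s0 : sin (y - x) = 0.
  by apply/eqP; move/eqP: E2; rewrite [b * a]mulrC subrr eq_sym mulf_eq0 gt_eqF.
by have := sin0cos1 s0; rewrite gtr0_norm.
Qed.

Lemma polar_mul a b c d x y : polar a b x -> polar c d y ->
  polar (a * c - b * d) (b * c + a * d) (x + y).
Proof.
move=> [r r0 [-> ->]] [s s0 [-> ->]]; exists (r * s); first exact: mulr_gt0.
by rewrite cosD sinD; split; ring.
Qed.

Lemma polar_scale r a b x : 0 < r -> polar a b x -> polar (r * a) (r * b) x.
Proof.
by move=> r0 [s s0 [-> ->]]; exists (r * s); rewrite ?mulr_gt0 // !mulrA.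
Qed.

Lemma polar_div a b c d x y : polar a b x -> polar c d y ->
  polar ((a * c + b * d) / (c ^+ 2 + d ^+ 2))
        ((b * c - a * d) / (c ^+ 2 + d ^+ 2)) (x - y).
Proof.
move=> h1 h2; have n0 := polar_neq0 h2.
have h2' : polar c (- d) (- y).
  by move: h2 => [s s0 [-> ->]]; exists s => //; rewrite cosN sinN mulrN.
have := polar_mul h1 h2'; rewrite !mulrN opprK => h.
by rewrite !(mulrC _ _^-1); apply: polar_scale => //; rewrite invr_gt0.
Qed.

Lemma polar_atan a b : 0 < a -> polar a b (atan (b / a)).
Proof.
move=> a0; exists (a / cos (atan (b / a))).
  rewrite divr_gt0 // cos_gt0_pihalf // atan_gtNpi2 atan_ltpi2 //.
have c0 : cos (atan (b / a)) != 0.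
  by rewrite gt_eqF // cos_gt0_pihalf // atan_gtNpi2 atan_ltpi2.
split; first by rewrite divfK.
rewrite mulrAC -mulrA -[_ * _^-1]/(tan _) atanK mulrC divfK // gt_eqF //.
Qed.

Lemma polar_conj a b x : polar a b x -> polar a (- b) (- x).
Proof. by move=> [r r0 [-> ->]]; exists r => //; rewrite cosN sinN mulrN. Qed.

End Polar.

(** * Continuous choices of the argument *)
Section PointwiseContinuity.
Variables (R : realType) (T : topologicalType) (x : T).
Implicit Types f g : T -> R.

Lemma contD f g : {for x, continuous f} -> {for x, continuous g} ->
  {for x, continuous (fun y => f y + g y)}.
Proof. by move=> cf cg; apply: (cvgD cf cg). Qed.

Lemma contB f g : {for x, continuous f} -> {for x, continuous g} ->
  {for x, continuous (fun y => f y - g y)}.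
Proof. by move=> cf cg; apply: (cvgB cf cg). Qed.

Lemma contN f : {for x, continuous f} -> {for x, continuous (fun y => - f y)}.
Proof. by move=> cf; apply: (cvgN cf). Qed.

Lemma contM f g : {for x, continuous f} -> {for x, continuous g} ->
  {for x, continuous (fun y => f y * g y)}.
Proof. by move=> cf cg; apply: (cvgM cf cg). Qed.

Lemma contV f : f x != 0 -> {for x, continuous f} ->
  {for x, continuous (fun y => (f y)^-1)}.
Proof. by move=> f0 cf; apply: (cvgV f0 cf). Qed.

Lemma contX f n : {for x, continuous f} ->
  {for x, continuous (fun y => f y ^+ n)}.
Proof.
move=> cf; elim: n => [|n IH].
  have -> : (fun y => f y ^+ 0) = fun=> 1 by apply/funext => y; rewrite expr0.
  exact: cvg_cst.
have -> : (fun y => f y ^+ n.+1) = (fun y => f y * f y ^+ n).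
  by apply/funext => y; rewrite exprS.
exact: contM.
Qed.

Lemma cont_norm f : {for x, continuous f} ->
  {for x, continuous (fun y => `|f y|)}.
Proof. by move=> cf; apply: (@cvg_norm _ R). Qed.

Lemma cont_cst (a : R) : {for x, continuous (fun _ : T => a)}.
Proof. exact: cvg_cst. Qed.

Lemma cont_pair (U V : topologicalType) (f : T -> U) (g : T -> V) :
  {for x, continuous f} -> {for x, continuous g} ->
  {for x, continuous (fun y => (f y, g y))}.
Proof. by move=> cf cg; apply: cvg_pair. Qed.

End PointwiseContinuity.

Lemma cont_comp (T U W : topologicalType) (x : T) (f : T -> U) (g : U -> W) :
  {for x, continuous f} -> {for f x, continuous g} ->
  {for x, continuous (fun y => g (f y))}.
Proof. exact: continuous_comp. Qed.

Lemma cont_fst (U V : topologicalType) (x : U * V) : {for x, continuous fst}.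
Proof. exact: cvg_fst. Qed.

Lemma cont_snd (U V : topologicalType) (x : U * V) : {for x, continuous snd}.
Proof. exact: cvg_snd. Qed.

Lemma cont_comp_fst (U V W : topologicalType) (x : U * V) (f : U -> W) :
  {for x.1, continuous f} -> {for x, continuous (fun y => f y.1)}.
Proof. exact: (cont_comp (@cont_fst _ _ _)). Qed.

Lemma cont_comp_snd (U V W : topologicalType) (x : U * V) (f : V -> W) :
  {for x.2, continuous f} -> {for x, continuous (fun y => f y.2)}.
Proof. exact: (cont_comp (@cont_snd _ _ _)). Qed.

(** A difference is a sum with an opposite, so its case must precede that of sums. Subterms that
    match no case are left to the caller. *)
Ltac cont :=
  lazymatch goal with
  | |- prop_for _ (inPhantom (continuous ?f)) =>
    lazymatch f with
    | (fun y => @Algebra.add _ (@?a y) (@Algebra.opp _ (@?b y))) => apply: contB; cont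
    | (fun y => @Algebra.add _ (@?a y) (@?b y)) => apply: contD; cont
    | (fun y => @Algebra.opp _ (@?b y)) => apply: contN; cont
    | (fun y => @GRing.mul _ (@?a y) (@?b y)) => apply: contM; cont
    | (fun y => @GRing.exp _ (@?a y) _) => apply: contX; cont
    | (fun _ => ?c) => exact: cvg_cst
    | @fst _ _ => exact: cont_fst
    | @snd _ _ => exact: cont_snd
    | (fun y => y) => exact: cvg_id
    | _ => try assumption
    end
  end.

Section Lift.
Variable R : realType.
Local Notation tau := (2 * @pi R).

Lemma pointwise_within (f : R -> R) l r :
  (forall t, l <= t <= r -> {for t, continuous f}) ->
  {within `[l, r], continuous f}.
Proof.
move=> cf; apply: continuous_in_subspaceT => t; rewrite inE /= in_itv /=.
exact: cf.
Qed.

Lemma IVT_pointwise (f : R -> R) l r v : l <= r ->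
  (forall t, l <= t <= r -> {for t, continuous f}) ->
  (f l <= v <= f r) || (f r <= v <= f l) -> exists2 c, l <= c <= r & f c = v.
Proof.
move=> lr /pointwise_within cf h.
have [|c] := IVT (v := v) lr cf; last by rewrite in_itv /= => ? ?; exists c.
by rewrite ge_min le_max; case/orP: h => /andP[-> ->]; rewrite ?orbT.
Qed.

(** If [f] moved by [pi] or more, it would take the value [f l + pi] or [f l - pi], where the cosine
    is [- cos (f l)]. *)
Lemma cos_gt0_range (f : R -> R) l r : l <= r ->
  (forall t, l <= t <= r -> {for t, continuous f}) ->
  (forall t, l <= t <= r -> 0 < cos (f t)) -> `|f r - f l| < pi.
Proof.
move=> lr cf pf; rewrite ltNge; apply/negP => h.
have pi0 := pi_gt0 R.
have fl := pf l; rewrite lexx lr in fl; have {}fl := fl isT.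
have [h1|h1] : f l + pi <= f r \/ f r <= f l - pi.
  by move: h; rewrite ler_normr; case/orP; [left|right]; lra.
- have [|c cb E] := @IVT_pointwise f l r (f l + pi) lr cf; first by apply/orP; left; lra.
  by have := pf c cb; rewrite E cosDpi; lra.
- have [|c cb E] := @IVT_pointwise f l r (f l - pi) lr cf; first by apply/orP; right; lra.
  by have := pf c cb; have := cosDpi (f l - pi); rewrite subrK E; lra.
Qed.

Lemma cos_eq1_small (x : R) : cos x = 1 -> `|x| < tau -> x = 0.
Proof.
move=> /cos_eq1[n ->]; have pi0 := pi_gt0 R.
rewrite normrM gtr0_norm ?mulr_gt0 // gtr_pMr ?mulr_gt0 //.
rewrite -intr_norm -[1]/(1%:~R) ltr_int.
by case: n => [[|n]|n] //; rewrite ?mulr0.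
Qed.

Lemma cosB_eq1 (x y : R) : cos x = 1 -> cos y = 1 -> cos (x - y) = 1.
Proof. by move=> cx cy; rewrite cosB cx cy (sin_cos1 cx) mul0r addr0 mulr1. Qed.

(** Constancy of a multiple of [tau] whose behaviour between the ends is controlled only weakly:
    moving by [pi] or more would mean passing through [f l + pi] or [f l - pi], where the cosine is
    -1. *)
Lemma cos_neqN1_range (f : R -> R) l r : l <= r ->
  (forall t, l <= t <= r -> {for t, continuous f}) ->
  (forall t, l <= t <= r -> cos (f t) != -1) ->
  cos (f l) = 1 -> cos (f r) = 1 -> f l = f r.
Proof.
move=> lr cf pf cl cr; apply/eqP; rewrite -subr_eq0; apply/eqP.
have pi0 := pi_gt0 R.
apply: cos_eq1_small; first exact: cosB_eq1.
rewrite ltNge; apply/negP => h.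
have [h1|h1] : f l + pi <= f r \/ f r <= f l - pi.
  by move: h; rewrite ler_normr; case/orP; [right|left]; lra.
- have [|c cb E] := @IVT_pointwise f l r (f l + pi) lr cf; first by apply/orP; left; lra.
  by have := pf c cb; rewrite E cosDpi cl eqxx.
- have [|c cb E] := @IVT_pointwise f l r (f l - pi) lr cf; first by apply/orP; right; lra.
  by have := pf c cb; have := cosDpi (f l - pi); rewrite subrK E cl => ->; rewrite opprK eqxx.
Qed.

(** Continuity is two-sided even at [l] and [r], so lifts restrict and compose without subspace
    topologies. *)
Definition arg_lift (f1 f2 theta : R -> R) (l r : R) : Prop :=
  forall t, l <= t <= r ->
    {for t, continuous theta} /\ polar (f1 t) (f2 t) (theta t).

Lemma lift_sub f1 f2 th l r l' r' : l <= l' -> r' <= r ->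
  arg_lift f1 f2 th l r -> arg_lift f1 f2 th l' r'.
Proof. by move=> h1 h2 H t ht; apply: H; lra. Qed.

Lemma lift_uniq f1 f2 th th' l r : l <= r ->
  arg_lift f1 f2 th l r -> arg_lift f1 f2 th' l r -> th r - th l = th' r - th' l.
Proof.
move=> lr H H'.
have E : forall t, l <= t <= r -> cos (th' t - th t) = 1.
  by move=> t ht; apply: polar_uniq (H t ht).2 (H' t ht).2.
have : th' l - th l = th' r - th r.
  apply: (@cos_neqN1_range (fun t => th' t - th t) l r) => //.
  - by move=> t ht; apply: contB; [exact: (H' t ht).1|exact: (H t ht).1].
  - by move=> t ht; rewrite E //; lra.
  - by apply: E; rewrite lexx.
  - by apply: E; rewrite lexx andbT.
by lra.
Qed.

(** A positive inner product means that the quotient of the two numbers has positive real part. Its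
    argument is then an arctangent, which depends continuously on both numbers. *)
Lemma polar_step (a b c d x : R) : polar a b x -> 0 < a * c + b * d ->
  polar c d (x + atan ((a * d - b * c) / (a * c + b * d))).
Proof.
move=> h n0; have a0 := polar_neq0 h.
have := polar_mul h (polar_atan (a * d - b * c) n0).
move=> /(polar_scale (r := (a ^+ 2 + b ^+ 2)^-1)); rewrite invr_gt0 => /(_ a0).
have -> : (a ^+ 2 + b ^+ 2)^-1 * (a * (a * c + b * d) - b * (a * d - b * c)) = c.
  by field; rewrite gt_eqF.
have -> // : (a ^+ 2 + b ^+ 2)^-1 * (b * (a * c + b * d) + a * (a * d - b * c)) = d.
by field; rewrite gt_eqF.
Qed.

Lemma clamp_id (l r x : R) : l <= x <= r -> Num.max l (Num.min r x) = x.
Proof. by move=> /andP[h1 h2]; rewrite (min_idPr h2) (max_idPr h1). Qed.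

Lemma clamp_in (l r x : R) : l <= r -> l <= Num.max l (Num.min r x) <= r.
Proof. by move=> lr; rewrite le_max lexx /= ge_max lr ge_min lexx. Qed.

Lemma cont_clamp (l r x : R) : {for x, continuous (fun y => Num.max l (Num.min r y))}.
Proof.
apply: (@continuous_max R R (fun=> l)); first exact: cvg_cst.
by apply: (@continuous_min R R (fun=> r)); [exact: cvg_cst|exact: cvg_id].
Qed.

(** Near each point of the diagonal the inner product of two values is close to a positive squared
    norm; compactness makes the radius uniform over the rectangle. *)
Lemma rectangle_step (f1 f2 : R * R -> R) (l r b d : R) :
  (forall P : R * R, l <= P.1 <= r -> b <= P.2 <= d ->
     [/\ {for P, continuous f1}, {for P, continuous f2} & (f1 P != 0) || (f2 P != 0)]) ->
  exists2 e : R, 0 < e & forall P Q : R * R, l <= P.1 <= r -> b <= P.2 <= d ->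
    ball P e Q -> 0 < f1 Q * f1 P + f2 Q * f2 P.
Proof.
move=> H.
have cK : compact (`[l, r]%classic `*` `[b, d]%classic : set (R * R)).
  by apply: compact_setX; exact: segment_compact.
have {cK} := (compact_near_coveringP _).1 cK R (0:R)^'+
  (fun e P => forall Q, ball P e Q -> 0 < f1 Q * f1 P + f2 Q * f2 P) _.
case.
  move=> P [/=]; rewrite !in_itv /= => h1 h2.
  have [c1 c2 n0] := H P h1 h2.
  (* Both points must move: the covering argument varies the center of the ball as well. *)
  pose g (PQ : (R * R) * (R * R)) := f1 PQ.2 * f1 PQ.1 + f2 PQ.2 * f2 PQ.1.
  have cg : {for (P, P), continuous g}.
    have cs (f : R * R -> R) : {for P, continuous f} ->
        {for (P, P), continuous (fun PQ : (R * R) * (R * R) => f PQ.2)}.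
      by move=> cf; exact: (@cont_comp_snd _ _ _ (P, P) f cf).
    have cf (f : R * R -> R) : {for P, continuous f} ->
        {for (P, P), continuous (fun PQ : (R * R) * (R * R) => f PQ.1)}.
      by move=> cf; exact: (@cont_comp_fst _ _ _ (P, P) f cf).
    by rewrite /g; cont; first [exact: cs|exact: cf].
  have gP : 0 < g (P, P).
    rewrite /g /= -!expr2 lt_def addr_ge0 ?sqr_ge0 // andbT.
    by rewrite paddr_eq0 ?sqr_ge0 // !sqrf_eq0 negb_and.
  have : \forall x \near (P, P), 0 < g x by exact: (cvgr_gt (g (P, P)) cg).
  move=> /nbhs_ballP[e /= e0 he].
  have e20 : 0 < e / 2 by rewrite divr_gt0.
  exists (ball P (e / 2), [set e' | 0 < e'] `&` [set e' | e' < e / 2]).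
    split; first exact: nbhsx_ballx.
    apply: filterI; first exact: nbhs_right_gt.
    exact: nbhs_right_lt.
  move=> [X e'] [/= PX [e'0 e'e]] Q XQ.
  apply: (he (X, Q)); split => /=.
    by apply: le_ball PX; rewrite ler_pdivrMr // ler_peMr ?ler1n // ltW.
  rewrite [e]splitr; apply: ball_triangle PX _.
  by apply: le_ball XQ; rewrite ltW.
move=> /= e e0 he.
exists (e / 2); first by rewrite divr_gt0.
move=> P Q h1 h2; apply: (he (e / 2)).
- by rewrite /ball /= sub0r normrN gtr0_norm ?divr_gt0 // ltr_pdivrMr // ltr_pMr ?ltr1n.
- by rewrite divr_gt0.
- by split; rewrite /= in_itv.
Qed.

End Lift.

Section RectangleLift.
Variable R : realType.
Local Notation tau := (2 * @pi R).

Lemma rectangle_lift (f1 f2 : R * R -> R) (l r b d : R) : l <= r -> b <= d ->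
  (forall P : R * R, l <= P.1 <= r -> b <= P.2 <= d ->
     [/\ {for P, continuous f1}, {for P, continuous f2} & (f1 P != 0) || (f2 P != 0)]) ->
  exists2 th : R * R -> R, (forall P, {for P, continuous th}) &
    forall P, l <= P.1 <= r -> b <= P.2 <= d -> polar (f1 P) (f2 P) (th P).
Proof.
move=> lr bd H.
have [e e0 He] := rectangle_step H.
(* With [N] steps, each one is shorter than [e] in both coordinates, whatever the end point [P]. *)
pose N := Num.bound ((r - l + (d - b)) / e).
have rl0 : 0 <= r - l by rewrite subr_ge0.
have db0 : 0 <= d - b by rewrite subr_ge0.
have S0 : 0 <= (r - l + (d - b)) / e.
  by rewrite divr_ge0 ?(addr_ge0 rl0 db0) // ltW.
have N0 : (r - l + (d - b)) / e < N%:R by exact: archi_boundP.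
have Np : 0 < N%:R :> R by exact: le_lt_trans N0.
rewrite ltr_pdivrMr // in N0.
(* The argument is accumulated in N small steps along the segment from (l, b) to P. *)
pose path (k : nat) (P : R * R) := (l + k%:R / N%:R * (P.1 - l), b + k%:R / N%:R * (P.2 - b)).
(* Clamping to the rectangle makes the lift continuous at every point of the plane, the boundary of
   the rectangle included. *)
pose cl (P : R * R) := (Num.max l (Num.min r P.1), Num.max b (Num.min d P.2)).
have cl_id P : l <= P.1 <= r -> b <= P.2 <= d -> cl P = P.
  by move=> h1 h2; rewrite /cl !clamp_id // -surjective_pairing.
have cl1 P : l <= (cl P).1 <= r by exact: clamp_in.
have cl2 P : b <= (cl P).2 <= d by exact: clamp_in.
have ccl P : {for P, continuous cl}.
  apply: cont_pair.
    exact: (@cont_comp_fst _ _ _ P _ (@cont_clamp _ l r _)).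
  exact: (@cont_comp_snd _ _ _ P _ (@cont_clamp _ b d _)).
have cpath k P : {for P, continuous (path k)}.
  by rewrite /path; apply: cont_pair; cont.
have inpath k P : (k <= N)%N -> l <= P.1 <= r -> b <= P.2 <= d ->
    l <= (path k P).1 <= r /\ b <= (path k P).2 <= d.
  move=> kN h1 h2 /=.
  have q0 : 0 <= k%:R / N%:R :> R by rewrite divr_ge0.
  have q1 : k%:R / N%:R <= 1 :> R by rewrite ler_pdivrMr // mul1r ler_nat.
  by split; apply/andP; split; nra.
have stepball k P : l <= P.1 <= r -> b <= P.2 <= d -> ball (path k.+1 P) e (path k P).
  move=> h1 h2.
  have E (x y : R) : x + k.+1%:R / N%:R * y - (x + k%:R / N%:R * y) = y / N%:R.
    by rewrite -natr1; field; rewrite gt_eqF.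
  by split; rewrite /ball /= E ger0_norm ?divr_ge0 ?ltr_pdivrMr // ?ler0n //; lra.
suff S k : (k <= N)%N -> exists2 th : R * R -> R, (forall P, {for P, continuous th}) &
    forall P, polar (f1 (path k (cl P))) (f2 (path k (cl P))) (th P).
  have [th cth Hth] := S N (leqnn N).
  exists th => // P h1 h2; have := Hth P; rewrite cl_id //.
  have -> // : path N P = P.
  by rewrite /path divff ?gt_eqF // !mul1r !subrKC -surjective_pairing.
elim: k => [_|k IH kN].
  have [_ _ n0] := H (l, b) (introT andP (conj (lexx l) lr)) (introT andP (conj (lexx b) bd)).
  have [x hx] := polar_exists n0.
  exists (fun=> x); first by move=> P; exact: cvg_cst.
  by move=> P; rewrite /path !mul0r !addr0.
have [th cth Hth] := IH (ltnW kN).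
pose den Q := f1 (path k Q) * f1 (path k.+1 Q) + f2 (path k Q) * f2 (path k.+1 Q).
pose num Q := f1 (path k Q) * f2 (path k.+1 Q) - f2 (path k Q) * f1 (path k.+1 Q).
have den0 P : 0 < den (cl P).
  have [i1 i2] := inpath k.+1 (cl P) kN (cl1 P) (cl2 P).
  apply: He => //; exact: stepball.
have cf i (g := if i then f1 else f2) j : (j <= N)%N ->
    forall P, {for P, continuous (fun Q => g (path j (cl Q)))}.
  move=> jN P; have [i1 i2] := inpath j (cl P) jN (cl1 P) (cl2 P).
  have [c1 c2 _] := H _ i1 i2.
  apply: (@cont_comp _ _ _ P (fun Q => path j (cl Q)) g).
    exact: cont_comp (ccl P) (cpath j (cl P)).
  by rewrite /g; case: (i).
exists (fun P => th P + atan (num (cl P) / den (cl P))).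
  move=> P; apply: contD; first exact: cth.
  apply: cont_comp; last exact: continuous_atan.
  have c1 := cf true k (ltnW kN) P; have c2 := cf false k (ltnW kN) P.
  have c1' := cf true k.+1 kN P; have c2' := cf false k.+1 kN P.
  apply: contM; first by rewrite /num; cont.
  by apply: contV; [rewrite gt_eqF|rewrite /den; cont].
by move=> P; apply: polar_step (Hth P) _; exact: den0.
Qed.

Lemma lift_exists (f1 f2 : R -> R) (l r : R) : l <= r ->
  (forall t, l <= t <= r ->
     [/\ {for t, continuous f1}, {for t, continuous f2} & (f1 t != 0) || (f2 t != 0)]) ->
  exists2 th : R -> R, (forall t, {for t, continuous th}) & arg_lift f1 f2 th l r.
Proof.
move=> lr H.
have [|th cth Hth] := @rectangle_lift (fun P => f1 P.1) (fun P => f2 P.1) l r 0 0 lr (lexx 0).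
  move=> P h1 _; have [c1 c2 n0] := H P.1 h1.
  by split=> //; [exact: cont_comp_fst c1|exact: cont_comp_fst c2].
have cth' t : {for t, continuous (fun s => th (s, 0))}.
  by apply: cont_comp; [apply: cont_pair; cont|exact: cth].
exists (fun t => th (t, 0)) => // t ht; split => //.
by apply: (Hth (t, 0)); rewrite //= lexx.
Qed.

(* [n] counts the turns of [f] along the positively oriented boundary of the
   rectangle [l, r] x [b, d]. *)
Definition boundary_turns (f1 f2 : R * R -> R) (l r b d : R) (n : int) : Prop :=
  forall thb tht thl thr : R -> R,
    arg_lift (fun t => f1 (t, b)) (fun t => f2 (t, b)) thb l r ->
    arg_lift (fun t => f1 (t, d)) (fun t => f2 (t, d)) tht l r ->
    arg_lift (fun u => f1 (l, u)) (fun u => f2 (l, u)) thl b d ->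
    arg_lift (fun u => f1 (r, u)) (fun u => f2 (r, u)) thr b d ->
    (thb r - thb l) + (thr d - thr b) - (tht r - tht l) - (thl d - thl b)
      = tau * n%:~R.

(** Without zeros one argument is defined on the whole rectangle, and its variations along the four
    sides cancel. *)
Lemma boundary_turns0 (f1 f2 : R * R -> R) (l r b d : R) : l <= r -> b <= d ->
  (forall P : R * R, l <= P.1 <= r -> b <= P.2 <= d ->
     [/\ {for P, continuous f1}, {for P, continuous f2} & (f1 P != 0) || (f2 P != 0)]) ->
  boundary_turns f1 f2 l r b d 0.
Proof.
move=> lr bd H thb tht thl thr Hb Ht Hl Hr.
have [th cth Hth] := rectangle_lift lr bd H.
have hor u : b <= u <= d -> arg_lift (fun t => f1 (t, u)) (fun t => f2 (t, u)) (fun t => th (t, u)) l r.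
  move=> hu t ht; split; last exact: (Hth (t, u)).
  by apply: cont_comp; [apply: cont_pair; cont|exact: cth].
have ver t : l <= t <= r -> arg_lift (fun u => f1 (t, u)) (fun u => f2 (t, u)) (fun u => th (t, u)) b d.
  move=> ht u hu; split; last exact: (Hth (t, u)).
  by apply: cont_comp; [apply: cont_pair; cont|exact: cth].
rewrite (lift_uniq lr Hb (hor b _)) ?lexx // (lift_uniq lr Ht (hor d _)) ?lexx ?andbT //.
rewrite (lift_uniq bd Hl (ver l _)) ?lexx // (lift_uniq bd Hr (ver r _)) ?lexx ?andbT //.
by rewrite mulr0; ring.
Qed.

(** The inner product of the moving point with [(b2, - b1)] is the constant [a1 * b2 - a2 * b1], so
    the line stays in an open half-plane and turns by less than [pi]. The determinant of the end
    points gives the direction of the turn. *)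
Lemma lift_affine (a1 a2 b1 b2 : R) (f1 f2 th : R -> R) l r : l < r ->
  (forall t, f1 t = a1 + t * b1) -> (forall t, f2 t = a2 + t * b2) ->
  0 < a1 * b2 - a2 * b1 -> arg_lift f1 f2 th l r -> 0 < th r - th l < pi.
Proof.
move=> lr E1 E2 n0 H; have pi0 := pi_gt0 R.
have [x hx] : exists x, polar b2 (- b1) x.
  apply: polar_exists; rewrite -negb_and oppr_eq0; apply/negP => /andP[/eqP h1 /eqP h2].
  by rewrite h1 h2 !mulr0 subrr ltxx in n0.
have small : `|th r - th l| < pi.
  have : `|(th r - x) - (th l - x)| < pi; last by have -> : th r - x - (th l - x) = th r - th l by ring.
  apply: (@cos_gt0_range R (fun t => th t - x) l r (ltW lr)).
    by move=> t ht; apply: contB; [exact: (H t ht).1|exact: cont_cst].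
  move=> t ht; apply: polar_cos_gt0 hx (H t ht).2 _.
  by rewrite E1 E2; nra.
have hl : l <= l <= r by rewrite lexx ltW.
have hr : l <= r <= r by rewrite lexx ltW.
have s0 : 0 < sin (th r - th l).
  apply: polar_sin_gt0 (H l hl).2 (H r hr).2 _; rewrite !E1 !E2.
  have -> : (a1 + l * b1) * (a2 + r * b2) - (a2 + l * b2) * (a1 + r * b1) =
     (r - l) * (a1 * b2 - a2 * b1) by ring.
  by rewrite mulr_gt0 // subr_gt0.
apply/andP; split; last by apply: le_lt_trans small; exact: ler_norm.
rewrite ltNge; apply/negP => h.
have : 0 <= sin (th l - th r).
  apply: sin_ge0_pi; apply/andP; split; first lra.
  by rewrite ltW //; apply: le_lt_trans small; rewrite distrC; exact: ler_norm.
by rewrite -opprB sinN; lra.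
Qed.

End RectangleLift.

(** * The argument principle *)
Section ArgumentPrinciple.
Variable R : realType.
Local Notation tau := (2 * @pi R).

Lemma lift_affine_neg (a1 a2 b1 b2 : R) (f1 f2 th : R -> R) (l r : R) : l < r ->
  (forall t, f1 t = a1 + t * b1) -> (forall t, f2 t = a2 + t * b2) ->
  a1 * b2 - a2 * b1 < 0 -> arg_lift f1 f2 th l r -> - pi < th r - th l < 0.
Proof.
move=> lr E1 E2 n0 H.
have : 0 < - th r - - th l < pi.
  apply: (@lift_affine R a1 (- a2) b1 (- b2) f1 (fun t => - f2 t) (fun t => - th t)) => //.
  - by move=> t; rewrite E2; ring.
  - by lra.
  - move=> t ht; split; first by apply: contN; exact: (H t ht).1.
    by apply: polar_conj; exact: (H t ht).2.
by lra.
Qed.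

Definition lin (a c : R) (z P : R * R) : R := a * (P.1 - z.1) + c * (P.2 - z.2).

Lemma cosD_eq1 (x y : R) : cos x = 1 -> cos y = 1 -> cos (x + y) = 1.
Proof. by move=> cx cy; rewrite cosD cx cy (sin_cos1 cx) mul0r subr0 mulr1. Qed.

(** The image of each side is a segment seen from the origin under an angle in [(0, pi)]. The total
    is a multiple of [2 * pi] strictly between 0 and [4 * pi]. *)
Lemma lin_turns_pos (a1 c1 a2 c2 : R) z (l r b d : R) :
  l < z.1 < r -> b < z.2 < d -> 0 < a1 * c2 - a2 * c1 ->
  boundary_turns (lin a1 c1 z) (lin a2 c2 z) l r b d 1.
Proof.
move=> hz1 hz2 D0 thb tht thl thr Hb Ht Hl Hr.
have lr : l < r by lra.
have bd : b < d by lra.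
have pi0 := pi_gt0 R.
have B1 : 0 < thb r - thb l < pi.
  apply: (lift_affine lr (a1 := c1 * (b - z.2) - a1 * z.1) (b1 := a1)
    (a2 := c2 * (b - z.2) - a2 * z.1) (b2 := a2) _ _ _ Hb).
  - by move=> t; rewrite /lin /=; ring.
  - by move=> t; rewrite /lin /=; ring.
  have -> : (c1 * (b - z.2) - a1 * z.1) * a2 - (c2 * (b - z.2) - a2 * z.1) * a1 =
    (a1 * c2 - a2 * c1) * (z.2 - b) by ring.
  by apply: mulr_gt0 => //; lra.
have B2 : 0 < thr d - thr b < pi.
  apply: (lift_affine bd (a1 := a1 * (r - z.1) - c1 * z.2) (b1 := c1)
    (a2 := a2 * (r - z.1) - c2 * z.2) (b2 := c2) _ _ _ Hr).
  - by move=> t; rewrite /lin /=; ring.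
  - by move=> t; rewrite /lin /=; ring.
  have -> : (a1 * (r - z.1) - c1 * z.2) * c2 - (a2 * (r - z.1) - c2 * z.2) * c1 =
    (a1 * c2 - a2 * c1) * (r - z.1) by ring.
  by apply: mulr_gt0 => //; lra.
have B3 : - pi < tht r - tht l < 0.
  apply: (lift_affine_neg lr (a1 := c1 * (d - z.2) - a1 * z.1) (b1 := a1)
    (a2 := c2 * (d - z.2) - a2 * z.1) (b2 := a2) _ _ _ Ht).
  - by move=> t; rewrite /lin /=; ring.
  - by move=> t; rewrite /lin /=; ring.
  have -> : (c1 * (d - z.2) - a1 * z.1) * a2 - (c2 * (d - z.2) - a2 * z.1) * a1 =
    - ((a1 * c2 - a2 * c1) * (d - z.2)) by ring.
  by rewrite oppr_lt0; apply: mulr_gt0 => //; lra.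
have B4 : - pi < thl d - thl b < 0.
  apply: (lift_affine_neg bd (a1 := a1 * (l - z.1) - c1 * z.2) (b1 := c1)
    (a2 := a2 * (l - z.1) - c2 * z.2) (b2 := c2) _ _ _ Hl).
  - by move=> t; rewrite /lin /=; ring.
  - by move=> t; rewrite /lin /=; ring.
  have -> : (a1 * (l - z.1) - c1 * z.2) * c2 - (a2 * (l - z.1) - c2 * z.2) * c1 =
    - ((a1 * c2 - a2 * c1) * (z.1 - l)) by ring.
  by rewrite oppr_lt0; apply: mulr_gt0 => //; lra.
set S := LHS.
have S0 : 0 < S < 4 * pi by rewrite /S; lra.
have : cos S = 1.
  have -> : S = (thb r - thr b) + (thr d - tht r) + (tht l - thl d) + (thl b - thb l).
    by rewrite /S; ring.
  have hl : l <= l <= r by rewrite lexx ltW.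
  have hr : l <= r <= r by rewrite lexx ltW.
  have hb : b <= b <= d by rewrite lexx ltW.
  have hd : b <= d <= d by rewrite lexx ltW.
  apply: cosD_eq1; last exact: polar_uniq (Hb l hl).2 (Hl b hb).2.
  apply: cosD_eq1; last exact: polar_uniq (Hl d hd).2 (Ht l hl).2.
  apply: cosD_eq1; last exact: polar_uniq (Ht r hr).2 (Hr d hd).2.
  exact: polar_uniq (Hr b hb).2 (Hb r hr).2.
move=> /cos_eq1[n nE]; rewrite nE; congr (_ * _%:~R).
move: S0; rewrite nE => /andP[].
rewrite pmulr_rgt0 ?mulr_gt0 // ltr0z => n0.
have -> : 4 * pi = tau * 2%:~R by ring.
rewrite ltr_pM2l ?mulr_gt0 // ltr_int => n2.
by case: (n) n0 n2 => [[|[|k]]|k].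
Qed.

Lemma lin_turns (a1 c1 a2 c2 : R) z (l r b d : R) :
  l < z.1 < r -> b < z.2 < d -> a1 * c2 - a2 * c1 != 0 ->
  boundary_turns (lin a1 c1 z) (lin a2 c2 z) l r b d
    (int_of_sign (0 < a1 * c2 - a2 * c1)).
Proof.
move=> hz1 hz2; rewrite neq_lt => /orP[D0|D0]; last by rewrite D0; exact: lin_turns_pos.
rewrite ltNge ltW //= => thb tht thl thr Hb Ht Hl Hr.
(* Complex conjugation reverses the orientation and negates all arguments. *)
have D0' : 0 < a1 * - c2 - - a2 * c1 by lra.
have cj (f1 f2 g2 th : R -> R) s s' : (forall t, g2 t = - f2 t) ->
    arg_lift f1 f2 th s s' -> arg_lift f1 g2 (fun t => - th t) s s'.
  move=> E H t ht; rewrite E; split; first by apply: contN; exact: (H t ht).1.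
  by apply: polar_conj; exact: (H t ht).2.
have E P : lin (- a2) (- c2) z P = - lin a2 c2 z P by rewrite /lin; ring.
have := lin_turns_pos hz1 hz2 D0' (cj _ _ _ _ _ _ _ Hb) (cj _ _ _ _ _ _ _ Ht)
  (cj _ _ _ _ _ _ _ Hl) (cj _ _ _ _ _ _ _ Hr) => /(_ _ _ _ _)/=.
rewrite /int_of_sign mulrN1z => h.
by rewrite mulrN -h ?mulr1 //; ring.
Qed.

(* Real and imaginary parts of (a + i b) / (c + i d). *)
Definition cdiv1 (a b c d : R) := (a * c + b * d) / (c ^+ 2 + d ^+ 2).
Definition cdiv2 (a b c d : R) := (b * c - a * d) / (c ^+ 2 + d ^+ 2).

(** Division by one linear factor commutes with division by another, so removing a zero leaves the
    other zeros simple. *)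
Lemma cdiv1C a b c d c' d' : cdiv1 (cdiv1 a b c d) (cdiv2 a b c d) c' d' =
  cdiv1 (cdiv1 a b c' d') (cdiv2 a b c' d') c d.
Proof.
rewrite /cdiv1 /cdiv2; set I := (c ^+ 2 + _)^-1; set I' := (c' ^+ 2 + _)^-1.
by ring.
Qed.

Lemma cdiv2C a b c d c' d' : cdiv2 (cdiv1 a b c d) (cdiv2 a b c d) c' d' =
  cdiv2 (cdiv1 a b c' d') (cdiv2 a b c' d') c d.
Proof.
rewrite /cdiv1 /cdiv2; set I := (c ^+ 2 + _)^-1; set I' := (c' ^+ 2 + _)^-1.
by ring.
Qed.

Lemma cdiv_neq0 a b c d : (a != 0) || (b != 0) -> c ^+ 2 + d ^+ 2 != 0 ->
  (cdiv1 a b c d != 0) || (cdiv2 a b c d != 0).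
Proof.
move=> ab0 cd0; rewrite -negb_and; apply/negP => /andP[].
rewrite /cdiv1 /cdiv2 !mulf_eq0 invr_eq0 (negPf cd0) !orbF => /eqP h1 /eqP h2.
have ha : a * (c ^+ 2 + d ^+ 2) = 0.
  have -> : a * (c ^+ 2 + d ^+ 2) = c * (a * c + b * d) - d * (b * c - a * d) by ring.
  by rewrite h1 h2 !mulr0 subrr.
have hb : b * (c ^+ 2 + d ^+ 2) = 0.
  have -> : b * (c ^+ 2 + d ^+ 2) = d * (a * c + b * d) + c * (b * c - a * d) by ring.
  by rewrite h1 h2 !mulr0 addr0.
move: ab0; move/eqP: ha; rewrite mulf_eq0 (negPf cd0) orbF => ->.
by move/eqP: hb; rewrite mulf_eq0 (negPf cd0) orbF => ->.
Qed.

Lemma cdiv_cvg (T : Type) (F : set_system T) {FF : Filter F} (f1 f2 g1 g2 : T -> R) (a b c d : R) :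
  c ^+ 2 + d ^+ 2 != 0 ->
  f1 x @[x --> F] --> a -> f2 x @[x --> F] --> b ->
  g1 x @[x --> F] --> c -> g2 x @[x --> F] --> d ->
  cdiv1 (f1 x) (f2 x) (g1 x) (g2 x) @[x --> F] --> cdiv1 a b c d /\
  cdiv2 (f1 x) (f2 x) (g1 x) (g2 x) @[x --> F] --> cdiv2 a b c d.
Proof.
move=> n0 h1 h2 h3 h4.
have h : (g1 x ^+ 2 + g2 x ^+ 2)^-1 @[x --> F] --> (c ^+ 2 + d ^+ 2)^-1.
  apply: cvgV n0 _.
  have -> : (fun x => g1 x ^+ 2 + g2 x ^+ 2) = (g1 \* g1 + g2 \* g2 : T -> R).
    by apply/funext => x; rewrite !expr2.
  by rewrite !expr2; apply: cvgD; apply: cvgM.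
split; apply: cvgM h; first by apply: cvgD; apply: cvgM.
by apply: cvgB; apply: cvgM.
Qed.

(** The complex quotient of [f] by an invertible real-linear map vanishing at [z] has a nonzero
    limit. The limit is not fixed to 1, because division by the linear factor of another zero
    multiplies it by a nonzero constant. *)
Definition simple_zero (f1 f2 : R * R -> R) (z : R * R) (s : bool) : Prop :=
  exists a1 c1 a2 c2 w1 w2 : R,
   [/\ a1 * c2 - a2 * c1 != 0, s = (0 < a1 * c2 - a2 * c1), (w1 != 0) || (w2 != 0),
       cdiv1 (f1 P) (f2 P) (lin a1 c1 z P) (lin a2 c2 z P) @[P --> z^'] --> w1 &
       cdiv2 (f1 P) (f2 P) (lin a1 c1 z P) (lin a2 c2 z P) @[P --> z^'] --> w2].

Lemma lin_neq0 a1 c1 a2 c2 z P : a1 * c2 - a2 * c1 != 0 -> P != z ->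
  0 < lin a1 c1 z P ^+ 2 + lin a2 c2 z P ^+ 2.
Proof.
move=> D0 Pz; rewrite lt_def addr_ge0 ?sqr_ge0 // andbT.
rewrite paddr_eq0 ?sqr_ge0 // !sqrf_eq0; apply: contra Pz => /andP[/eqP h1 /eqP h2].
have e1 : (a1 * c2 - a2 * c1) * (P.1 - z.1) = 0.
  have -> : (a1 * c2 - a2 * c1) * (P.1 - z.1) = c2 * lin a1 c1 z P - c1 * lin a2 c2 z P.
    by rewrite /lin; ring.
  by rewrite h1 h2 !mulr0 subrr.
have e2 : (a1 * c2 - a2 * c1) * (P.2 - z.2) = 0.
  have -> : (a1 * c2 - a2 * c1) * (P.2 - z.2) = a1 * lin a2 c2 z P - a2 * lin a1 c1 z P.
    by rewrite /lin; ring.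
  by rewrite h1 h2 !mulr0 subrr.
move/eqP: e1; rewrite mulf_eq0 (negPf D0) subr_eq0 /= => /eqP e1.
move/eqP: e2; rewrite mulf_eq0 (negPf D0) subr_eq0 /= => /eqP e2.
by rewrite [P]surjective_pairing [z]surjective_pairing e1 e2.
Qed.

Lemma cont_lin a c z P : {for P, continuous (lin a c z)}.
Proof. by rewrite /lin; cont. Qed.

End ArgumentPrinciple.

Section Zeros.
Variable R : realType.
Local Notation tau := (2 * @pi R).

Lemma near_neq (z P : R * R) : P != z -> \forall Q \near P, Q != z.
Proof.
move=> Pz.
pose n (Q : R * R) := lin 1 0 z Q ^+ 2 + lin 0 1 z Q ^+ 2.
have cn : {for P, continuous n}.
  by apply: contD; apply: contX; exact: cont_lin.
have nP : 0 < n P by apply: lin_neq0 => //; rewrite mul1r mul0r subr0 oner_neq0.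
apply: filterS (cvgr_gt (n P) cn 0 nP) => Q; apply: contraTneq => ->.
by rewrite /n /lin !subrr !mulr0 addr0 !expr0n /= addr0 ltxx.
Qed.

Lemma cont_near (T : topologicalType) (f g : T -> R) (x : T) :
  (\forall y \near x, f y = g y) -> {for x, continuous f} -> {for x, continuous g}.
Proof.
move=> h cf; rewrite /prop_for /continuous_at -(nbhs_singleton h).
exact: cvg_trans (near_eq_cvg h) cf.
Qed.

(* Dividing by a linear map that vanishes at [z] removes the zero [z]. *)
Lemma argument_principle (zs : seq (R * R)) (s : R * R -> bool)
    (f1 f2 : R * R -> R) (l r b d : R) : l < r -> b < d -> uniq zs ->
  (forall z, z \in zs -> l < z.1 < r /\ b < z.2 < d) ->
  (forall z, z \in zs -> simple_zero f1 f2 z (s z)) ->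
  (forall P : R * R, l <= P.1 <= r -> b <= P.2 <= d ->
     [/\ {for P, continuous f1}, {for P, continuous f2} &
         P \notin zs -> (f1 P != 0) || (f2 P != 0)]) ->
  boundary_turns f1 f2 l r b d (\sum_(z <- zs) int_of_sign (s z)).
Proof.
move=> lr bd; elim: zs f1 f2 => [|z zs IH] f1 f2.
  move=> _ _ _ H; rewrite big_nil; apply: boundary_turns0 (ltW lr) (ltW bd) _.
  by move=> P h1 h2; have [? ? h] := H P h1 h2; split => //; exact: h.
move=> /= /andP[zzs uzs] hin hz H.
have [hz1 hz2] := hin z (mem_head _ _).
have [a1 [c1 [a2 [c2 [w1 [w2 [D0 sE w0 q1 q2]]]]]]] := hz z (mem_head _ _).
set z1 := lin a1 c1 z in q1 q2; set z2 := lin a2 c2 z in q1 q2.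
have cz1 P : {for P, continuous z1} by exact: cont_lin.
have cz2 P : {for P, continuous z2} by exact: cont_lin.
have zn0 P : P != z -> 0 < z1 P ^+ 2 + z2 P ^+ 2 by exact: lin_neq0.
(* The quotient, with its singularity at [z] filled by the limit, is continuous and nonzero
   there. *)
pose g1 P := if P == z then w1 else cdiv1 (f1 P) (f2 P) (z1 P) (z2 P).
pose g2 P := if P == z then w2 else cdiv2 (f1 P) (f2 P) (z1 P) (z2 P).
have g1E P : P != z -> g1 P = cdiv1 (f1 P) (f2 P) (z1 P) (z2 P).
  by rewrite /g1 => /negPf->.
have g2E P : P != z -> g2 P = cdiv2 (f1 P) (f2 P) (z1 P) (z2 P).
  by rewrite /g2 => /negPf->.
have nearz : \forall P \near z^', P != z by exact: nbhs_dnbhs_neq.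
have IHg : boundary_turns g1 g2 l r b d (\sum_(z <- zs) int_of_sign (s z)).
  apply: IH => //.
  - by move=> y hy; apply: hin; rewrite in_cons hy orbT.
  - move=> y hy; have yz : y != z by apply: contraNneq zzs => <-.
    have [a1' [c1' [a2' [c2' [v1 [v2 [D0' sE' v0 p1 p2]]]]]]] : simple_zero f1 f2 y (s y).
      by apply: hz; rewrite in_cons hy orbT.
    have ny : z1 y ^+ 2 + z2 y ^+ 2 != 0 by rewrite gt_eqF // zn0.
    exists a1', c1', a2', c2', (cdiv1 v1 v2 (z1 y) (z2 y)), (cdiv2 v1 v2 (z1 y) (z2 y)).
    have [e1 e2] := cdiv_cvg ny p1 p2 ((continuous_withinNx _ _).1 (cz1 y)) ((continuous_withinNx _ _).1 (cz2 y)).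
    have neary : \forall P \near y^', P != z.
      by apply: cvg_within; exact: near_neq.
    split => //; first exact: cdiv_neq0.
    + apply: cvg_trans e1; apply: near_eq_cvg; near=> P.
      have Pz : P != z by near: P.
      by rewrite (g1E _ Pz) (g2E _ Pz) cdiv1C.
    + apply: cvg_trans e2; apply: near_eq_cvg; near=> P.
      have Pz : P != z by near: P.
      by rewrite (g1E _ Pz) (g2E _ Pz) cdiv2C.
  - move=> P h1 h2; have [cf1 cf2 fn0] := H P h1 h2.
    have [->|Pz] := eqVneq P z.
      split.
      + apply/continuous_withinNx; rewrite {2}/g1 eqxx.
        apply: cvg_trans q1; apply: near_eq_cvg; near=> Q.
        by rewrite g1E //; near: Q.
      + apply/continuous_withinNx; rewrite {2}/g2 eqxx.
        apply: cvg_trans q2; apply: near_eq_cvg; near=> Q.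
        by rewrite g2E //; near: Q.
      + by rewrite /g1 /g2 eqxx.
    have nP : z1 P ^+ 2 + z2 P ^+ 2 != 0 by rewrite gt_eqF // zn0.
    have [e1 e2] := cdiv_cvg nP cf1 cf2 (cz1 P) (cz2 P).
    split.
    + apply: cont_near e1; apply: filterS (near_neq Pz) => Q Qz.
      by rewrite g1E.
    + apply: cont_near e2; apply: filterS (near_neq Pz) => Q Qz.
      by rewrite g2E.
    + move=> Pzs; rewrite g1E // g2E //; apply: cdiv_neq0 => //.
      by apply: fn0; rewrite in_cons negb_or Pz.
have Lz := lin_turns hz1 hz2 D0; rewrite -/z1 -/z2 -sE in Lz.
move=> thb tht thl thr Hb Ht Hl Hr.
have n0 x y : 0 < x ^+ 2 + y ^+ 2 -> (x != 0) || (y != 0) :> bool.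
  move=> h; rewrite -negb_and; apply: contraTN h => /andP[/eqP-> /eqP->].
  by rewrite expr0n addr0 ltxx.
have hor u : u != z.2 -> exists2 th : R -> R, (forall t, {for t, continuous th}) &
    arg_lift (fun t => z1 (t, u)) (fun t => z2 (t, u)) th l r.
  move=> hu; apply: lift_exists (ltW lr) _ => t ht; split.
  - by apply: cont_comp; [apply: cont_pair; cont|exact: cz1].
  - by apply: cont_comp; [apply: cont_pair; cont|exact: cz2].
  - by apply: n0; apply: zn0; apply: contra hu => /eqP <-.
have ver t : t != z.1 -> exists2 th : R -> R, (forall u, {for u, continuous th}) &
    arg_lift (fun u => z1 (t, u)) (fun u => z2 (t, u)) th b d.
  move=> ht; apply: lift_exists (ltW bd) _ => u hu; split.
  - by apply: cont_comp; [apply: cont_pair; cont|exact: cz1].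
  - by apply: cont_comp; [apply: cont_pair; cont|exact: cz2].
  - by apply: n0; apply: zn0; apply: contra ht => /eqP <-.
have [|etb _ Kb] := hor b; first by rewrite lt_eqF; lra.
have [|ett _ Kt] := hor d; first by rewrite gt_eqF; lra.
have [|etl _ Kl] := ver l; first by rewrite lt_eqF; lra.
have [|etr _ Kr] := ver r; first by rewrite gt_eqF; lra.
(* On the boundary, which avoids [z], an argument of the quotient is a difference of arguments; so
   the turns of [f] are those of the quotient plus those of the linear map. *)
have quot (p : R -> R * R) (th et : R -> R) x y : (forall t, x <= t <= y -> p t != z) ->
    arg_lift (fun t => f1 (p t)) (fun t => f2 (p t)) th x y ->
    arg_lift (fun t => z1 (p t)) (fun t => z2 (p t)) et x y ->
    arg_lift (fun t => g1 (p t)) (fun t => g2 (p t)) (fun t => th t - et t) x y.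
  move=> pz Hth Het t ht; split.
    by apply: contB; [exact: (Hth t ht).1|exact: (Het t ht).1].
  rewrite g1E ?g2E ?pz //; exact: polar_div (Hth t ht).2 (Het t ht).2.
have Qb := quot (fun t => (t, b)) _ _ _ _ _ Hb Kb.
have Qt := quot (fun t => (t, d)) _ _ _ _ _ Ht Kt.
have Ql := quot (fun u => (l, u)) _ _ _ _ _ Hl Kl.
have Qr := quot (fun u => (r, u)) _ _ _ _ _ Hr Kr.
have E2 := Lz _ _ _ _ Kb Kt Kl Kr.
rewrite big_cons intrD [RHS]mulrDr -E2 -(IHg _ _ _ _ (Qb _) (Qt _) (Ql _) (Qr _)); first by ring.
- by move=> t _; apply/eqP => E; move: hz2; rewrite -E /= ltxx.
- by move=> t _; apply/eqP => E; move: hz2; rewrite -E /= ltxx andbF.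
- by move=> t _; apply/eqP => E; move: hz1; rewrite -E /= ltxx.
- by move=> t _; apply/eqP => E; move: hz1; rewrite -E /= ltxx andbF.
Unshelve. all: by end_near. Qed.

End Zeros.

(** * Geometry of the sphere *)
Section Geometry.
Variable R : realType.
Local Notation V := 'rV[R]_3.
Implicit Types e p q x y z u v w : V.
Local Notation c0 u := (u (0 : 'I_1) (0 : 'I_3)).
Local Notation c1 u := (u (0 : 'I_1) (1 : 'I_3)).
Local Notation c2 u := (u (0 : 'I_1) (2 : 'I_3)).

Lemma dotE u v : dot u v = c0 u * c0 v + c1 u * c1 v + c2 u * c2 v.
Proof.
rewrite /dot !big_ord_recr big_ord0 /= add0r.
by congr (_ * _ + _ * _ + _ * _); congr (_ _ _); apply/val_inj.
Qed.

Lemma row3P u v : c0 u = c0 v -> c1 u = c1 v -> c2 u = c2 v -> u = v.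
Proof.
move=> h0 h1 h2; apply/rowP => -[[|[|[|i]]] hi] //.
- by move: h0; congr (_ = _); congr (_ _ _); apply/val_inj.
- by move: h1; congr (_ = _); congr (_ _ _); apply/val_inj.
- by move: h2; congr (_ = _); congr (_ _ _); apply/val_inj.
Qed.

Lemma det3E u v w : det3 u v w =
  c0 u * (c1 v * c2 w - c2 v * c1 w) - c1 u * (c0 v * c2 w - c2 v * c0 w)
  + c2 u * (c0 v * c1 w - c1 v * c0 w).
Proof.
rewrite /det3 (expand_det_row _ 0) !big_ord_recl big_ord0 /cofactor.
rewrite !(expand_det_row _ 0) !big_ord_recl !big_ord0 /cofactor !det_mx11 !mxE /=.
have [f E] : exists f : V -> nat -> R, forall (u : V) (i : 'I_3), u 0 i = f u i.
  by exists (fun u n => u 0 (inord n)) => u' i; rewrite inord_val.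
by rewrite !E /= /bump /=; ring.
Qed.

Lemma dotC u v : dot u v = dot v u.
Proof. by rewrite !dotE; ring. Qed.

Lemma dotDl u v w : dot (u + v) w = dot u w + dot v w.
Proof. by rewrite !dotE !mxE; ring. Qed.

Lemma dotZl (k : R) u w : dot (k *: u) w = k * dot u w.
Proof. by rewrite !dotE !mxE; ring. Qed.

Lemma dotBl u v w : dot (u - v) w = dot u w - dot v w.
Proof. by rewrite !dotE !mxE; ring. Qed.

Lemma dotBr u v w : dot w (u - v) = dot w u - dot w v.
Proof. by rewrite !dotE !mxE; ring. Qed.

Lemma dotDr u v w : dot w (u + v) = dot w u + dot w v.
Proof. by rewrite !dotE !mxE; ring. Qed.

Lemma dotZr (k : R) u w : dot w (k *: u) = k * dot w u.
Proof. by rewrite !dotE !mxE; ring. Qed.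

Lemma dot0l w : dot 0 w = 0.
Proof. by rewrite !dotE !mxE; ring. Qed.

Lemma dot_ge0 u : 0 <= dot u u.
Proof. by rewrite dotE -!expr2 !addr_ge0 // sqr_ge0. Qed.

Lemma dot_eq0 u : dot u u = 0 -> u = 0.
Proof.
rewrite dotE -!expr2 => /eqP; rewrite paddr_eq0 ?addr_ge0 ?sqr_ge0 //.
rewrite paddr_eq0 ?sqr_ge0 // !sqrf_eq0 => /andP[/andP[/eqP h0 /eqP h1] /eqP h2].
by apply: row3P; rewrite mxE.
Qed.

Lemma dot_gt0 u : u != 0 -> 0 < dot u u.
Proof. by move=> u0; rewrite lt_def dot_ge0 andbT; apply: contra_neq u0 => /dot_eq0. Qed.

Lemma sphere_dot_lt1 x q : dot x x = 1 -> dot q q = 1 -> x != q -> dot x q < 1.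
Proof.
move=> hx hq; rewrite -subr_eq0 => /dot_gt0.
by rewrite !dotBl !dotBr (dotC q x) hx hq; lra.
Qed.

(* Up to a positive factor, the stereographic projection of [x] from [q] minus
   that of [p]: both differ from the inversion of center [q] by a constant. *)
Definition stereo p q x : V := (1 - dot p q) *: (x - q) - (1 - dot x q) *: (p - q).

Lemma stereo_orth p q x : dot q q = 1 -> dot (stereo p q x) q = 0.
Proof. by move=> hq; rewrite dotBl !dotZl !dotBl hq; ring. Qed.

(** If the vector vanished, pairing it with [x - q] and [p - q] would give [dot x q = dot p q]. It
    would then be a nonzero multiple of [x - p]. *)
Lemma stereo_neq0 p q x : dot p p = 1 -> dot q q = 1 -> dot x x = 1 ->
  p != q -> x != q -> x != p -> stereo p q x != 0.
Proof.
move=> hp hq hx pq xq xp; apply: contra_neq xp => N0.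
have a0 := sphere_dot_lt1 hp hq pq; have b0 := sphere_dot_lt1 hx hq xq.
have E1 : dot (stereo p q x) (x - q) = 0 by rewrite N0 dot0l.
have E2 : dot (stereo p q x) (p - q) = 0 by rewrite N0 dot0l.
move: E1 E2; rewrite !dotBl !dotZl !dotBl !dotBr hx hq hp (dotC q x) (dotC q p) (dotC p x).
move=> E1 E2.
have F1 : (1 - dot x q) * (2 * (1 - dot p q) - (dot x p - dot p q - dot x q + 1)) = 0.
  by rewrite -E1; ring.
have F2 : (1 - dot p q) * (2 * (1 - dot x q) - (dot x p - dot p q - dot x q + 1)) = 0.
  by rewrite -[RHS]oppr0 -E2; ring.
have {F1 E1 E2} : 2 * (1 - dot p q) - (dot x p - dot p q - dot x q + 1) = 0.
  by apply/eqP; move/eqP: F1; rewrite mulf_eq0 subr_eq0 gt_eqF.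
have {F2} : 2 * (1 - dot x q) - (dot x p - dot p q - dot x q + 1) = 0.
  by apply/eqP; move/eqP: F2; rewrite mulf_eq0 subr_eq0 gt_eqF.
move=> F2 F1; have pxq : dot x q = dot p q by lra.
move: N0; rewrite /stereo pxq -scalerBr opprB addrA subrK => /eqP.
by rewrite scaler_eq0 subr_eq0 gt_eqF //= subr_eq0 => /eqP.
Qed.

Lemma cramer e1 e2 e3 v :
  det3 e1 e2 e3 *: v = det3 v e2 e3 *: e1 + det3 e1 v e3 *: e2 + det3 e1 e2 v *: e3.
Proof. by apply: row3P; rewrite !mxE !det3E; ring. Qed.

Lemma det3_dot_eq0 e1 e2 e3 v : det3 e1 e2 e3 != 0 ->
  dot v e1 = 0 -> dot v e2 = 0 -> dot v e3 = 0 -> v = 0.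
Proof.
move=> D0 h1 h2 h3; apply: dot_eq0; apply/eqP; rewrite -(mulrI_eq0 _ (mulfI D0)).
by rewrite -dotZr (cramer e1 e2 e3) !dotDr !dotZr h1 h2 h3 !mulr0 !addr0.
Qed.

Lemma gram (a1 a2 a3 b1 b2 b3 : V) : det3 a1 a2 a3 * det3 b1 b2 b3 =
  dot a1 b1 * (dot a2 b2 * dot a3 b3 - dot a2 b3 * dot a3 b2)
  - dot a1 b2 * (dot a2 b1 * dot a3 b3 - dot a2 b3 * dot a3 b1)
  + dot a1 b3 * (dot a2 b1 * dot a3 b2 - dot a2 b2 * dot a3 b1).
Proof. by rewrite !det3E !dotE; ring. Qed.

Lemma gram_tangent q e1 e2 v w : dot q q = 1 -> dot v q = 0 -> dot w q = 0 ->
  dot v e1 * dot w e2 - dot v e2 * dot w e1 = det3 q v w * det3 q e1 e2.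
Proof. by move=> hq hv hw; rewrite gram hq hv hw; ring. Qed.

(* Stereographic projection reverses the orientation. *)
Definition frame q e1 e2 : Prop := det3 q e1 e2 < 0.

Lemma frame_exists q : q != 0 -> exists e1 e2, frame q e1 e2.
Proof.
move=> q0; pose E (i : 'I_3) : V := delta_mx 0 i.
have [|h] := pselect (exists e1 e2, det3 q e1 e2 != 0).
  move=> [e1 [e2]]; rewrite neq_lt => /orP[h|h]; first by exists e1, e2.
  exists e2, e1; rewrite /frame.
  have -> : det3 q e2 e1 = - det3 q e1 e2 by rewrite !det3E; ring.
  by rewrite oppr_lt0.
have {}h e1 e2 : det3 q e1 e2 = 0.
  by apply/eqP; apply/negPn/negP => h'; apply: h; exists e1, e2.
case/eqP: q0; apply: row3P.
- by have := h (E 1) (E 2); rewrite det3E /E !mxE /= => <-; ring.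
- by have := h (E 2) (E 0); rewrite det3E /E !mxE /= => <-; ring.
- by have := h (E 0) (E 1); rewrite det3E /E !mxE /= => <-; ring.
Qed.

(** The vector is orthogonal to [q], hence determined by its products with [e1] and [e2], whether or
    not these are tangent at [q]. *)
Lemma stereo_coord_neq0 p q x e1 e2 : dot p p = 1 -> dot q q = 1 -> dot x x = 1 ->
  p != q -> x != q -> x != p -> frame q e1 e2 ->
  (dot (stereo p q x) e1 != 0) || (dot (stereo p q x) e2 != 0).
Proof.
move=> hp hq hx pq xq xp fr.
rewrite -negb_and; apply: contra (stereo_neq0 hp hq hx pq xq xp) => /andP[/eqP h1 /eqP h2].
apply/eqP; apply: (@det3_dot_eq0 q e1 e2) => //; first by rewrite lt_eqF.
exact: stereo_orth.
Qed.

(** The coordinates change by a matrix of positive determinant. Up to a fixed rotation this changes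
    arguments by less than a right angle, so the two variations differ by less than [pi]; since
    [v l = v r], both are multiples of [tau]. *)
Lemma frame_change q e1 e2 e1' e2' (v : R -> V) (th th' : R -> R) (l r : R) : l <= r ->
  dot q q = 1 -> frame q e1 e2 -> frame q e1' e2' ->
  (forall t, l <= t <= r -> dot (v t) q = 0) -> v l = v r ->
  arg_lift (fun t => dot (v t) e1) (fun t => dot (v t) e2) th l r ->
  arg_lift (fun t => dot (v t) e1') (fun t => dot (v t) e2') th' l r ->
  th r - th l = th' r - th' l.
Proof.
move=> lr hq fr fr' vq vlr H H'.
have D0 : det3 q e1 e2 != 0 by rewrite lt_eqF.
pose D := det3 q e1 e2; pose a e := det3 q e e2 / D; pose b e := det3 q e1 e / D.
have coord t e : l <= t <= r -> dot (v t) e = a e * dot (v t) e1 + b e * dot (v t) e2.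
  move=> ht; apply: (mulfI D0); rewrite -[LHS]dotZr (cramer q e1 e2) !dotDr !dotZr vq //.
  by rewrite /a /b /D; field.
have det0 : 0 < a e1' * b e2' - b e1' * a e2'.
  have -> : a e1' * b e2' - b e1' * a e2' = det3 q e1' e2' / D.
    rewrite /a /b; apply: (mulIf (expf_neq0 2 D0)).
    transitivity (det3 q e1' e2 * det3 q e1 e2' - det3 q e1 e1' * det3 q e2' e2).
      by rewrite -/D; field.
    have -> : det3 q e1' e2' / D * det3 q e1 e2 ^+ 2 = det3 q e1' e2' * det3 q e1 e2.
      by rewrite /D; field.
    by rewrite !det3E; ring.
  by rewrite ltr_ndivlMr // mul0r.
(* If M is the matrix of the change of frame and w the complex number such that
   z |-> w z is the C-linear part of 2 M, then <M z, w z> = |M z|^2 + det M |z|^2. *)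
have form (x y : R) : (x != 0) || (y != 0) ->
    0 < (a e1' * x + b e1' * y) * ((a e1' + b e2') * x - (a e2' - b e1') * y)
      + (a e2' * x + b e2' * y) * ((a e2' - b e1') * x + (a e1' + b e2') * y).
  move=> xy0.
  have xy : 0 < x ^+ 2 + y ^+ 2.
    rewrite lt_def addr_ge0 ?sqr_ge0 // andbT paddr_eq0 ?sqr_ge0 //.
    by rewrite !sqrf_eq0 negb_and.
  have -> : (a e1' * x + b e1' * y) * ((a e1' + b e2') * x - (a e2' - b e1') * y)
      + (a e2' * x + b e2' * y) * ((a e2' - b e1') * x + (a e1' + b e2') * y) =
    (a e1' * x + b e1' * y) ^+ 2 + (a e2' * x + b e2' * y) ^+ 2
    + (a e1' * b e2' - b e1' * a e2') * (x ^+ 2 + y ^+ 2) by ring.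
  by rewrite ltr_wpDl ?mulr_gt0 // addr_ge0 ?sqr_ge0.
(* [al] is an argument of the complex number w above, which is nonzero because the form is
   positive. *)
have [al hal] : exists al, polar (a e1' + b e2') (a e2' - b e1') al.
  apply: polar_exists; rewrite -negb_and; apply/negP => /andP[/eqP h1 /eqP h2].
  have := form 1 0; rewrite oner_neq0 h1 h2 => /(_ isT).
  by rewrite !mul0r !subr0 !addr0 !mulr0 addr0 ltxx.
have pi0 := pi_gt0 R.
have small : `|(th' r - (al + th r)) - (th' l - (al + th l))| < pi.
  apply: (@cos_gt0_range R (fun t => th' t - (al + th t)) l r lr).
    move=> t ht; apply: contB; first exact: (H' t ht).1.
    by apply: contD; [exact: cont_cst|exact: (H t ht).1].
  move=> t ht; have hm := polar_mul hal (H t ht).2.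
  apply: polar_cos_gt0 hm (H' t ht).2 _.
  have := form (dot (v t) e1) (dot (v t) e2).
  rewrite -!coord //; have -> : (dot (v t) e1 != 0) || (dot (v t) e2 != 0).
    rewrite -negb_and; apply/negP => /andP[/eqP h1 /eqP h2].
    by have := polar_neq0 (H t ht).2; rewrite h1 h2 expr0n addr0 ltxx.
  by move=> /(_ isT) h; apply: (lt_le_trans h); rewrite le_eqVlt; apply/orP; left; apply/eqP; ring.
have hl : l <= l <= r by rewrite lexx.
have hr : l <= r <= r by rewrite lexx andbT.
have C : cos (th r - th l) = 1.
  by apply: polar_uniq (H l hl).2 _; rewrite vlr; exact: (H r hr).2.
have C' : cos (th' r - th' l) = 1.
  by apply: polar_uniq (H' l hl).2 _; rewrite vlr; exact: (H' r hr).2.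
apply/eqP; rewrite eq_sym -subr_eq0; apply/eqP.
apply: cos_eq1_small; first exact: cosB_eq1.
move: small; have -> : th' r - (al + th r) - (th' l - (al + th l)) =
  th' r - th' l - (th r - th l) by ring.
by move=> h; apply: lt_trans h _; rewrite ltr_pMl // ltr1n.
Qed.

End Geometry.

(** * Simple zeros of differentiable maps of the plane *)

Section SimpleZeros.
Variable R : realType.

Lemma norm_mul_le_sqr (x y : R) : `|x * y| <= x ^+ 2 + y ^+ 2.
Proof.
have h1 := sqr_ge0 (x - y); have h2 := sqr_ge0 (x + y).
by rewrite ler_norml; nra.
Qed.

(** By Cramer's rule [D * s] and [D * v] are combinations of [z1] and [z2], so the products of [s]
    or [v] with these are at most [M] times the squared norm. The error of the quotient is a
    combination of such products whose coefficients are the perturbations summed in [E]. *)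
Lemma cdiv_near1 (a1 a2 c1 c2 A1 A2 C1 C2 s v : R) :
  let D := a1 * c2 - a2 * c1 in
  let z1 := a1 * s + c1 * v in let z2 := a2 * s + c2 * v in
  let M := (`|a1| + `|a2| + `|c1| + `|c2|) / `|D| in
  let E := `|A1 - a1| + `|A2 - a2| + `|C1 - c1| + `|C2 - c2| in
  D != 0 -> 0 < z1 ^+ 2 + z2 ^+ 2 ->
  `|1 - cdiv1 (s * A1 + v * C1) (s * A2 + v * C2) z1 z2| <= M * E /\
  `|0 - cdiv2 (s * A1 + v * C1) (s * A2 + v * C2) z1 z2| <= M * E.
Proof.
move=> D z1 z2 M E D0 n0; set n := z1 ^+ 2 + z2 ^+ 2 in n0 *.
have Dp : 0 < `|D| by rewrite normr_gt0.
have lin_bound (x p q y : R) : D * x = p * z1 + q * z2 ->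
    `|p| + `|q| <= `|a1| + `|a2| + `|c1| + `|c2| ->
    `|z1 * y| <= n -> `|z2 * y| <= n -> `|x * y| <= M * n.
  move=> Dx pq h1 h2; rewrite /M mulrAC ler_pdivlMr // -normrM.
  have -> : x * y * D = p * (z1 * y) + q * (z2 * y).
    by transitivity (D * x * y); [ring|rewrite Dx; ring].
  apply: le_trans (ler_normD _ _) _; rewrite !normrM.
  apply: (@le_trans _ _ ((`|p| + `|q|) * n)); last by apply: ler_wpM2r => //; exact: ltW.
  rewrite mulrDl -!normrM; apply: lerD; rewrite normrM; exact: ler_wpM2l.
have b11 : `|z1 * z1| <= n by rewrite normrM -expr2 real_normK ?num_real // lerDl sqr_ge0.
have b22 : `|z2 * z2| <= n by rewrite normrM -expr2 real_normK ?num_real // lerDr sqr_ge0.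
have b12 : `|z1 * z2| <= n by exact: norm_mul_le_sqr.
have b21 : `|z2 * z1| <= n by rewrite mulrC.
have na1 := normr_ge0 a1; have na2 := normr_ge0 a2.
have nc1 := normr_ge0 c1; have nc2 := normr_ge0 c2.
have sE : D * s = c2 * z1 + (- c1) * z2 by rewrite /D /z1 /z2; ring.
have vE : D * v = (- a2) * z1 + a1 * z2 by rewrite /D /z1 /z2; ring.
have s1 : `|s * z1| <= M * n by apply: (lin_bound s _ _ z1 sE) => //; rewrite normrN; lra.
have s2 : `|s * z2| <= M * n by apply: (lin_bound s _ _ z2 sE) => //; rewrite normrN; lra.
have v1 : `|v * z1| <= M * n by apply: (lin_bound v _ _ z1 vE) => //; rewrite normrN; lra.
have v2 : `|v * z2| <= M * n by apply: (lin_bound v _ _ z2 vE) => //; rewrite normrN; lra.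
have term (x y e : R) : `|x * y| <= M * n -> `|x * y * e| <= `|e| * (M * n).
  by move=> h; rewrite normrM mulrC ler_wpM2l.
have fin (w : R) : `|w| <= E * (M * n) -> `|w / n| <= M * E.
  move=> h; rewrite normrM normfV (gtr0_norm n0) ler_pdivrMr //.
  by apply: le_trans h _; rewrite mulrCA mulrA.
split.
- have -> : 1 - cdiv1 (s * A1 + v * C1) (s * A2 + v * C2) z1 z2 =
    - (s * z1 * (A1 - a1) + s * z2 * (A2 - a2) + v * z1 * (C1 - c1) + v * z2 * (C2 - c2)) / n.
    rewrite /cdiv1 -/n; apply: (mulIf (lt0r_neq0 n0)).
    rewrite mulrBl mul1r !divfK ?lt0r_neq0 //.
    rewrite /n /z1 /z2; ring.
  apply: fin; rewrite normrN /E !mulrDl.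
  by do !(apply: le_trans (ler_normD _ _) _; apply: lerD); exact: term.
- have -> : 0 - cdiv2 (s * A1 + v * C1) (s * A2 + v * C2) z1 z2 =
    (s * z2 * (A1 - a1) + (- (s * z1 * (A2 - a2))) + v * z2 * (C1 - c1) + (- (v * z1 * (C2 - c2)))) / n.
    rewrite /cdiv2 -/n; apply: (mulIf (lt0r_neq0 n0)).
    rewrite mulrBl mul0r !divfK ?lt0r_neq0 //.
    rewrite /n /z1 /z2; ring.
  apply: fin; rewrite /E !mulrDl.
  by do !(apply: le_trans (ler_normD _ _) _; apply: lerD); rewrite ?normrN; exact: term.
Qed.

(** The factorization with slopes continuous at [z] is differentiability in the form of
    Carathéodory. The quotient by the differential tends to the complex number 1. *)
Lemma simple_zero_slopes (f1 f2 A1 A2 C1 C2 : R * R -> R) (z : R * R) :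
  (forall P, f1 P = (P.1 - z.1) * A1 P + (P.2 - z.2) * C1 P) ->
  (forall P, f2 P = (P.1 - z.1) * A2 P + (P.2 - z.2) * C2 P) ->
  {for z, continuous A1} -> {for z, continuous A2} ->
  {for z, continuous C1} -> {for z, continuous C2} ->
  A1 z * C2 z - A2 z * C1 z != 0 ->
  simple_zero f1 f2 z (0 < A1 z * C2 z - A2 z * C1 z).
Proof.
move=> E1 E2 cA1 cA2 cC1 cC2 D0.
pose M := (`|A1 z| + `|A2 z| + `|C1 z| + `|C2 z|) / `|A1 z * C2 z - A2 z * C1 z|.
pose E (P : R * R) : R := `|A1 P - A1 z| + `|A2 P - A2 z| + `|C1 P - C1 z| + `|C2 P - C2 z|.
have M0 : 0 <= M by rewrite divr_ge0 // !addr_ge0.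
have cE : {for z, continuous (fun P => M * E P)}.
  apply: contM; first exact: cont_cst.
  by rewrite /E; do !apply: contD; apply: cont_norm; apply: contB => //; exact: cont_cst.
have ME0 : M * E z = 0 by rewrite /E !subrr normr0 !addr0 mulr0.
have small (eps : R) : 0 < eps -> \forall P \near z^', M * E P < eps.
  move=> e0; apply: cvg_within.
  by apply: (cvgr_lt (M * E z) cE); rewrite ME0.
have nearz : \forall P \near z^', P != z by exact: nbhs_dnbhs_neq.
exists (A1 z), (C1 z), (A2 z), (C2 z), 1, 0; split => //; first by rewrite oner_neq0.
- apply/cvgrPdist_lt => eps e0; near=> P.
  have Pz : P != z by near: P.
  have h : M * E P < eps by near: P; exact: small.
  apply: le_lt_trans h; rewrite E1 E2.
  exact: (@cdiv_near1 (A1 z) (A2 z) (C1 z) (C2 z) (A1 P) (A2 P) (C1 P) (C2 P)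
    (P.1 - z.1) (P.2 - z.2) D0 (lin_neq0 D0 Pz)).1.
- apply/cvgrPdist_lt => eps e0; near=> P.
  have Pz : P != z by near: P.
  have h : M * E P < eps by near: P; exact: small.
  apply: le_lt_trans h; rewrite E1 E2.
  exact: (@cdiv_near1 (A1 z) (A2 z) (C1 z) (C2 z) (A1 P) (A2 P) (C1 P) (C2 P)
    (P.1 - z.1) (P.2 - z.2) D0 (lin_neq0 D0 Pz)).2.
Unshelve. all: by end_near. Qed.

Lemma caratheodory (U : normedModType R) (f : R -> U) (t : R) : derivable f t 1 ->
  exists g : R -> U, [/\ forall s, f s = f t + (s - t) *: g s,
    {for t, continuous g} & g t = derive1 f t].
Proof.
move=> df.
exists (fun s => if s == t then derive1 f t else (s - t)^-1 *: (f s - f t)).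
split; last by rewrite eqxx.
  move=> s; have [->|st] := eqVneq s t; first by rewrite subrr scale0r addr0.
  by rewrite scalerA divff ?subr_eq0 // scale1r addrC subrK.
apply/continuous_withinNx; rewrite eqxx.
have /cvgrPdist_lt dc : h^-1 *: (f (h + t) - f t) @[h --> 0^'] --> derive1 f t.
  rewrite derive1E; apply: cvg_trans df; apply: near_eq_cvg; near=> h.
  by rewrite /= /GRing.scale /= mulr1.
apply/cvgrPdist_lt => eps e0.
have /nbhs_ballP[d /= d0 hd] := dc eps e0.
apply/nbhs_ballP; exists d => //= s sd st.
rewrite (negPf st).
have := hd (s - t); rewrite subrK; apply; last by rewrite subr_eq0.
by move: sd; rewrite /ball /= sub0r normrN distrC.
Unshelve. all: by end_near. Qed.

End SimpleZeros.

(** * Local degree where the diagram meets the shortcut *)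

Section Crossing.
Variable R : realType.
Local Notation V := 'rV[R]_3.
Local Notation tau := (2 * @pi R).
Local Notation c0 u := (u (0 : 'I_1) (0 : 'I_3)).
Local Notation c1 u := (u (0 : 'I_1) (1 : 'I_3)).
Local Notation c2 u := (u (0 : 'I_1) (2 : 'I_3)).

Lemma cont_coord (T : topologicalType) (f : T -> V) (x : T) i :
  {for x, continuous f} -> {for x, continuous (fun y => f y 0 i)}.
Proof.
move=> cf; apply: (@continuous_comp _ _ _ f (fun M : V => M 0 i)) => //.
exact: coord_continuous.
Qed.

Lemma cont_dot (T : topologicalType) (f g : T -> V) (x : T) :
  {for x, continuous f} -> {for x, continuous g} ->
  {for x, continuous (fun y => dot (f y) (g y))}.
Proof.
move=> cf cg; have -> : (fun y => dot (f y) (g y)) = fun y =>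
    c0 (f y) * c0 (g y) + c1 (f y) * c1 (g y) + c2 (f y) * c2 (g y).
  by apply/funext => y; rewrite dotE.
by cont; apply: cont_coord.
Qed.

Lemma cont_det3 (T : topologicalType) (f g h : T -> V) (x : T) :
  {for x, continuous f} -> {for x, continuous g} -> {for x, continuous h} ->
  {for x, continuous (fun y => det3 (f y) (g y) (h y))}.
Proof.
move=> cf cg ch.
have cc (k : T -> V) i : {for x, continuous k} -> {for x, continuous (fun y => k y 0 i)}.
  exact: cont_coord.
have -> : (fun y => det3 (f y) (g y) (h y)) = fun y =>
  c0 (f y) * (c1 (g y) * c2 (h y) - c2 (g y) * c1 (h y)) - c1 (f y) * (c0 (g y) * c2 (h y) - c2 (g y) * c0 (h y))
  + c2 (f y) * (c0 (g y) * c1 (h y) - c1 (g y) * c0 (h y)).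
  by apply/funext => y; rewrite det3E.
by cont; apply: cc.
Qed.

Lemma cont_stereo_coord (T : topologicalType) (p q f e : T -> V) (x : T) :
  {for x, continuous p} -> {for x, continuous q} -> {for x, continuous f} ->
  {for x, continuous e} ->
  {for x, continuous (fun y => dot (stereo (p y) (q y) (f y)) (e y))}.
Proof.
move=> cp cq cf ce.
have -> : (fun y => dot (stereo (p y) (q y) (f y)) (e y)) = fun y =>
   (1 - dot (p y) (q y)) * (dot (f y) (e y) - dot (q y) (e y))
   - (1 - dot (f y) (q y)) * (dot (p y) (e y) - dot (q y) (e y)).
  by apply/funext => y; rewrite dotBl !dotZl !dotBl.
by cont; apply: cont_dot.
Qed.

Lemma zero_near (h : R -> R) (t : R) : {for t, continuous h} ->
  (\forall s \near t, s != t -> h s = 0) -> h t = 0.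
Proof.
move=> ch hn; apply: (@cvg_unique _ _ (h @ t^')) => //.
  exact: (continuous_withinNx _ _).1 ch.
have z0 : (fun _ : R => 0 : R) @ t^' --> (0 : R) by exact: cvg_cst.
apply: cvg_trans z0; apply: near_eq_cvg; near=> s.
symmetry; have st : s != t by near: s; exact: nbhs_dnbhs_neq.
by move: st; near: s; apply: cvg_within.
Unshelve. all: by end_near. Qed.

(** Substitute [f s = f t + (s - t) *: g s] in [dot (f s) (f s) = 1] and divide by [s - t]: the
    resulting [h] vanishes for [s != t] near [t], hence at [t] by continuity. *)
Lemma unit_curve_tangent (f : R -> V) (t : R) : derivable f t 1 ->
  (\forall s \near t, dot (f s) (f s) = 1) -> dot (derive1 f t) (f t) = 0.
Proof.
move=> /caratheodory[g [fE cg <-]] hn.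
pose h s := 2 * dot (g s) (f t) + (s - t) * dot (g s) (g s).
have ch : {for t, continuous h}.
  by rewrite /h; cont; apply: cont_dot => //; exact: cvg_cst.
have ht1 : dot (f t) (f t) = 1 by exact: nbhs_singleton hn.
have ht : h t = 0.
  apply: (zero_near ch); apply: filterS hn => s; rewrite fE => hs st.
  have st0 : s - t != 0 by rewrite subr_eq0.
  apply: (mulfI st0); rewrite mulr0 /h.
  move: hs; rewrite !dotDl !dotDr !dotZl !dotZr ht1 (dotC (f t) (g s)) => hs.
  by apply: (addrI 1); rewrite addr0 -[RHS]hs; ring.
move: ht; rewrite /h subrr mul0r addr0 => /eqP.
by rewrite mulf_eq0 pnatr_eq0 => /eqP.
Unshelve. all: by end_near. Qed.

(* The differential at [z] of the stereographic projection from [q], up to a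
   positive factor. *)
Definition dstereo (q z v : V) : V := (1 - dot z q) *: v + dot v q *: (z - q).

Lemma dstereo_orth (q z v : V) : dot q q = 1 -> dot (dstereo q z v) q = 0.
Proof. by move=> hq; rewrite dotDl !dotZl dotBl hq; ring. Qed.

(** As [v] and [w] are tangent at [z], their cross product is [D] times [z]; this is read off
    coordinatewise in [m0], [m1], [m2]. The minus sign is the reversal of orientation. *)
Lemma dstereo_det3 (q z v w : V) : dot q q = 1 -> dot z z = 1 ->
  dot v z = 0 -> dot w z = 0 ->
  det3 q (dstereo q z v) (dstereo q z w) = - (1 - dot z q) ^+ 2 * det3 z v w.
Proof.
move=> hq hz hv hw; set D := det3 z v w.
have m0 : c1 v * c2 w - c2 v * c1 w = D * c0 z.
  transitivity ((c1 v * c2 w - c2 v * c1 w) * dot z z + (c2 z * c1 w - c1 z * c2 w) * dot v z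
    - (c2 z * c1 v - c1 z * c2 v) * dot w z).
    by rewrite hz hv hw; ring.
  by rewrite /D det3E !dotE; ring.
have m1 : c2 v * c0 w - c0 v * c2 w = D * c1 z.
  transitivity ((c2 v * c0 w - c0 v * c2 w) * dot z z + (c0 z * c2 w - c2 z * c0 w) * dot v z
    - (c0 z * c2 v - c2 z * c0 v) * dot w z).
    by rewrite hz hv hw; ring.
  by rewrite /D det3E !dotE; ring.
have m2 : c0 v * c1 w - c1 v * c0 w = D * c2 z.
  transitivity ((c0 v * c1 w - c1 v * c0 w) * dot z z + (c1 z * c0 w - c0 z * c1 w) * dot v z
    - (c1 z * c0 v - c0 z * c1 v) * dot w z).
    by rewrite hz hv hw; ring.
  by rewrite /D det3E !dotE; ring.
set al := 1 - dot z q.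
have -> : det3 q (dstereo q z v) (dstereo q z w) =
   al ^+ 2 * (c0 q * (c1 v * c2 w - c2 v * c1 w) + c1 q * (c2 v * c0 w - c0 v * c2 w)
     + c2 q * (c0 v * c1 w - c1 v * c0 w))
   + al * (dot w q * det3 q v z + dot v q * det3 q z w).
  by rewrite !det3E /dstereo !mxE -/al; ring.
have -> : dot w q * det3 q v z + dot v q * det3 q z w =
   (c1 v * c2 w - c2 v * c1 w) * (c0 q * dot z q - c0 z * dot q q)
   + (c2 v * c0 w - c0 v * c2 w) * (c1 q * dot z q - c1 z * dot q q)
   + (c0 v * c1 w - c1 v * c0 w) * (c2 q * dot z q - c2 z * dot q q).
  by rewrite !det3E !dotE; ring.
rewrite m0 m1 m2 hq.
have -> : c0 q * (D * c0 z) + c1 q * (D * c1 z) + c2 q * (D * c2 z) = D * dot z q.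
  by rewrite dotE; ring.
have -> : D * c0 z * (c0 q * dot z q - c0 z * 1) + D * c1 z * (c1 q * dot z q - c1 z * 1) +
   D * c2 z * (c2 q * dot z q - c2 z * 1) = D * (dot z q ^+ 2 - dot z z).
  by rewrite !dotE; ring.
by rewrite hz /al; ring.
Qed.

Lemma stereo_simple_zero (K a : R -> V) (q e1 e2 : V) (t0 u0 : R) :
  dot q q = 1 -> frame q e1 e2 -> derivable K t0 1 -> derivable a u0 1 ->
  K t0 = a u0 -> dot (K t0) (K t0) = 1 -> K t0 != q ->
  dot (derive1 K t0) (K t0) = 0 -> dot (derive1 a u0) (a u0) = 0 ->
  det3 (K t0) (derive1 a u0) (derive1 K t0) != 0 ->
  simple_zero (fun P => dot (stereo (a P.2) q (K P.1)) e1)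
              (fun P => dot (stereo (a P.2) q (K P.1)) e2) (t0, u0)
    (0 < det3 (K t0) (derive1 a u0) (derive1 K t0)).
Proof.
move=> hq fr /caratheodory[k [kE ck kt]] /caratheodory[al [alE cal alu]] Kz hz zq tK ta.
rewrite -kt -alu in tK ta *; set z := K t0 in kE Kz hz zq tK *.
rewrite -Kz in alE ta *.
have zq1 := sphere_dot_lt1 hz hq zq.
have cpt0 : {for (t0, u0), continuous (fun P : R * R => k P.1)}.
  exact: (@cont_comp_fst _ _ _ (t0, u0) k ck).
have cpu0 : {for (t0, u0), continuous (fun P : R * R => al P.2)}.
  exact: (@cont_comp_snd _ _ _ (t0, u0) al cal).
have cc (v : V) : {for (t0, u0), continuous (fun _ : R * R => v)} by exact: cvg_cst.
pose A (e : V) (P : R * R) := (1 - dot z q) * dot (k P.1) e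
   + dot (k P.1) q * (dot z e - dot q e).
(* The map is bilinear in the two displacements. The mixed term is put into the slope in [u], where
   its factor [P.1 - t0] vanishes at the zero. *)
pose C (e : V) (P : R * R) := - (dot (al P.2) q * (dot z e - dot q e)
   + (1 - dot z q) * dot (al P.2) e)
   + (P.1 - t0) * (dot (k P.1) q * dot (al P.2) e - dot (al P.2) q * dot (k P.1) e).
have fE (e : V) (P : R * R) : dot (stereo (a P.2) q (K P.1)) e =
    (P.1 - (t0, u0).1) * A e P + (P.2 - (t0, u0).2) * C e P.
  rewrite /= dotBl !dotZl !dotBl kE alE !dotDl !dotZl /A /C; ring.
have cA e : {for (t0, u0), continuous (A e)}.
  by rewrite /A; cont; apply: cont_dot.
have cC e : {for (t0, u0), continuous (C e)}.
  by rewrite /C; cont; apply: cont_dot.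
have AE e : A e (t0, u0) = dot (dstereo q z (k t0)) e.
  by rewrite /A /dstereo /= dotDl !dotZl dotBl.
have CE e : C e (t0, u0) = - dot (dstereo q z (al u0)) e.
  by rewrite /C /dstereo /= dotDl !dotZl dotBl; ring.
(* The negative frame and the reversal by the projection compensate, so the local degree is the sign
   of the hit. *)
have detE : A e1 (t0, u0) * C e2 (t0, u0) - A e2 (t0, u0) * C e1 (t0, u0) =
    (1 - dot z q) ^+ 2 * - det3 q e1 e2 * det3 z (al u0) (k t0).
  rewrite !AE !CE; transitivity (dot (dstereo q z (al u0)) e1 * dot (dstereo q z (k t0)) e2
    - dot (dstereo q z (al u0)) e2 * dot (dstereo q z (k t0)) e1); first by ring.
  rewrite (gram_tangent _ _ hq) ?dstereo_orth // dstereo_det3 //; ring.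
have kp : 0 < (1 - dot z q) ^+ 2 * - det3 q e1 e2.
  by rewrite mulr_gt0 ?oppr_gt0 // exprn_gt0 // subr_gt0.
move=> D0; have := simple_zero_slopes (fE e1) (fE e2) (cA e1) (cA e2) (cC e1) (cC e2).
rewrite detE pmulr_rgt0 //; apply.
by rewrite mulf_neq0 // lt0r_neq0.
Qed.

End Crossing.

(** * Winding numbers of the loops of a diagram *)
Section HalfPlane.
Variable R : realType.
Local Notation V := 'rV[R]_3.
Local Notation tau := (2 * @pi R).

Lemma cos_gt0_center (x : R) : 0 < cos x -> exists k : int, `|x - tau * k%:~R| < pi / 2.
Proof.
move=> cx; have pi0 := pi_gt0 R.
have pi2 : 0 < tau by rewrite mulr_gt0.
pose n := Num.floor ((x + pi) / tau).
pose y := x - tau * n%:~R.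
have yb : - pi <= y < pi.
  rewrite /y; apply/andP; split.
    have : n%:~R * tau <= x + pi by rewrite -ler_pdivlMr // floor_le.
    by lra.
  have : x + pi < (n + 1)%:~R * tau by rewrite -ltr_pdivrMr // floorD1_gt.
  by rewrite intrD; lra.
have cy : 0 < cos `|y| by rewrite cos_norm /y -mulrN -mulrNz cosDint.
exists n; rewrite -/y ltNge; apply/negP => h.
have : cos `|y| <= cos (pi / 2).
  rewrite leNgt ltr_cos ?in_itv /= ?normr_ge0 -?leNgt //; first by rewrite ler_norml; lra.
  by rewrite divr_ge0 ?ler_pdivrMr; lra.
by rewrite cos_pihalf; lra.
Qed.

(** The cosine vanishes at distance [pi / 2] from a multiple of [tau], so [f] cannot leave or enter
    the interval around it. *)
Lemma cos_gt0_stay (f : R -> R) (k : int) (l r : R) : l <= r ->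
  (forall t, l <= t <= r -> {for t, continuous f}) ->
  (forall t, l <= t <= r -> 0 < cos (f t)) ->
  (`|f l - tau * k%:~R| < pi / 2) = (`|f r - tau * k%:~R| < pi / 2).
Proof.
move=> lr cf pf; have pi0 := pi_gt0 R.
have bad c : l <= c <= r -> `|f c - tau * k%:~R| <> pi / 2.
  move=> hc E; have := pf c hc.
  have -> : cos (f c) = cos (f c - tau * k%:~R) by rewrite -mulrN -mulrNz cosDint.
  by rewrite -cos_norm E cos_pihalf ltxx.
pose g t := `|f t - tau * k%:~R|.
have cg t : l <= t <= r -> {for t, continuous g}.
  by move=> ht; apply: cont_norm; apply: contB; [exact: cf|exact: cont_cst].
apply/idP/idP => h; rewrite ltNge; apply/negP => h'.
- have [|c hc E] := @IVT_pointwise R g l r (pi / 2) lr cg; last exact: bad hc E.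
  by rewrite (ltW h) h'.
- have [|c hc E] := @IVT_pointwise R g l r (pi / 2) lr cg; last exact: bad hc E.
  by rewrite (ltW h) h' orbT.
Qed.

Lemma half_plane (q e1 e2 b : V) : dot q q = 1 -> frame q e1 e2 ->
  exists al : R, forall (v : V) (th : R), dot v q = 0 -> 0 < dot v b ->
    polar (dot v e1) (dot v e2) th -> 0 < cos (th - al).
Proof.
move=> hq fr; have D0 : det3 q e1 e2 != 0 by rewrite lt_eqF.
pose b1 := det3 q b e2 / det3 q e1 e2; pose b2 := det3 q e1 b / det3 q e1 e2.
have E (v : V) : dot v q = 0 -> dot v b = b1 * dot v e1 + b2 * dot v e2.
  move=> vq; apply: (mulfI D0); rewrite -[LHS]dotZr (cramer q e1 e2) !dotDr !dotZr vq.
  by rewrite /b1 /b2; field.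
have [b0|b0] := boolP ((b1 != 0) || (b2 != 0)); last first.
  (* If the form [dot v b] vanishes on the plane orthogonal to [q], no [v] satisfies the
     assumption. *)
  exists 0 => v th vq; rewrite E //.
  move: b0; rewrite negb_or !negbK => /andP[/eqP-> /eqP->].
  by rewrite !mul0r addr0 ltxx.
have [al hal] := polar_exists b0.
by exists al => v th vq; rewrite E // => h hp; exact: polar_cos_gt0 hal hp h.
Qed.

Lemma half_plane_lift (q e1 e2 b : V) (v : R -> V) (th : R -> R) (l r : R) : l <= r ->
  dot q q = 1 -> frame q e1 e2 ->
  (forall t, l <= t <= r -> dot (v t) q = 0) ->
  (forall t, l <= t <= r -> 0 < dot (v t) b) ->
  arg_lift (fun t => dot (v t) e1) (fun t => dot (v t) e2) th l r ->
  `|th r - th l| < pi.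
Proof.
move=> lr hq fr vq vb H; have [al hal] := half_plane b hq fr.
have -> : th r - th l = (th r - al) - (th l - al) by ring.
apply: (@cos_gt0_range R (fun t => th t - al) l r lr).
  by move=> t ht; apply: contB; [exact: (H t ht).1|exact: cont_cst].
by move=> t ht; apply: hal (vq t ht) (vb t ht) (H t ht).2.
Qed.

Lemma seq_lt_bound (s : seq R) (M : R) : {in s, forall x, x < M} ->
  exists2 b, b < M & {in s, forall x, x < b}.
Proof.
elim: s => [|x s IH] h; first by exists (M - 1) => //; rewrite ltrBlDr ltrDl.
have [|b bM hb] := IH; first by move=> y ys; apply: h; rewrite in_cons ys orbT.
have xM := h x (mem_head _ _).
exists (Num.max b ((x + M) / 2)); first by rewrite gt_max bM midf_lt.
move=> y; rewrite in_cons lt_max => /orP[/eqP->|ys]; last by rewrite hb.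
by rewrite midf_lt ?orbT.
Qed.

End HalfPlane.

Section Index.
Variable R : realType.
Local Notation V := 'rV[R]_3.
Local Notation tau := (2 * @pi R).

Section ImmersedArc.
Variable g : R -> V.
Hypothesis hg : immersed_arc g.

Lemma arc_unit t : 0 <= t <= 1 -> dot (g t) (g t) = 1.
Proof. by case: hg => h _ _ _; exact: h. Qed.

Lemma arc_derivable t : 0 <= t <= 1 -> derivable g t 1.
Proof. by case: hg => _ h _ _; exact: h. Qed.

Lemma arc_cont t : 0 <= t <= 1 -> {for t, continuous g}.
Proof. by move=> ht; apply/differentiable_continuous/derivable1_diffP/arc_derivable. Qed.

Lemma arc_tangent t : 0 < t < 1 -> dot (derive1 g t) (g t) = 0.
Proof.
move=> ht; apply: unit_curve_tangent; first by apply: arc_derivable; lra.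
have : \forall s \near t, s \in `]0, 1[ by apply: near_in_itvoo; rewrite in_itv.
by apply: filterS => s; rewrite in_itv /= => hs; apply: arc_unit; lra.
Qed.

End ImmersedArc.

Variable K : diagram R.

Let hK : immersed_arc K := diagram_immersed K.

Lemma crossing_times c : c \in crossings K ->
  [/\ 0 < Num.min c.1 c.2, Num.min c.1 c.2 < Num.max c.1 c.2, Num.max c.1 c.2 < 1 &
      K (Num.min c.1 c.2) = K (Num.max c.1 c.2)].
Proof.
move=> hc; have [h1 h2] := crossings_inner hc.
have hc' : (c.1, c.2) \in crossings K by rewrite -surjective_pairing.
have b1 : 0 <= c.1 <= 1 by lra.
have b2 : 0 <= c.2 <= 1 by lra.
have [n e] := (@crossingsP _ K _ _ b1 b2).2 (or_introl hc').
by case: (ltgtP c.1 c.2) => // lt; split => //; lra.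
Qed.

Lemma diagram_tail_only t : 0 < t <= 1 -> K t != K 0.
Proof.
move=> ht; apply/eqP => E.
have b1 : 0 <= t <= 1 by lra.
have b2 : 0 <= (0 : R) <= 1 by lra.
have [||] := (@crossingsP _ K _ _ b1 b2).1.
- by split => // t1; lra.
- by move=> /crossings_inner /=; lra.
- by move=> /crossings_inner /=; lra.
Qed.

Lemma diagram_head_only t : 0 <= t < 1 -> K t != K 1.
Proof.
move=> ht; apply/eqP => E.
have b1 : 0 <= t <= 1 by lra.
have b2 : 0 <= (1 : R) <= 1 by lra.
have [||] := (@crossingsP _ K _ _ b1 b2).1.
- by split => // t1; lra.
- by move=> /crossings_inner /=; lra.
- by move=> /crossings_inner /=; lra.
Qed.

Lemma head_unit : dot (K 1) (K 1) = 1. Proof. by apply: (arc_unit hK); lra. Qed.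
Lemma tail_unit : dot (K 0) (K 0) = 1. Proof. by apply: (arc_unit hK); lra. Qed.

Definition angle e1 e2 (th : R -> R) (l r : R) : Prop :=
  arg_lift (fun t => dot (stereo (K 0) (K 1) (K t)) e1)
           (fun t => dot (stereo (K 0) (K 1) (K t)) e2) th l r.

(** The times 0 and 1 are excluded because the projected vector vanishes at the tail and at the
    head. *)
Lemma angle_exists e1 e2 (l r : R) : frame (K 1) e1 e2 -> 0 < l -> l <= r -> r < 1 ->
  exists2 th, (forall t, {for t, continuous th}) & angle e1 e2 th l r.
Proof.
move=> fr l0 lr r1; apply: lift_exists => // t ht.
have cK : {for t, continuous K} by apply: (arc_cont hK); lra.
have cc (v : V) : {for t, continuous (fun _ : R => v)} by exact: cvg_cst.
have cs e : {for t, continuous (fun s => dot (stereo (K 0) (K 1) (K s)) e)}.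
  exact: (@cont_stereo_coord _ _ (fun=> K 0) (fun=> K 1) K (fun=> e) t (cc _) (cc _) cK (cc _)).
split; [exact: cs|exact: cs|].
apply: stereo_coord_neq0 => //; try exact: head_unit; try exact: tail_unit.
- by apply: (arc_unit hK); lra.
- by apply: diagram_head_only; lra.
- by apply: diagram_head_only; lra.
- by apply: diagram_tail_only; lra.
Qed.

(* The winding number around {K 0, K 1} of the loop of K at the crossing [c]. *)
Definition winding (c : R * R) (n : int) : Prop :=
  exists e1 e2 th, [/\ frame (K 1) e1 e2,
    angle e1 e2 th (Num.min c.1 c.2) (Num.max c.1 c.2) &
    th (Num.max c.1 c.2) - th (Num.min c.1 c.2) = tau * n%:~R].

(** The integer depends neither on the frame nor on the lift, since the loop is closed. *)
Lemma winding_angle c n e1 e2 th : c \in crossings K -> winding c n ->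
  frame (K 1) e1 e2 -> angle e1 e2 th (Num.min c.1 c.2) (Num.max c.1 c.2) ->
  th (Num.max c.1 c.2) - th (Num.min c.1 c.2) = tau * n%:~R.
Proof.
move=> hc [f1 [f2 [et [fr' H' <-]]]] fr H.
have [l0 lr r1 E] := crossing_times hc.
apply: (frame_change (ltW lr) head_unit fr fr' _ _ H H'); last by rewrite E.
by move=> t _; apply: stereo_orth; exact: head_unit.
Qed.

Lemma winding_uniq c n m : c \in crossings K -> winding c n -> winding c m -> n = m.
Proof.
move=> hc hn [e1 [e2 [th [fr H E]]]].
have := winding_angle hc hn fr H; rewrite E => /(mulfI _) -/(_ _)/eqP.
rewrite eqr_int => h; apply/eqP; rewrite eq_sym h //.
by rewrite gt_eqF // mulr_gt0 ?pi_gt0.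
Qed.

Lemma angle_loop c e1 e2 th : c \in crossings K ->
  angle e1 e2 th (Num.min c.1 c.2) (Num.max c.1 c.2) ->
  cos (th (Num.max c.1 c.2) - th (Num.min c.1 c.2)) = 1.
Proof.
move=> hc H; have [l0 lr r1 E] := crossing_times hc.
set l := Num.min _ _ in lr E H *; set r := Num.max _ _ in lr E H *.
have hl : l <= l <= r by rewrite lexx ltW.
have hr : l <= r <= r by rewrite lexx ltW.
by apply: polar_uniq (H l hl).2 _; rewrite E; exact: (H r hr).2.
Qed.

Lemma winding_exists c : c \in crossings K -> exists n, winding c n.
Proof.
move=> hc; have [l0 lr r1 E] := crossing_times hc.
have [|e1 [e2 fr]] := @frame_exists R (K 1).
  by apply/eqP => h; have := head_unit; rewrite h dot0l => /eqP; rewrite eq_sym oner_eq0.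
have [th _ H] := angle_exists fr l0 (ltW lr) r1.
have [n hn] := cos_eq1 (angle_loop hc H).
by exists n, e1, e2, th.
Qed.

End Index.

(** * The winding number as a sum of signs along a shortcut *)

Section IndWinding.
Variables (R : realType) (K : diagram R) (a : shortcut K).
Local Notation V := 'rV[R]_3.
Local Notation tau := (2 * @pi R).

Let hK : immersed_arc K := diagram_immersed K.
Let ha : immersed_arc a := shortcut_immersed a.

Lemma dot_bound_lt1 (l r : R) : 0 < l -> l <= r -> r < 1 ->
  exists2 M, M < 1 & forall t, l <= t <= r -> dot (K t) (K 1) <= M.
Proof.
move=> l0 lr r1.
have [|t0] := @EVT_max R (fun t => dot (K t) (K 1)) l r lr.
  apply: pointwise_within => t ht; apply: cont_dot; last exact: cvg_cst.
  by apply: (arc_cont hK); lra.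
rewrite in_itv /= => ht0 hmax; exists (dot (K t0) (K 1)).
  apply: sphere_dot_lt1; first (by apply: (arc_unit hK); lra); first exact: head_unit.
  by apply: diagram_head_only; lra.
by move=> t ht; apply: hmax; rewrite in_itv.
Qed.

(** Provides the top side of the rectangle: a time beyond all hits at which the shortcut is closer
    to the head than the whole loop. *)
Lemma shortcut_near_head (M : R) : M < 1 ->
  exists u1, [/\ 0 < u1, u1 < 1, M < dot (a u1) (K 1) &
    forall h, h \in hits a -> h.2 < u1].
Proof.
move=> M1.
have [|b b1 hb] := @seq_lt_bound R [seq h.2 | h <- hits a] 1.
  by move=> u /mapP[[t u'] /hitsP[_ /andP[_ hu] _] ->].
have ca : {for 1, continuous (fun u => dot (a u) (K 1))}.
  apply: cont_dot; last exact: cvg_cst.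
  by apply: (arc_cont ha); lra.
have Ma : M < dot (a 1) (K 1) by rewrite shortcut_head head_unit.
have /nbhs_ballP[d /= d0 hd] : \forall u \near (1 : R), M < dot (a u) (K 1).
  exact: (cvgr_gt (dot (a 1) (K 1)) ca).
(* The three bounds put [u1] beyond the hits, above 0, and within distance [d] of 1. *)
pose u1 := Num.max b (Num.max (1 / 2) (1 - d / 2)).
have h1 : b <= u1 by rewrite le_max lexx.
have h2 : 1 / 2 <= u1 by rewrite !le_max lexx orbT.
have h3 : 1 - d / 2 <= u1 by rewrite !le_max lexx !orbT.
have h4 : u1 < 1 by rewrite !gt_max b1 /=; lra.
exists u1; split => //; first lra.
  by apply: hd; rewrite /ball /= ger0_norm; lra.
by move=> h hh; apply: lt_le_trans (hb h.2 _) h1; exact: map_f.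
Qed.

Lemma hits_uniq : uniq (hits a).
Proof.
apply: (@map_uniq _ _ fst); apply: sorted_uniq (hits_sorted a).
- exact: lt_trans.
- exact: ltxx.
Qed.

Lemma Ind_winding c : c \in crossings K -> winding K c (Ind a c).
Proof.
move=> hc; have [l0 lr r1 Klr] := crossing_times hc.
rewrite /winding /Ind; set l := Num.min _ _ in l0 lr Klr *.
set r := Num.max _ _ in lr r1 Klr *.
have hq : dot (K 1) (K 1) = 1 := head_unit K.
have [|e1 [e2 fr]] := @frame_exists R (K 1).
  by apply/eqP => h; have := hq; rewrite h dot0l => /eqP; rewrite eq_sym oner_eq0.
have [M M1 KM] := dot_bound_lt1 l0 (ltW lr) r1.
have [u1 [u10 u11 Mu hu1]] := shortcut_near_head M1.
have Kunit t : l <= t <= r -> dot (K t) (K t) = 1 by move=> ht; apply: (arc_unit hK); lra.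
have aunit u : 0 <= u <= u1 -> dot (a u) (a u) = 1 by move=> hu; apply: (arc_unit ha); lra.
have Kq t : l <= t <= r -> K t != K 1 by move=> ht; apply: diagram_head_only; lra.
have aq u : 0 <= u <= u1 -> a u != K 1.
  move=> hu; rewrite -(shortcut_head a); apply/eqP => h.
  have hu' : 0 <= u <= 1 by lra.
  have h1 : 0 <= (1 : R) <= 1 by lra.
  have : u = 1 by exact: shortcut_injective hu' h1 h.
  by move=> u1E; lra.
have Kcont t : l <= t <= r -> {for t, continuous K} by move=> ht; apply: (arc_cont hK); lra.
have acont u : 0 <= u <= u1 -> {for u, continuous a} by move=> hu; apply: (arc_cont ha); lra.
pose f e (P : R * R) := dot (stereo (a P.2) (K 1) (K P.1)) e.
pose zs := [seq h <- hits a | l < h.1 < r].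
(* No zero lies on a vertical side because the shortcut avoids crossings, nor on the bottom side
   because the diagram meets its tail only at time 0. *)
have avoid t u : l <= t <= r -> 0 <= u <= u1 -> K t = a u -> (t, u) \in zs.
  move=> ht hu E; rewrite mem_filter /=.
  have notc : K l <> a u.
    move=> E'; have : a u = K c.1.
      by rewrite -E'; move: Klr; rewrite /l /r; case: (leP c.1 c.2).
    by apply: shortcut_avoids_crossings => //; lra.
  have tl : t != l by apply/eqP => h; apply: notc; rewrite -h.
  have tr : t != r by apply/eqP => h; apply: notc; rewrite Klr -h.
  have -> : l < t < r by rewrite !lt_def tl (eq_sym r) tr.
  apply/hitsP; split => //; first lra.
  apply/andP; split; last lra.
  rewrite lt_def; apply/andP; split; last lra.
  apply/eqP => u0; have : K t != K 0 by apply: diagram_tail_only; lra.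
  by rewrite -(shortcut_tail a) E u0 eqxx.
have cf e P : l <= P.1 <= r -> 0 <= P.2 <= u1 -> {for P, continuous (f e)}.
  move=> h1 h2; have cc (v : V) : {for P, continuous (fun _ : R * R => v)} by exact: cvg_cst.
  exact: (@cont_stereo_coord _ _ (fun P => a P.2) (fun=> K 1) (fun P => K P.1) (fun=> e) P
    (@cont_comp_snd _ _ _ P a (acont _ h2)) (cc _) (@cont_comp_fst _ _ _ P K (Kcont _ h1)) (cc _)).
have f0 P : l <= P.1 <= r -> 0 <= P.2 <= u1 -> K P.1 != a P.2 ->
    (f e1 P != 0) || (f e2 P != 0).
  move=> h1 h2 Ka; apply: stereo_coord_neq0 => //; [exact: aunit|exact: Kunit|exact: aq|exact: Kq].
have turns : boundary_turns (f e1) (f e2) l r 0 u1 (\sum_(z <- zs) int_of_sign (hit_sign a z)).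
  apply: argument_principle => //.
  - by apply: filter_uniq; exact: hits_uniq.
  - move=> z; rewrite mem_filter => /andP[hz hz']; split => //; rewrite hu1 // andbT.
    by move: hz'; rewrite [z]surjective_pairing => /hitsP[_ /andP[]].
  - move=> z; rewrite mem_filter => /andP[hz hz'].
    have hzh : (z.1, z.2) \in hits a by rewrite -surjective_pairing.
    have /hitsP[hz1 hz2 Ez] := hzh.
    rewrite [z in simple_zero _ _ z]surjective_pairing.
    apply: stereo_simple_zero => //; rewrite -?/(K _).
    + by apply: (arc_derivable hK); lra.
    + by apply: (arc_derivable ha); lra.
    + by apply: Kunit; lra.
    + by apply: Kq; lra.
    + exact: (arc_tangent hK).
    + exact: (arc_tangent ha).
    + exact: (hits_transverse hz').
  - move=> P h1 h2; split; [exact: cf|exact: cf|move=> Pz; apply: f0 => //].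
    apply: contra Pz => /eqP E; have := avoid _ _ h1 h2 E.
    by rewrite -surjective_pairing.
have hl : l <= l <= r by rewrite lexx ltW.
have hr : l <= r <= r by lra.
have h0 : 0 <= (0 : R) <= u1 by lra.
have hu : 0 <= u1 <= u1 by lra.
have [th cth H] := angle_exists fr l0 (ltW lr) r1.
have [tht _ Ht] : exists2 th, (forall t, {for t, continuous th}) &
    arg_lift (fun t => f e1 (t, u1)) (fun t => f e2 (t, u1)) th l r.
  apply: lift_exists (ltW lr) _ => t ht.
  have cfv e : {for t, continuous (fun t => f e (t, u1))}.
    by apply: (@cont_comp _ _ _ t (fun t => (t, u1))); [apply: cont_pair; cont|exact: cf].
  split; [exact: cfv|exact: cfv|].
  apply: f0 => //=; apply/eqP => /(avoid _ _ ht hu); rewrite mem_filter => /andP[_ /hu1] /=.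
  by rewrite ltxx.
have [thl _ Hl] : exists2 th, (forall t, {for t, continuous th}) &
    arg_lift (fun u => f e1 (l, u)) (fun u => f e2 (l, u)) th 0 u1.
  apply: lift_exists (ltW u10) _ => u hu'.
  have cfv e : {for u, continuous (fun u => f e (l, u))}.
    by apply: (@cont_comp _ _ _ u (fun u => (l, u))); [apply: cont_pair; cont|exact: cf].
  split; [exact: cfv|exact: cfv|].
  by apply: f0 => //=; apply/eqP => /(avoid _ _ hl hu'); rewrite mem_filter /= ltxx.
(* The bottom side is the loop seen from the tail; the vertical sides share the lift [thl], as
   [K l = K r]. *)
have Hb : arg_lift (fun t => f e1 (t, 0)) (fun t => f e2 (t, 0)) th l r.
  by move=> t ht; have := H t ht; rewrite /f /= shortcut_tail.
have Hr : arg_lift (fun u => f e1 (r, u)) (fun u => f e2 (r, u)) thl 0 u1.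
  by move=> u hu'; have := Hl u hu'; rewrite /f /= Klr.
exists e1, e2, th; split => //.
have := turns _ _ _ _ Hb Ht Hl Hr; rewrite big_filter.
suff -> : tht r - tht l = 0 by move=> <-; ring.
apply: cos_eq1_small.
  by apply: polar_uniq (Ht l hl).2 _; rewrite /f /= Klr; exact: (Ht r hr).2.
have pi0 := pi_gt0 R.
suff : `|tht r - tht l| < pi by move=> h; apply: lt_trans h _; lra.
(* In the direction from [a u1] to the head every vector of the top side has a positive component,
   because [a u1] is closer to the head than the loop is. *)
apply: (half_plane_lift (b := K 1 - a u1) (ltW lr) hq fr _ _ Ht).
  by move=> t ht; exact: stereo_orth.
move=> t ht /=.
have xq := KM t ht; have xu := Kunit t ht; have yu := aunit u1 hu.
have yq1 : dot (a u1) (K 1) < 1 by apply: sphere_dot_lt1 => //; exact: aq.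
have xy1 : dot (K t) (a u1) < 1.
  apply: sphere_dot_lt1 => //; apply/eqP => /(avoid _ _ ht hu).
  by rewrite mem_filter => /andP[_ /hu1] /=; rewrite ltxx.
have -> : dot (stereo (a u1) (K 1) (K t)) (K 1 - a u1) =
  (1 - dot (a u1) (K 1)) * ((1 - dot (K t) (a u1)) + (dot (a u1) (K 1) - dot (K t) (K 1))).
  rewrite dotBl !dotZl !dotBl !dotBr yu hq (dotC (K 1) (a u1)).
  ring.
by rewrite mulr_gt0 //; lra.
Qed.

End IndWinding.

(** * Reidemeister moves *)
Section LocalChange.
Variable R : realType.
Local Notation V := 'rV[R]_3.
Local Notation tau := (2 * @pi R).

(* The circle through [p] and [q] with normal vector [b] separates the cap from
   one of its sides. *)
Lemma cap_half_plane (p q e x : V) (h : R) (b := (1 - dot p q) *: e - (h - dot e q) *: (p - q)) :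
  dot p p = 1 -> dot q q = 1 -> dot x x = 1 -> p != q ->
  dot e p < h -> dot e q < h -> h <= dot e x -> 0 < dot (stereo p q x) b.
Proof.
move=> hp hq hx pq ep eq ex.
have xq : x != q by apply: contraTneq ex => ->; rewrite -ltNge.
have a0 := sphere_dot_lt1 hp hq pq; have b0 := sphere_dot_lt1 hx hq xq.
have xp1 : 0 <= 1 - dot x p.
  have := dot_ge0 (x - p); rewrite !dotBl !dotBr hx hp (dotC p x); lra.
have -> : dot (stereo p q x) b = (1 - dot p q) * ((1 - dot p q) * (dot e x - h)
    + (1 - dot x q) * (h - dot e p) + (h - dot e q) * (1 - dot x p)).
  rewrite /b /stereo !dotBl !dotZl !dotBl !dotBr !dotZr !dotBr hp hq.
  by rewrite (dotC q p) (dotC x e) (dotC q e) (dotC p e); ring.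
rewrite mulr_gt0 ?subr_gt0 // addrAC ltr_wpDl ?mulr_gt0 ?subr_gt0 //.
by rewrite addr_ge0 // mulr_ge0 // subr_ge0 // ltW.
Qed.

Lemma derive1_near (f g : R -> V) (t : R) : (\forall s \near t, f s = g s) ->
  derive1 f t = derive1 g t.
Proof. by move=> h; rewrite !derive1E; apply: near_eq_derive => //; rewrite oner_neq0. Qed.

Lemma tau_int_inj (m n : int) : `|tau * m%:~R - tau * n%:~R| < tau -> m = n.
Proof.
move=> h; apply/eqP; rewrite -subr_eq0 -(intr_eq0 R) intrB; apply/eqP.
have pi0 := pi_gt0 R; apply: (mulfI (lt0r_neq0 (_ : 0 < tau))); first lra.
rewrite mulr0 mulrBr; apply: cos_eq1_small h.
by apply: cosB_eq1; exact: cos_int.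
Qed.

Section Change.
Variables (K K' : diagram R) (I : seq (R * R)) (e : V) (h : R).
Hypothesis arcs01 : forall J, J \in I -> [/\ 0 < J.1, J.1 < J.2 & J.2 < 1].
Hypothesis arcs_disj : pairwise (fun J J' : R * R => (J.2 < J'.1) || (J'.2 < J.1)) I.
Hypothesis K'K : forall t : R, 0 <= t <= 1 -> ~~ has ((@inside R)^~ t) I -> K' t = K t.
Hypothesis K_out : forall t : R, 0 <= t <= 1 -> ~~ in_arcs I t -> dot e (K t) < h.
Hypothesis K_in : forall t : R, has ((@inside R)^~ t) I -> h < dot e (K t) /\ h < dot e (K' t).

Let hK : immersed_arc K := diagram_immersed K.
Let hK' : immersed_arc K' := diagram_immersed K'.

Lemma arcsP J J' : J \in I -> J' \in I -> [\/ J = J', J.2 < J'.1 | J'.2 < J.1].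
Proof.
move: arcs_disj; elim: I => //= J0 s IH /andP[/allP h0 hs].
rewrite !in_cons => /orP[/eqP->|Js] /orP[/eqP->|Js']; first by constructor 1.
- by have /orP[?|?] := h0 _ Js'; [constructor 2|constructor 3].
- by have /orP[?|?] := h0 _ Js; [constructor 3|constructor 2].
- exact: IH.
Qed.

Lemma not_in_arcs0 (t : R) : ~~ (0 < t < 1) -> ~~ in_arcs I t.
Proof.
move=> ht; apply/hasPn => J /arcs01[j1 j2 j3]; apply: contra ht; lra.
Qed.

Lemma inside_in_arcs (t : R) : has ((@inside R)^~ t) I -> in_arcs I t.
Proof. by apply: sub_has => J /andP[h1 h2]; rewrite !ltW. Qed.

Lemma change_tail : K' 0 = K 0.
Proof.
apply: K'K; first lra.
by apply: contra (not_in_arcs0 _); [exact: inside_in_arcs|rewrite ltxx].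
Qed.

Lemma change_head : K' 1 = K 1.
Proof.
apply: K'K; first lra.
by apply: contra (not_in_arcs0 _); [exact: inside_in_arcs|rewrite ltxx andbF].
Qed.

Lemma tail_out : dot e (K 0) < h.
Proof. by apply: K_out; [lra|apply: not_in_arcs0; rewrite ltxx]. Qed.

Lemma head_out : dot e (K 1) < h.
Proof. by apply: K_out; [lra|apply: not_in_arcs0; rewrite ltxx andbF]. Qed.

(** The two diagrams therefore agree at the ends of the arcs, although [in_arcs] counts these ends
    as part of the arcs. *)
Lemma arc_end_common (J : R * R) : J \in I -> ~~ has ((@inside R)^~ J.1) I /\ ~~ has ((@inside R)^~ J.2) I.
Proof.
move=> JI; have [j1 j2 j3] := arcs01 JI.
split; apply/hasPn => J' J'I; apply/negP => /andP[h1 h2].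
- by have [E|E|E] := arcsP JI J'I; move: h1 h2; rewrite ?E ?ltxx //; lra.
- by have [E|E|E] := arcsP JI J'I; move: h1 h2; rewrite -?E ?ltxx //; lra.
Qed.

(** The assumption concerns the open arcs only. At an end the two curves agree, and a point strictly
    outside the cap would keep nearby points of the open arc outside by continuity. *)
Lemma arc_in J (t : R) : J \in I -> J.1 <= t <= J.2 -> h <= dot e (K t) /\ h <= dot e (K' t).
Proof.
move=> JI ht; have [j1 j2 j3] := arcs01 JI.
have ins s : J.1 < s < J.2 -> h < dot e (K s) /\ h < dot e (K' s).
  by move=> hs; apply: K_in; apply/hasP; exists J.
have [/ins[h1 h2]|nt] := boolP (J.1 < t < J.2); first by rewrite !ltW.
have [tE|tE] : t = J.1 \/ t = J.2.
  have [?|?] := eqVneq t J.1; first by left.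
  by right; apply/eqP; apply: contraNT nt => ?; rewrite !lt_def eq_sym (eq_sym J.2); lra.
all: have -> : K' t = K t by apply: K'K; [lra|rewrite tE; have [] := arc_end_common JI].
all: suff : h <= dot e (K t) by [].
all: rewrite leNgt; apply/negP => hlt.
all: have cK : {for t, continuous (fun s => dot e (K s))} by
  apply: cont_dot; [exact: cvg_cst|apply: (arc_cont hK); lra].
all: have /nbhs_ballP[d /= d0 hd] : \forall s \near t, dot e (K s) < h by
  exact: (cvgr_lt (dot e (K t)) cK).
(* A time of the open arc within distance [d] of its end; the midpoint keeps it from
   overshooting. *)
- pose s := Num.min ((J.1 + J.2) / 2) (t + d / 2).
  have s1 : s <= (J.1 + J.2) / 2 by rewrite ge_min lexx.
  have s2 : s <= t + d / 2 by rewrite ge_min lexx orbT.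
  have s3 : t < s by rewrite lt_min; apply/andP; split; lra.
  have [] := ins s; first lra.
  have : dot e (K s) < h by apply: hd; rewrite /ball /= ltr_norml; lra.
  by lra.
- pose s := Num.max ((J.1 + J.2) / 2) (t - d / 2).
  have s1 : (J.1 + J.2) / 2 <= s by rewrite le_max lexx.
  have s2 : t - d / 2 <= s by rewrite le_max lexx orbT.
  have s3 : s < t by rewrite gt_max; apply/andP; split; lra.
  have [] := ins s; first lra.
  have : dot e (K s) < h by apply: hd; rewrite /ball /= ltr_norml; lra.
  by lra.
Qed.

Lemma in_arcs_cap (t : R) : in_arcs I t -> h <= dot e (K t).
Proof. by move=> /hasP[J JI /(arc_in JI)[]]. Qed.

(** [outer_crossings] tests the overpass only, but the underpass is the same point of the sphere and
    so lies outside the cap too. *)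
Lemma outer_crossing c : c \in crossings K -> ~~ in_arcs I c.1 -> ~~ in_arcs I c.2.
Proof.
move=> hc out; apply/negP => /in_arcs_cap.
have [h1 h2] := crossings_inner hc.
have [_ <-] : c.1 <> c.2 /\ K c.1 = K c.2.
  by apply/(@crossingsP _ K _ _ _ _); try lra; left; rewrite -surjective_pairing.
by have := K_out _ out; lra.
Qed.

(** The complement of finitely many closed arcs is open. Agreement on a neighbourhood is what makes
    the derivatives, hence the crossing signs, agree. *)
Lemma near_outside (t : R) : 0 < t < 1 -> ~~ in_arcs I t -> \forall s \near t, K' s = K s.
Proof.
move=> ht; move: (I) K'K => I0 K'K0 out.
have n01 : \forall s \near t, s \in `]0, 1[ by apply: near_in_itvoo; rewrite in_itv.
have nout : \forall s \near t, ~~ in_arcs I0 s.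
  elim: I0 out {K'K0} => [|J s IH] /=; first by move=> _; near=> s.
  rewrite negb_or => /andP[hJ hs].
  have nJ : \forall s \near t, ~~ (J.1 <= s <= J.2).
    move: hJ; rewrite negb_and -!ltNge => /orP[hJ|hJ].
    - have : \forall s \near t, s \in `]-oo, J.1[ by apply: near_in_itvNyo; rewrite in_itv.
      by apply: filterS => u; rewrite in_itv /= => ?; rewrite negb_and -ltNge; apply/orP; left.
    - have : \forall s \near t, s \in `]J.2, +oo[ by apply: near_in_itvoy; rewrite in_itv /= hJ.
      by apply: filterS => u; rewrite in_itv /= andbT => ?; rewrite negb_and -!ltNge; apply/orP; right.
  by apply: filterS2 nJ (IH hs) => u h1 h2; rewrite negb_or h1.
apply: filterS2 n01 nout => s; rewrite in_itv /= => hs h1.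
apply: K'K0; first lra.
by apply: contra h1; apply: sub_has => J /andP[? ?]; rewrite !ltW.
Unshelve. all: by end_near. Qed.

Lemma outer_sign c : c \in crossings K -> ~~ in_arcs I c.1 ->
  crossing_sign K' c = crossing_sign K c.
Proof.
move=> hc o1; have o2 := outer_crossing hc o1.
have [h1 h2] := crossings_inner hc.
rewrite /crossing_sign (derive1_near (near_outside h1 o1)) (derive1_near (near_outside h2 o2)).
by rewrite (nbhs_singleton (near_outside h1 o1)).
Qed.

End Change.
End LocalChange.

(** * Comparison of the arguments before and after a local move *)

Section Moves.
Variable R : realType.
Local Notation V := 'rV[R]_3.
Local Notation tau := (2 * @pi R).

Lemma polar_shift (a b x y : R) : polar a b x -> cos y = 1 -> polar a b (x + y).
Proof.
move=> [r r0 [-> ->]] cy; exists r => //.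
by rewrite cosD sinD cy (sin_cos1 cy) !mulr0 subr0 addr0 !mulr1.
Qed.

(** Two directions in the same open half-plane are not opposite. *)
Lemma cos_gt0_neqN1 (x y : R) : 0 < cos x -> 0 < cos y -> cos (x - y) != -1.
Proof.
move=> cx cy; apply/eqP => E.
have s0 : sin (x - y) = 0 by apply: cos1sin0; rewrite E normrN1.
have : cos x = - cos y by rewrite -[in LHS](subrK y x) cosD E s0 mul0r subr0 mulN1r.
by lra.
Qed.

Lemma times_bounds (S : seq R) : {in S, forall x, 0 < x < 1} ->
  exists l r, [/\ 0 < l, l < r, r < 1 & {in S, forall x, l < x < r}].
Proof.
move=> hS; pose m : R := 1 / 2; have h2 : 0 < m < 1 by rewrite /m; lra.
have [|r r1 hr] := @seq_lt_bound R (m :: S) 1.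
  by move=> x; rewrite in_cons => /orP[/eqP->|/hS /andP[]//]; case/andP: h2.
have [|l l1 hl] := @seq_lt_bound R [seq - x | x <- m :: S] 0.
  move=> y /mapP[x]; rewrite in_cons => hx ->; rewrite oppr_lt0.
  by case/orP: hx => [/eqP->|/hS /andP[]//]; case/andP: h2.
have hl' x : x \in m :: S -> - l < x by move=> xS; have := hl (- x) (map_f _ xS); lra.
exists (- l), r; split => //; first lra.
  by have := hl' _ (mem_head _ _); have := hr _ (mem_head _ _); lra.
by move=> x xS; rewrite hl' ?hr // in_cons xS orbT.
Qed.

(** All comparisons of indices under a local move rest on this normalization: the two arguments are
    chosen equal outside the disc, and along each arc both stay within [pi / 2] of one constant,
    since the disc is seen from the tail within a half-plane. *)
Lemma change_angles (I : seq (R * R)) (K K' : diagram R) : local_change I K K' ->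
  exists e1 e2 l r th th',
   [/\ frame (K 1) e1 e2 /\ frame (K' 1) e1 e2,
       angle K e1 e2 th l r /\ angle K' e1 e2 th' l r,
       {in crossings K ++ crossings K', forall c, l <= c.1 <= r /\ l <= c.2 <= r},
       forall t, l <= t <= r -> ~~ in_arcs I t -> th' t = th t &
       forall J, J \in I -> exists k, forall t, J.1 <= t <= J.2 ->
         `|th t - k| < pi / 2 /\ `|th' t - k| < pi / 2].
Proof.
move=> [e [h [_ [arcs01 disj] K'K [K_out K_in] _]]].
have hK := diagram_immersed K; have hK' := diagram_immersed K'.
have E0 := change_tail arcs01 K'K; have E1 := change_head arcs01 K'K.
pose C := crossings K ++ crossings K'.
have [|l [r [l0 lr r1 hS]]] := @times_bounds ([seq c.1 | c <- C] ++ [seq c.2 | c <- C] ++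
    [seq J.1 | J <- I] ++ [seq J.2 | J <- I]).
  have hC c : c \in C -> 0 < c.1 < 1 /\ 0 < c.2 < 1.
    by rewrite mem_cat => /orP[] /crossings_inner.
  move=> x; rewrite !mem_cat => /or4P[] /mapP[c hc ->].
  - by have [] := hC c hc.
  - by have [] := hC c hc.
  - by have [] := arcs01 c hc; lra.
  - by have [] := arcs01 c hc; lra.
have hlr : {in C, forall c, l <= c.1 <= r /\ l <= c.2 <= r}.
  move=> c hc; have := hS c.1; have := hS c.2; rewrite !mem_cat.
  rewrite (map_f fst hc) (map_f snd hc) /= orbT => /(_ isT) h2 /(_ isT) h1; lra.
have Ilr J : J \in I -> l < J.1 /\ J.2 < r.
  move=> hJ; have := hS J.1; have := hS J.2; rewrite !mem_cat.
  rewrite (map_f fst hJ) (map_f snd hJ) /= !orbT => /(_ isT) h2 /(_ isT) h1; lra.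
have hq := head_unit K; have hp := tail_unit K.
have pq : K 0 != K 1 by apply: diagram_head_only; lra.
have [|e1 [e2 fr]] := @frame_exists R (K 1).
  by apply/eqP => E; have := hq; rewrite E dot0l => /eqP; rewrite eq_sym oner_eq0.
have fr' : frame (K' 1) e1 e2 by rewrite E1.
have [th cth H] := angle_exists fr l0 (ltW lr) r1.
have [th0 cth0 H0] := angle_exists fr' l0 (ltW lr) r1.
have hl : l <= l <= r by lra.
have cl : ~~ has ((@inside R)^~ l) I.
  apply/hasPn => A hA; have [i1 i2] := Ilr A hA.
  by apply/negP; rewrite /inside => /andP[j1 j2]; move: (lt_trans i1 j1); rewrite ltxx.
have same t : l <= t <= r -> ~~ has ((@inside R)^~ t) I -> cos (th0 t - th t) = 1.
  move=> ht hc; apply: polar_uniq (H t ht).2 _.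
  by have := (H0 t ht).2; rewrite E0 E1 K'K //; lra.
(* A multiple of [tau], subtracted so that the two arguments agree at time [l]. *)
pose d := th0 l - th l.
have cd : cos (- d) = 1 by rewrite cosN same.
pose th' t := th0 t - d.
have H' : angle K' e1 e2 th' l r.
  move=> t ht; split; first by apply: contB; [exact: cth0|exact: cont_cst].
  by apply: polar_shift cd; exact: (H0 t ht).2.
(* The normal vector is the one of [cap_half_plane] for the tail and the head. *)
have [al hal] := half_plane ((1 - dot (K 0) (K 1)) *: e - (h - dot e (K 1)) *: (K 0 - K 1)) hq fr.
have pK := tail_out arcs01 K_out; have qK := head_out arcs01 K_out.
have cap J t : J \in I -> J.1 <= t <= J.2 -> 0 < cos (th t - al) /\ 0 < cos (th' t - al).
  move=> hJ ht; have [h1 h2] := arc_in arcs01 disj K'K K_in hJ ht.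
  have [i1 i2] := Ilr J hJ; have htlr : l <= t <= r by lra.
  split.
  - apply: hal (H t htlr).2; first exact: stereo_orth.
    by apply: cap_half_plane => //; apply: (arc_unit hK); lra.
  - apply: (hal (stereo (K 0) (K 1) (K' t))); first exact: stereo_orth.
      by apply: cap_half_plane => //; apply: (arc_unit hK'); lra.
    by have := (H' t htlr).2; rewrite E0 E1.
(* The difference is a multiple of [tau] at common times. Inside an arc it is never an odd multiple
   of [pi], both directions being in one half-plane; so it keeps its value 0 from time [l]. *)
have common t : l <= t <= r -> ~~ has ((@inside R)^~ t) I -> th' t = th t.
  move=> ht ct; have cosl : cos (th' l - th l) = 1.
    by rewrite /th' /d (_ : _ - _ = 0) ?cos0 //; ring.
  have cost s : l <= s <= r -> ~~ has ((@inside R)^~ s) I -> cos (th' s - th s) = 1.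
    move=> hs cs; rewrite /th' (_ : _ - _ = th0 s - th s - d); last by ring.
    by apply: cosB_eq1; [exact: same|rewrite -cosN].
  suff : th' l - th l = th' t - th t by rewrite /th' /d; lra.
  apply: (@cos_neqN1_range R (fun s => th' s - th s)) => //; first lra.
  - move=> s hs; have hs' : l <= s <= r by lra.
    by apply: contB; [exact: (H' s hs').1|exact: (H s hs').1].
  - move=> s hs; have [/hasP[J hJ /andP[j1 j2]]|cs] := boolP (has ((@inside R)^~ s) I).
      have [|h1 h2] := cap J s hJ; first lra.
      have -> : th' s - th s = (th' s - al) - (th s - al) by ring.
      exact: cos_gt0_neqN1.
    have hs' : l <= s <= r by lra.
    by rewrite (cost s hs' cs) gt_eqF // (lt_trans (ltrN10 R)) ?ltr01.
  - exact: cost.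
exists e1, e2, l, r, th, th'; split => //.
  by move=> t ht ct; apply: common => //; apply: contra ct; exact: inside_in_arcs.
move=> J hJ; have [j1 j2 j3] := arcs01 J hJ; have [i1 i2] := Ilr J hJ.
have [|c1 _] := cap J J.1 hJ; first lra.
have [k hk] := cos_gt0_center c1.
(* The branch [k] is read off at [J.1], where both arguments agree, and neither can leave it along
   the arc. *)
exists (al + tau * k%:~R) => t ht.
have st (f : R -> R) : (forall s, l <= s <= r -> {for s, continuous f}) ->
    (forall s, J.1 <= s <= t -> 0 < cos (f s - al)) -> f J.1 = th J.1 ->
    `|f t - (al + tau * k%:~R)| < pi / 2.
  move=> cf pf fJ; rewrite opprD addrA.
  have h1 : J.1 <= t by lra.
  rewrite -(@cos_gt0_stay R (fun s => f s - al) k J.1 t h1) ?fJ //.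
  by move=> s hs; apply: contB; [apply: cf; lra|exact: cont_cst].
split; apply: st => //.
- by move=> s hs; have [|] := cap J s hJ; first lra.
- by move=> s hs; exact: (H' s hs).1.
- by move=> s hs; have [|] := cap J s hJ; first lra.
- apply: common; first lra.
  by have [] := arc_end_common arcs01 disj hJ.
Qed.

Lemma winding_angle_sub (K : diagram R) c n e1 e2 th l r : c \in crossings K ->
  winding K c n -> frame (K 1) e1 e2 -> angle K e1 e2 th l r ->
  l <= c.1 <= r -> l <= c.2 <= r ->
  th (Num.max c.1 c.2) - th (Num.min c.1 c.2) = tau * n%:~R.
Proof.
move=> hc hn fr H h1 h2; apply: winding_angle hc hn fr _.
apply: lift_sub H; first by rewrite le_min; lra.
by rewrite ge_max; lra.
Qed.

(* The arguments at corresponding ends of the two loops differ by less than pi, so the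
   integers [n] and [n'] differ by less than 1. *)
Lemma winding_arcs (K K' : diagram R) (c c' : R * R) (n n' : int) e1 e2 th th' l r
    (k1 k2 : R) :
  c \in crossings K -> c' \in crossings K' -> winding K c n -> winding K' c' n' ->
  frame (K 1) e1 e2 -> frame (K' 1) e1 e2 ->
  angle K e1 e2 th l r -> angle K' e1 e2 th' l r ->
  l <= c.1 <= r /\ l <= c.2 <= r -> l <= c'.1 <= r /\ l <= c'.2 <= r ->
  `|th c.1 - k1| < pi / 2 -> `|th c.2 - k2| < pi / 2 ->
  `|th' c'.1 - k1| < pi / 2 -> `|th' c'.2 - k2| < pi / 2 ->
  (c.1 < c.2) = (c'.1 < c'.2) -> n = n'.
Proof.
move=> hc hc' hn hn' fr fr' H H' [i1 i2] [i1' i2'] b1 b2 b1' b2' ord.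
have := winding_angle_sub hc hn fr H i1 i2; have := winding_angle_sub hc' hn' fr' H' i1' i2'.
move=> E' E; apply: (@tau_int_inj R); rewrite -E -E'.
have pi0 := pi_gt0 R.
move: b1 b2 b1' b2'; rewrite !ltr_norml => b1 b2 b1' b2'.
move: ord; case: (ltP c.1 c.2) => o; case: (ltP c'.1 c'.2) => o' // _; lra.
Qed.

End Moves.

(** * The signed count of crossings of given index under Reidemeister moves *)

Section WritheSum.
Variable R : realType.
Local Notation tau := (2 * @pi R).
Implicit Types (K : diagram R) (I : seq (R * R)) (n : int).

(** At a crossing the winding number exists and is unique, so the default 0 is taken only
    elsewhere. *)
Definition windex K (c : R * R) : int := xget 0 [set n | winding K c n].

Lemma windexP K c : c \in crossings K -> winding K c (windex K c).
Proof. by move=> /winding_exists[n hn]; exact: (xgetPex 0 (ex_intro _ n hn)). Qed.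

Lemma windexE K c n : c \in crossings K -> winding K c n -> windex K c = n.
Proof. by move=> hc; apply: winding_uniq hc (windexP hc). Qed.

Definition writhe_sum K n : int :=
  \sum_(c <- crossings K | windex K c == n) crossing_sign K c.

Lemma diagram_writheE K (a : shortcut K) n :
  diagram_writhe a n = (writhe_sum K n %/ 2)%Z.
Proof.
rewrite /diagram_writhe /writhe_sum big_seq_cond [in RHS]big_seq_cond.
congr (_ %/ _)%Z; apply: eq_bigl => c; case hc: (c \in crossings K) => //=.
by rewrite (windexE hc (Ind_winding a hc)).
Qed.

Lemma writhe_sum_split I K n : writhe_sum K n =
  \sum_(c <- inner_crossings I K | windex K c == n) crossing_sign K c +
  \sum_(c <- outer_crossings I K | windex K c == n) crossing_sign K c.
Proof.
rewrite -big_cat /writhe_sum; apply: perm_big.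
by rewrite perm_sym /inner_crossings /outer_crossings perm_filterC.
Qed.

Lemma outer_sum I K K' n : local_change I K K' ->
  \sum_(c <- outer_crossings I K' | windex K' c == n) crossing_sign K' c =
  \sum_(c <- outer_crossings I K | windex K c == n) crossing_sign K c.
Proof.
move=> chg; have [e1 [e2 [l [r [th [th' [[fr fr'] [H H'] hlr common _]]]]]]] := change_angles chg.
have [e [h [_ [arcs01 disj] K'K [K_out K_in] outp]]] := chg.
rewrite (perm_big _ outp) big_seq_cond [in RHS]big_seq_cond.
have main c : c \in outer_crossings I K ->
    windex K' c = windex K c /\ crossing_sign K' c = crossing_sign K c.
  move=> ho; have ho' : c \in outer_crossings I K' by rewrite (perm_mem outp).
  move: ho'; rewrite mem_filter => /andP[out1 hc'].
  move: ho; rewrite mem_filter => /andP[_ hc].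
  have out2 := outer_crossing arcs01 disj K'K K_out K_in hc out1.
  split; last exact: (outer_sign arcs01 disj K'K K_out K_in hc out1).
  have [i1 i2] : l <= c.1 <= r /\ l <= c.2 <= r by apply: hlr; rewrite mem_cat hc.
  have E := winding_angle_sub hc (windexP hc) fr H i1 i2.
  have E' := winding_angle_sub hc' (windexP hc') fr' H' i1 i2.
  apply: (@tau_int_inj R); rewrite -E -E'.
  have -> : th' (Num.max c.1 c.2) = th (Num.max c.1 c.2).
    by case: (leP c.1 c.2) => _; apply: common.
  have -> : th' (Num.min c.1 c.2) = th (Num.min c.1 c.2).
    by case: (leP c.1 c.2) => _; apply: common.
  by rewrite subrr normr0 mulr_gt0 // pi_gt0.
apply: eq_big => [c|c /andP[ho _]]; last by have [_ ->] := main c ho.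
by apply: andb_id2l => ho; have [-> _] := main c ho.
Qed.

(** Both ends of the new loop are on one arc, so its argument varies by less than [pi] and the index
    is 0, a value that [n] excludes. *)
Lemma writhe_sum_R1 K K' n : n != 0 -> reidemeister1 K K' ->
  writhe_sum K' n = writhe_sum K n.
Proof.
move=> n0 [J [chg iK [c [iK' c1 c2]]]].
rewrite !(writhe_sum_split [:: J]) (outer_sum _ chg) iK iK' big_nil big_cons big_nil.
suff -> : windex K' c = 0 by rewrite eq_sym (negPf n0).
have [e1 [e2 [l [r [th [th' [[fr fr'] [H H'] hlr _ hJ]]]]]]] := change_angles chg.
have hc : c \in crossings K'.
  have : c \in inner_crossings [:: J] K' by rewrite iK' mem_head.
  by rewrite mem_filter => /andP[].
have [i1 i2] : l <= c.1 <= r /\ l <= c.2 <= r by apply: hlr; rewrite mem_cat hc orbT.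
have E := winding_angle_sub hc (windexP hc) fr' H' i1 i2.
have [k hk] := hJ J (mem_head _ _).
move: c1 c2; rewrite /inside => /andP[c11 c12] /andP[c21 c22].
have [|_ b1] := hk c.1; first by rewrite !ltW.
have [|_ b2] := hk c.2; first by rewrite !ltW.
apply: (@tau_int_inj R); rewrite mulr0 subr0 -E; have pi0 := pi_gt0 R.
move: b1 b2; rewrite !ltr_norml; case: (leP c.1 c.2) => _; lra.
Qed.

(** Disjoint arcs fix which strand of a crossing comes first, so loops at corresponding crossings
    are traversed between the arcs in the same order. *)
Lemma arcs_order (J1 J2 : R * R) (x1 x2 y1 y2 : R) :
  inside J1 x1 -> inside J2 x2 -> inside J1 y1 -> inside J2 y2 ->
  (J1.2 < J2.1) || (J2.2 < J1.1) -> (x1 < x2) = (y1 < y2).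
Proof.
move=> /andP[? ?] /andP[? ?] /andP[? ?] /andP[? ?] /orP[lt|lt].
- have -> : x1 < x2 by lra.
  by symmetry; lra.
- have -> : (x1 < x2) = false by apply/negP => ?; lra.
  by symmetry; apply/negP => ?; lra.
Qed.

(** The two crossings join the same pair of arcs, hence have equal indices; their opposite signs
    cancel in the same sum. *)
Lemma writhe_sum_R2 K K' n : reidemeister2 K K' ->
  writhe_sum K' n = writhe_sum K n.
Proof.
move=> [Jo [Ju [chg iK [c [d [iK' /andP[c1 c2] /andP[d1 d2] sgn]]]]]].
rewrite !(writhe_sum_split [:: Jo; Ju]) (outer_sum _ chg) iK (perm_big _ iK') big_nil.
rewrite !big_cons big_nil /=; congr (_ + _).
suff -> : windex K' c = windex K' d by case: (windex K' d == n) => //; rewrite sgn addr0 addNr.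
have [e1 [e2 [l [r [th [th' [[fr fr'] [H H'] hlr _ hJ]]]]]]] := change_angles chg.
have [e [h [_ [arcs01 disj] _ _ _]]] := chg.
have mem x : x \in [:: c; d] -> x \in crossings K'.
  by rewrite -(perm_mem iK') mem_filter => /andP[].
have hc : c \in crossings K' by apply: mem; rewrite !inE eqxx.
have hd : d \in crossings K' by apply: mem; rewrite !inE eqxx orbT.
have ic : l <= c.1 <= r /\ l <= c.2 <= r by apply: hlr; rewrite mem_cat hc orbT.
have jd : l <= d.1 <= r /\ l <= d.2 <= r by apply: hlr; rewrite mem_cat hd orbT.
have [ko hko] := hJ Jo (mem_head _ _).
have [|ku hku] := hJ Ju; first by rewrite !inE eqxx orbT.
have /andP[? ?] := c1; have /andP[? ?] := c2; have /andP[? ?] := d1; have /andP[? ?] := d2.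
apply: (winding_arcs (k1 := ko) (k2 := ku) hc hd (windexP hc) (windexP hd) fr' fr' H' H' ic jd).
- by have [|] := hko c.1; first by rewrite !ltW.
- by have [|] := hku c.2; first by rewrite !ltW.
- by have [|] := hko d.1; first by rewrite !ltW.
- by have [|] := hku d.2; first by rewrite !ltW.
by apply: arcs_order c1 c2 d1 d2 _; move: disj; rewrite /= !andbT.
Qed.

Lemma sum3 (T : Type) (P : pred T) (F : T -> int) (x y z : T) :
  \sum_(i <- [:: x; y; z] | P i) F i =
  (if P x then F x else 0) + (if P y then F y else 0) + (if P z then F z else 0).
Proof. by rewrite !big_cons big_nil; do 3 case: ifP => _; ring. Qed.

Lemma writhe_sum_R3 K K' n : reidemeister3 K K' ->
  writhe_sum K' n = writhe_sum K n.
Proof.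
move=> [Jt [Jm [Jb [chg [c1 [c2 [c3 [d1 [d2 [d3 [pK pK' [s1 s2 s3]]]]]]]]]]]].
move: pK pK' => [iK p1 p2 p3] [iK' q1 q2 q3].
rewrite !(writhe_sum_split [:: Jt; Jm; Jb]) (outer_sum _ chg).
rewrite (perm_big _ iK) [X in X + _ = _](perm_big _ iK') !sum3 -s1 -s2 -s3.
have [e1 [e2 [l [r [th [th' [[fr fr'] [H H'] hlr _ hJ]]]]]]] := change_angles chg.
have [e [h [_ [arcs01 disj] _ _ _]]] := chg.
have mem x : x \in [:: c1; c2; c3] -> x \in crossings K.
  by rewrite -(perm_mem iK) mem_filter => /andP[].
have mem' x : x \in [:: d1; d2; d3] -> x \in crossings K'.
  by rewrite -(perm_mem iK') mem_filter => /andP[].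
have same (c d J1 J2 : R * R) : c \in [:: c1; c2; c3] -> d \in [:: d1; d2; d3] ->
    J1 \in [:: Jt; Jm; Jb] -> J2 \in [:: Jt; Jm; Jb] ->
    (J1.2 < J2.1) || (J2.2 < J1.1) ->
    inside J1 c.1 && inside J2 c.2 -> inside J1 d.1 && inside J2 d.2 ->
    windex K c = windex K' d.
  move=> /mem hc /mem' hd hJ1 hJ2 dis /andP[x1 x2] /andP[y1 y2].
  have /andP[? ?] := x1; have /andP[? ?] := x2; have /andP[? ?] := y1; have /andP[? ?] := y2.
  have ic : l <= c.1 <= r /\ l <= c.2 <= r by apply: hlr; rewrite mem_cat hc.
  have jd : l <= d.1 <= r /\ l <= d.2 <= r by apply: hlr; rewrite mem_cat hd orbT.
  have [k1 hk1] := hJ J1 hJ1.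
  have [k2 hk2] := hJ J2 hJ2.
  apply: (winding_arcs (k1 := k1) (k2 := k2) hc hd (windexP hc) (windexP hd) fr fr' H H' ic jd).
  - by have [|] := hk1 c.1; first by rewrite !ltW.
  - by have [|] := hk2 c.2; first by rewrite !ltW.
  - by have [|] := hk1 d.1; first by rewrite !ltW.
  - by have [|] := hk2 d.2; first by rewrite !ltW.
  exact: arcs_order x1 x2 y1 y2 dis.
move: disj; rewrite /= !andbT => /andP[/andP[dis1 dis2] dis3].
have -> : windex K c1 = windex K' d1.
  by apply: (same _ _ Jt Jm _ _ _ _ dis1 p1 q1); rewrite !inE eqxx ?orbT.
have -> : windex K c2 = windex K' d2.
  by apply: (same _ _ Jt Jb _ _ _ _ dis2 p2 q2); rewrite !inE eqxx ?orbT.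
have -> : windex K c3 = windex K' d3; last by [].
by apply: (same _ _ Jm Jb _ _ _ _ dis3 p3 q3); rewrite !inE eqxx ?orbT.
Qed.

End WritheSum.

(** * Isotopies *)
Section Calculus.
Variable R : realType.
Local Notation V := 'rV[R]_3.

Lemma within_cont_comp (T U W : topologicalType) (D : set U) (f : U -> W) (g : T -> U) (x : T) :
  {within D, continuous f} -> (forall y, D (g y)) -> {for x, continuous g} ->
  {for x, continuous (fun y => f (g y))}.
Proof.
move=> /subspace_continuousP cf Dg cg A /(cf (g x) (Dg x)) /= hA.
have : \forall y \near x, D (g y) -> A (f (g y)) by exact: cg hA.
by apply: filterS => y; apply; exact: Dg.
Qed.

Lemma slope_derive1 (f g : R -> V) (t : R) : (forall s, f s = f t + (s - t) *: g s) ->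
  {for t, continuous g} -> derivable f t 1 /\ derive1 f t = g t.
Proof.
move=> fE cg.
have h : h^-1 *: (f (h *: (1 : R) + t) - f t) @[h --> 0^'] --> g t.
  have cg0 : {for 0, continuous (fun h : R => g (h + t))}.
    apply: (@cont_comp _ _ _ (0 : R) (fun h => h + t) g); last by rewrite add0r.
    by apply: cvgD; [exact: cvg_id|exact: cvg_cst].
  have := (continuous_withinNx _ _).1 cg0; rewrite add0r; apply: cvg_trans.
  apply: near_eq_cvg; near=> h; have h0 : h != 0 by near: h; exact: nbhs_dnbhs_neq.
  have E : f (h + t) - f t = h *: g (h + t) by rewrite (fE (h + t)) addrK addrAC subrr add0r.
  have -> : h *: (1 : R) = h by rewrite /GRing.scale /= mulr1.
  by rewrite E scalerA mulVf // scale1r.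
split; first by apply/cvg_ex; exists (g t).
by rewrite derive1E; exact: cvg_lim h.
Unshelve. all: by end_near. Qed.

Lemma diff_curve (f : V -> V) (g : R -> V) (t : R) :
  differentiable f (g t) -> derivable g t 1 ->
  derivable (fun s => f (g s)) t 1 /\
  derive1 (fun s => f (g s)) t = 'd f (g t) (derive1 g t).
Proof.
move=> df dg; have dg' : differentiable g t by apply/derivable1_diffP.
have dfg : differentiable (f \o g) t by exact: differentiable_comp.
split; first by apply/derivable1_diffP.
have E1 : derive1 (f \o g) t = 'd (f \o g) t (1 : R) by rewrite derive1E; exact: deriveE.
have E2 : derive1 g t = 'd g t (1 : R) by rewrite derive1E; exact: deriveE.
have E3 := congr1 (fun k => k (1 : R)) (congr1 (fun k => k : R -> V) (diff_comp dg' df)).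
move: E1; rewrite E2 => E1.
exact: etrans E1 E3.
Qed.

(** An isotopy is controlled on the sphere only, so its differential is computed along curves of the
    sphere. This is the half-angle parametrization of the circle, which is rational and also covers
    [u = 0]. *)
Lemma great_circle (x u : V) : dot x x = 1 -> dot u x = 0 ->
  exists g : R -> V, [/\ g 0 = x, forall s, S2 (g s), derivable g 0 1 & derive1 g 0 = u].
Proof.
move=> hx ux; pose w s := s ^+ 2 * dot u u / 4.
have w0 s : 0 <= w s by rewrite /w divr_ge0 // mulr_ge0 ?sqr_ge0 ?dot_ge0.
have w1 s : 1 + w s != 0 by rewrite gt_eqF // ltr_wpDr.
pose k s : V := (1 + w s)^-1 *: (u - (s * dot u u / 2) *: x).
pose g s : V := x + s *: k s.
have g0 : g 0 = x by rewrite /g scale0r addr0.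
have cw (s : R) : {for s, continuous w} by rewrite /w; cont.
have ck : {for 0, continuous k}.
  apply: cvgZ; first by apply: (@contV _ _ _ (fun s => 1 + w s)) => //; cont; exact: cw.
  apply: cvgB; first exact: cvg_cst.
  apply: cvgZ; last exact: cvg_cst.
  have h : {for 0, continuous (fun s : R => s * dot u u / 2)} by cont.
  exact: h.
have [|dg dE] := @slope_derive1 g k 0 _ ck; first by move=> s; rewrite subr0 g0.
exists g; split => //.
  have dNl (a b : V) : dot (- a) b = - dot a b by rewrite -scaleN1r dotZl mulN1r.
  have dNr (a b : V) : dot a (- b) = - dot a b by rewrite dotC dNl dotC.
  move=> s; rewrite /S2 /= /g /k !(dNl, dNr, dotDl, dotDr, dotZl, dotZr) hx ux (dotC x u) ux.
  move: (w1 s); rewrite /w; set n := dot u u => h; field.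
  by apply: lt0r_neq0; have := sqr_ge0 s; have := dot_ge0 u; rewrite -/n; nra.
have k0 : k 0 = u by rewrite /k /w expr0n /= !mul0r addr0 invr1 scale0r subr0 scale1r.
by rewrite -[RHS]k0; exact: dE.
Qed.

(** The Gram determinant of [y], [m], [v] reduces to the equality case of Cauchy-Schwarz for [m] and
    [v]. *)
Lemma tangent_parallel (y m v : V) : dot y y = 1 -> dot m y = 0 -> dot v y = 0 ->
  det3 y m v = 0 -> dot m m *: v = dot m v *: m.
Proof.
move=> hy my vy D0; apply/eqP; rewrite -subr_eq0; apply/eqP.
set d := _ - _; have dm : dot d m = 0.
  by rewrite /d dotBl !dotZl (dotC v m); ring.
have dy : dot d y = 0 by rewrite /d dotBl !dotZl my vy; ring.
apply: dot_eq0.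
have dd : dot d d = dot m m * dot v d.
  by rewrite {1}/d dotBl !dotZl (dotC m d) dm mulr0 subr0.
have := gram y m v y m v; rewrite D0 mul0r hy my vy (dotC y m) my (dotC y v) vy => G.
rewrite /d !(dotBl, dotBr, dotZl, dotZr) (dotC v m).
transitivity (dot m m * (dot m m * dot v v - dot m v * dot m v)); first by ring.
by move: G; rewrite (dotC v m) => G; apply/eqP; rewrite mulf_eq0 orbC; apply/orP; left;
  apply/eqP; rewrite [RHS]G; ring.
Qed.

End Calculus.

Section Isotopy.
Variable R : realType.
Local Notation V := 'rV[R]_3.
Local Notation tau := (2 * @pi R).
Variable phi : R -> V -> V.
Hypothesis phi_iso : isotopy phi.

Let phi0 x : S2 x -> phi 0 x = x. Proof. by case: phi_iso => h _ _ _ _; exact: h. Qed.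

Let phi_bij (t : R) : 0 <= t <= 1 -> set_bij (@S2 R) (@S2 R) (phi t).
Proof. by case: phi_iso => _ h _ _ _; exact: h. Qed.

Let phi_diff (t : R) x : 0 <= t <= 1 -> S2 x -> differentiable (phi t) x.
Proof. by case: phi_iso => _ _ _ h _; exact: h. Qed.

Let phi_immersion (t : R) x v : 0 <= t <= 1 -> S2 x -> dot x v = 0 -> v != 0 -> 'd (phi t) x v != 0.
Proof. by case: phi_iso => _ _ _ _ [_ h]; exact: h. Qed.

Lemma isotopy_S2 (t : R) x : 0 <= t <= 1 -> S2 x -> S2 (phi t x).
Proof. by move=> ht hx; case: (phi_bij ht) => f _ _; exact: f. Qed.

Lemma isotopy_inj (t : R) x y : 0 <= t <= 1 -> S2 x -> S2 y -> x != y -> phi t x != phi t y.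
Proof.
move=> ht hx hy; apply: contra_neq => E; case: (phi_bij ht) => _ i _.
by apply: i => //; rewrite inE.
Qed.

Lemma isotopy_cont (T : topologicalType) (s : T -> R) (g : T -> V) (x : T) :
  (forall y, 0 <= s y <= 1) -> (forall y, S2 (g y)) ->
  {for x, continuous s} -> {for x, continuous g} ->
  {for x, continuous (fun y => phi (s y) (g y))}.
Proof.
move=> hs hg cs cg; case: phi_iso => _ _ h _ _.
by apply: (within_cont_comp (g := fun y => (s y, g y)) h); [move=> y; split; [exact: hs|exact: hg]|exact: cont_pair].
Qed.

Lemma isotopy_diff_cont (T : topologicalType) (s : T -> R) (g : T -> V) (v : V) (x : T) :
  (forall y, 0 <= s y <= 1) -> (forall y, S2 (g y)) ->
  {for x, continuous s} -> {for x, continuous g} ->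
  {for x, continuous (fun y => 'd (phi (s y)) (g y) v : V)}.
Proof.
move=> hs hg cs cg; case: phi_iso => _ _ _ _ [h _].
by apply: (within_cont_comp (g := fun y => (s y, g y)) (h v)); [move=> y; split; [exact: hs|exact: hg]|exact: cont_pair].
Qed.

Lemma isotopy_diff0 x u : S2 x -> dot u x = 0 -> 'd (phi 0) x u = u.
Proof.
move=> hx ux; have [g [g0 hg dg gE]] := great_circle hx ux.
have h01 : 0 <= (0 : R) <= 1 by lra.
have df : differentiable (phi 0) (g 0) by rewrite g0; exact: phi_diff.
have [_] := diff_curve df dg; rewrite g0 gE => <-.
by rewrite -gE; congr (derive1 _ 0); apply/funext => s; exact: phi0.
Qed.

Lemma isotopy_diff_tangent (t : R) x u : 0 <= t <= 1 -> S2 x -> dot u x = 0 ->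
  dot ('d (phi t) x u) (phi t x) = 0.
Proof.
move=> ht hx ux; have [g [g0 hg dg gE]] := great_circle hx ux.
have df : differentiable (phi t) (g 0) by rewrite g0; exact: phi_diff.
have [dfg] := diff_curve df dg; rewrite g0 gE => <-.
have := @unit_curve_tangent R (fun s => phi t (g s)) 0 dfg; rewrite g0; apply.
by near=> s; exact: isotopy_S2.
Unshelve. all: by end_near. Qed.

(** If the images were parallel, a combination of [u] and [v] would be killed by the differential,
    which is injective on the tangent plane; so [u] and [v] would be parallel. *)
Lemma isotopy_det_neq0 (t : R) x u v : 0 <= t <= 1 -> S2 x -> dot u x = 0 -> dot v x = 0 ->
  det3 x u v != 0 -> det3 (phi t x) ('d (phi t) x u) ('d (phi t) x v) != 0.
Proof.
move=> ht hx ux vx; apply: contra_neq => D0.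
have u0 : u != 0 -> 'd (phi t) x u != 0 by apply: phi_immersion => //; rewrite dotC.
have [->|/u0 {}u0] := eqVneq u 0; first by rewrite det3E !mxE; ring.
have := tangent_parallel (isotopy_S2 ht hx) (isotopy_diff_tangent ht hx ux)
  (isotopy_diff_tangent ht hx vx) D0.
set m := 'd _ _ u in u0 *; set a := dot m m; set b := dot m _ => E.
have a0 : a != 0 by rewrite gt_eqF // dot_gt0.
have : 'd (phi t) x (a *: v - b *: u) = 0 by rewrite linearB !linearZ /= -/m E scalerN subrr.
have [w0 _|w0 /eqP] := eqVneq (a *: v - b *: u) 0; last first.
  have wx : dot x (a *: v - b *: u) = 0 by rewrite dotC dotBl !dotZl ux vx; ring.
  by rewrite (negPf (phi_immersion ht hx wx w0)).
apply: (mulfI a0); rewrite mulr0.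
have -> : a * det3 x u v = det3 x u (a *: v - b *: u) by rewrite !det3E !mxE; ring.
by rewrite w0 det3E !mxE; ring.
Qed.

(* The determinant never vanishes along the isotopy, so its sign is constant. *)
Lemma isotopy_orientation (t : R) x u v : 0 <= t <= 1 -> S2 x -> dot u x = 0 -> dot v x = 0 ->
  det3 x u v != 0 ->
  0 < det3 x u v * det3 (phi t x) ('d (phi t) x u) ('d (phi t) x v).
Proof.
move=> ht hx ux vx D0.
(* The isotopy is continuous within [[0, 1]] only; clamping the time gives functions continuous at
   every real. *)
pose cl (s : R) := Num.max 0 (Num.min 1 s).
have hcl s : 0 <= cl s <= 1 by apply: clamp_in; rewrite ler01.
pose D s := det3 x u v * det3 (phi (cl s) x) ('d (phi (cl s)) x u) ('d (phi (cl s)) x v).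
have ccl (s : R) : {for s, continuous cl} by exact: cont_clamp.
have cx (s : R) : {for s, continuous (fun _ : R => x)} by exact: cvg_cst.
have cD s : 0 <= s <= t -> {for s, continuous D}.
  move=> _; apply: contM; first exact: cont_cst.
  apply: cont_det3; first exact: (isotopy_cont hcl (fun=> hx) (ccl s) (cx s)).
    exact: (isotopy_diff_cont (v := u) hcl (fun=> hx) (ccl s) (cx s)).
  exact: (isotopy_diff_cont (v := v) hcl (fun=> hx) (ccl s) (cx s)).
have Dn s : D s != 0 by rewrite mulf_neq0 // isotopy_det_neq0.
have clt : cl t = t by apply: clamp_id.
have cl0 : cl 0 = 0 by apply: clamp_id; lra.
have D00 : 0 < D 0.
  by rewrite /D cl0 phi0 // !isotopy_diff0 // -expr2 lt_def sqr_ge0 sqrf_eq0 D0.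
have -> : det3 x u v * det3 (phi t x) ('d (phi t) x u) ('d (phi t) x v) = D t by rewrite /D clt.
clearbody D; rewrite ltNge; apply/negP => Dt.
have t0 : 0 <= t by case/andP: ht.
have [|s _ /eqP] := @IVT_pointwise R D 0 t 0 t0 cD; first by rewrite Dt (ltW D00) orbT.
by rewrite (negPf (Dn s)).
Qed.

End Isotopy.

Lemma det3Z (R : realType) (x y z : 'rV[R]_3) (a b : R) :
  det3 x (a *: y) (b *: z) = a * b * det3 x y z.
Proof. by rewrite !det3E !mxE; ring. Qed.

Lemma tangent_frame_exists (R : realType) (q : 'rV[R]_3) : dot q q = 1 ->
  exists e1 e2, [/\ frame q e1 e2, dot e1 q = 0 & dot e2 q = 0].
Proof.
move=> hq; have [|e1 [e2 fr]] := @frame_exists R q.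
  by apply/eqP => E; move: hq; rewrite E dot0l => /eqP; rewrite eq_sym oner_eq0.
exists (e1 - dot e1 q *: q), (e2 - dot e2 q *: q).
split; try by rewrite dotBl dotZl hq mulr1 subrr.
rewrite /frame; suff -> : det3 q (e1 - dot e1 q *: q) (e2 - dot e2 q *: q) = det3 q e1 e2 by [].
by rewrite !det3E !mxE; ring.
Qed.

Lemma pos_mul_sign (R : realType) (k a b : R) : 0 < k -> b != 0 -> 0 < b * (k * a) ->
  (0 < a) = (0 < b).
Proof.
move=> k0 b0; rewrite mulrCA pmulr_rgt0 // => ab.
have [bp|bn] := ltP 0 b; first by move: ab; rewrite pmulr_rgt0.
have {}bn : b < 0 by rewrite lt_neqAle b0.
by move: ab; rewrite nmulr_rgt0 // => an; apply/negbTE; rewrite -leNgt ltW.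
Qed.

(** * Signs and indices of the crossings of isotopic diagrams *)

Section IsotopicDiagrams.
Variable R : realType.
Local Notation V := 'rV[R]_3.
Local Notation tau := (2 * @pi R).
Variables (K K' : diagram R) (phi : R -> V -> V) (h : R -> R).
Hypothesis phi_iso : isotopy phi.
Hypothesis h_rep : reparametrization h.
Hypothesis K'h : forall t : R, 0 <= t <= 1 -> K' (h t) = phi 1 (K t).
Hypothesis crossings_h : perm_eq (crossings K') [seq (h c.1, h c.2) | c <- crossings K].

Let hK : immersed_arc K := diagram_immersed K.
Let hK' : immersed_arc K' := diagram_immersed K'.

Lemma repar_derivable (t : R) : 0 <= t <= 1 -> derivable h t 1.
Proof. by move=> ht; case: h_rep => _ _ /(_ t ht)[]. Qed.

Lemma repar_derive_gt0 (t : R) : 0 <= t <= 1 -> 0 < derive1 h t.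
Proof. by move=> ht; case: h_rep => _ _ /(_ t ht)[]. Qed.

Lemma repar_cont (t : R) : 0 <= t <= 1 -> {for t, continuous h}.
Proof. by move=> ht; apply/differentiable_continuous/derivable1_diffP/repar_derivable. Qed.

Lemma repar_lt (s t : R) : 0 <= s -> s < t -> t <= 1 -> h s < h t.
Proof.
apply: gtr0_derive1_incr.
- by move=> x; rewrite in_itv /= => /andP[x0 x1]; apply: repar_derivable; rewrite !ltW.
- by move=> x; rewrite in_itv /= => /andP[x0 x1]; apply: repar_derive_gt0; rewrite !ltW.
- by apply: pointwise_within => t' ht; exact: repar_cont.
Qed.

Lemma repar_crossing c : c \in crossings K -> (h c.1, h c.2) \in crossings K'.
Proof. by move=> hc; rewrite (perm_mem crossings_h); apply/mapP; exists c. Qed.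

Lemma repar_derive1 (t : R) : 0 < t < 1 -> 0 < h t < 1 ->
  'd (phi 1) (K t) (derive1 K t) = derive1 h t *: derive1 K' (h t).
Proof.
move=> ht hht; have t01 : 0 <= t <= 1 by case/andP: ht => ? ?; rewrite !ltW.
have ht01 : 0 <= h t <= 1 by case/andP: hht => ? ?; rewrite !ltW.
have i01 : 0 <= (1 : R) <= 1 by rewrite ler01 lexx.
have df : differentiable (phi 1) (K t).
  by case: phi_iso => _ _ _ d _; apply: d => //; exact: (arc_unit hK).
have [_ <-] := diff_curve df (arc_derivable hK t01).
have [k [kE ck <-]] := caratheodory (arc_derivable hK' ht01).
have [e [eE ce <-]] := caratheodory (repar_derivable t01).
have cg : {for t, continuous (fun s => e s *: k (h s))}.
  by apply: cvgZ => //; exact: (cont_comp (repar_cont t01) ck).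
have [|_ <-] := @slope_derive1 R (fun s => K' (h s)) (fun s => e s *: k (h s)) t _ cg.
  move=> s; rewrite kE scalerA; congr (_ + _ *: _).
  by rewrite eE addrAC subrr add0r.
apply: derive1_near.
have : \forall s \near t, s \in `]0, 1[ by apply: near_in_itvoo; rewrite in_itv.
by apply: filterS => s; rewrite in_itv /= => /andP[s0 s1]; rewrite K'h // !ltW.
Qed.

Lemma isotopy_orientation_eq (x u v y U W : V) : S2 x -> dot u x = 0 -> dot v x = 0 ->
  det3 x u v != 0 -> phi 1 x = y -> 'd (phi 1) x u = U -> 'd (phi 1) x v = W ->
  0 < det3 x u v * det3 y U W.
Proof.
move=> hx ux vx D0 <- <- <-; apply: isotopy_orientation => //.
by rewrite ler01 lexx.
Qed.

Lemma isotopic_sign c : c \in crossings K ->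
  crossing_sign K' (h c.1, h c.2) = crossing_sign K c.
Proof.
move=> hc; have [i1 i2] := crossings_inner hc.
have [j1 j2] := crossings_inner (repar_crossing hc).
have t1 : 0 <= c.1 <= 1 by case/andP: i1 => ? ?; rewrite !ltW.
have t2 : 0 <= c.2 <= 1 by case/andP: i2 => ? ?; rewrite !ltW.
have i01 : 0 <= (1 : R) <= 1 by rewrite ler01 lexx.
have Kc : K c.1 = K c.2.
  have [| //] := (@crossingsP _ K _ _ t1 t2).2; by left; rewrite -surjective_pairing.
have D0 := crossings_transverse hc.
have tan1 := arc_tangent hK i1; have tan2 := arc_tangent hK i2; rewrite -Kc in tan2.
have E2 : 'd (phi 1) (K c.1) (derive1 K c.2) = derive1 h c.2 *: derive1 K' (h c.2).
  by rewrite Kc; exact: repar_derive1.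
have := isotopy_orientation_eq (arc_unit hK t1) tan1 tan2 D0 (esym (K'h t1)) (repar_derive1 i1 j1) E2.
rewrite /crossing_sign /=.
rewrite det3Z => AB; apply: (congr1 int_of_sign).
have p12 := mulr_gt0 (repar_derive_gt0 t1) (repar_derive_gt0 t2).
exact: pos_mul_sign p12 D0 AB.
Qed.

(** One argument is lifted over all times of the isotopy and of the loop. At each time of the
    isotopy its variation along the closed loop is a multiple of [tau], so it is constant. *)
Lemma isotopic_winding c : c \in crossings K ->
  windex K' (h c.1, h c.2) = windex K c.
Proof.
move=> hc; have hc' := repar_crossing hc.
have [l0 lr r1 Klr] := crossing_times hc.
have [i1 i2] := crossings_inner hc.
have i01 : 0 <= (1 : R) <= 1 by rewrite ler01 lexx.
have [minE maxE] : Num.min (h c.1) (h c.2) = h (Num.min c.1 c.2) /\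
    Num.max (h c.1) (h c.2) = h (Num.max c.1 c.2).
  move: i1 i2 lr => /andP[? ?] /andP[? ?]; case: (ltgtP c.1 c.2) => [lt|lt|->]; last by rewrite ltxx.
    by have := repar_lt (ltW _) lt (ltW _) => /(_ _ _)H; rewrite min_l ?max_r ?ltW //; apply: repar_lt => //; exact: ltW.
  by rewrite min_r ?max_l ?ltW //; apply: repar_lt => //; exact: ltW.
set l := Num.min c.1 c.2 in l0 lr Klr minE *; set r := Num.max c.1 c.2 in lr r1 Klr maxE *.
pose p := K 0; pose q := K 1.
have hp : dot p p = 1 := tail_unit K; have hq : dot q q = 1 := head_unit K.
have pq : p != q by apply: diagram_head_only; rewrite lexx ltr01.
(* The frame must be tangent: it is transported by the differential of the isotopy, which is
   controlled on tangent vectors only. *)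
have [e1 [e2 [fr e1q e2q]]] := tangent_frame_exists hq.
pose ct (s : R) := Num.max 0 (Num.min 1 s); pose cs (s : R) := Num.max l (Num.min r s).
have hct s : 0 <= ct s <= 1 by apply: clamp_in; exact: ler01.
have hcs s : l <= cs s <= r by apply: clamp_in; exact: ltW.
have Klr01 s : l <= s <= r -> 0 < s < 1.
  by move=> /andP[s1 s2]; rewrite (lt_le_trans l0 s1) (le_lt_trans s2 r1).
have Kunit s : l <= s <= r -> dot (K s) (K s) = 1.
  by move=> /Klr01/andP[s0 s1]; apply: (arc_unit hK); rewrite !ltW.
have Kp s : l <= s <= r -> K s != p.
  by move=> /Klr01/andP[s0 s1]; apply: diagram_tail_only; rewrite s0 ltW.
have Kq s : l <= s <= r -> K s != q.
  by move=> /Klr01/andP[s0 s1]; apply: diagram_head_only; rewrite s1 ltW.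
have frt t : 0 <= t <= 1 -> frame (phi t q) ('d (phi t) q e1) ('d (phi t) q e2).
  move=> ht; have D0 : det3 q e1 e2 != 0 by rewrite lt_eqF.
  have := isotopy_orientation phi_iso ht hq e1q e2q D0.
  by rewrite nmulr_rgt0.
pose f e (P : R * R) := dot (stereo (phi (ct P.1) p) (phi (ct P.1) q)
  (phi (ct P.1) (K (cs P.2)))) ('d (phi (ct P.1)) q e).
have cct (P : R * R) : {for P, continuous (fun P : R * R => ct P.1)}.
  exact: (@cont_comp_fst _ _ _ P ct (@cont_clamp _ _ _ _)).
have cKs (P : R * R) : {for P, continuous (fun P : R * R => K (cs P.2))}.
  apply: (@cont_comp_snd _ _ _ P (fun s => K (cs s))).
  apply: (@cont_comp _ _ _ P.2 cs K (@cont_clamp _ _ _ _)).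
  by have /Klr01/andP[s0 s1] := hcs P.2; apply: (arc_cont hK); rewrite !ltW.
have ccst (v : V) (P : R * R) : {for P, continuous (fun _ : R * R => v)} by exact: cvg_cst.
have hct' (P : R * R) : 0 <= ct P.1 <= 1 by exact: hct.
have hKs (P : R * R) : S2 (K (cs P.2)) by exact: Kunit.
have cf e P : {for P, continuous (f e)}.
  exact: (@cont_stereo_coord _ _ (fun P => phi (ct P.1) p) (fun P => phi (ct P.1) q)
   (fun P => phi (ct P.1) (K (cs P.2))) (fun P => 'd (phi (ct P.1)) q e) P
   (isotopy_cont phi_iso hct' (fun=> hp) (cct P) (ccst p P))
   (isotopy_cont phi_iso hct' (fun=> hq) (cct P) (ccst q P))
   (isotopy_cont phi_iso hct' hKs (cct P) (cKs P))
   (isotopy_diff_cont phi_iso (v := e) hct' (fun=> hq) (cct P) (ccst q P))).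
have iS2 t x : 0 <= t <= 1 -> dot x x = 1 -> dot (phi t x) (phi t x) = 1.
  by move=> ht hx; exact: (isotopy_S2 phi_iso ht hx).
have f0 P : (f e1 P != 0) || (f e2 P != 0).
  apply: stereo_coord_neq0.
  - exact: iS2 (hct' P) hp.
  - exact: iS2 (hct' P) hq.
  - exact: iS2 (hct' P) (hKs P).
  - exact: (isotopy_inj phi_iso (hct' P) hp hq pq).
  - exact: (isotopy_inj phi_iso (hct' P) (hKs P) hq (Kq _ (hcs P.2))).
  - exact: (isotopy_inj phi_iso (hct' P) (hKs P) hp (Kp _ (hcs P.2))).
  - exact: frt (hct' P).
have [th cth Hth] := @rectangle_lift R (f e1) (f e2) 0 1 l r ler01 (ltW lr)
  (fun P _ _ => And3 (cf e1 P) (cf e2 P) (f0 P)).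
have hl : l <= l <= r by rewrite lexx ltW.
have hr : l <= r <= r by rewrite lexx ltW.
have i00 : 0 <= (0 : R) <= 1 by rewrite ler01 lexx.
have i11 : 0 <= (1 : R) <= 1 by rewrite ler01 lexx.
have csE s : l <= s <= r -> cs s = s by exact: clamp_id.
have ctE s : 0 <= s <= 1 -> ct s = s by exact: clamp_id.
have cth1 t s : {for s, continuous (fun s => th (t, s))}.
  by apply: (@cont_comp _ _ _ s (fun s => (t, s))); [apply: cont_pair; cont|exact: cth].
have cth2 t s : {for t, continuous (fun t => th (t, s))}.
  by apply: (@cont_comp _ _ _ t (fun t => (t, s))); [apply: cont_pair; cont|exact: cth].
have turn t : 0 <= t <= 1 -> cos (th (t, r) - th (t, l)) = 1.
  move=> ht; apply: polar_uniq (Hth (t, l) ht hl) _.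
  have fE e : f e (t, l) = f e (t, r) by rewrite /f /= !csE // Klr.
  by rewrite !fE; exact: (Hth (t, r) ht hr).
have E01 : th (0, r) - th (0, l) = th (1, r) - th (1, l).
  apply: (@cos_neqN1_range R (fun t => th (t, r) - th (t, l)) 0 1 ler01).
  - by move=> t _; apply: contB; exact: cth2.
  - by move=> t ht; rewrite turn // gt_eqF // (lt_trans (ltrN10 R)) ?ltr01.
  - exact: turn.
  - exact: turn.
have S2K s : l <= s <= r -> S2 (K s) by exact: Kunit.
have fix0 x : dot x x = 1 -> phi 0 x = x by case: phi_iso => e0 _ _ _ _; exact: e0.
have A0 : angle K e1 e2 (fun s => th (0, s)) l r.
  move=> s hs; split; first exact: cth1.
  have fE e : dot e q = 0 -> f e (0, s) = dot (stereo (K 0) (K 1) (K s)) e.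
    move=> eq0; rewrite /f /= ctE // csE // !fix0 //; last exact: Kunit.
    by rewrite (isotopy_diff0 phi_iso hq eq0).
  by rewrite -!fE //; exact: (Hth (0, s)).
have W := winding_angle hc (windexP hc) fr A0.
have h0 : h 0 = 0 by case: h_rep.
have h1 : h 1 = 1 by case: h_rep.
have K'0 : K' 0 = phi 1 p by rewrite -{1}h0 K'h.
have K'1 : K' 1 = phi 1 q by rewrite -{1}h1 K'h.
have fr1 : frame (K' 1) ('d (phi 1) q e1) ('d (phi 1) q e2) by rewrite K'1; exact: frt.
have [l0' lr' r1' _] := crossing_times hc'.
rewrite /= minE maxE in l0' lr' r1'.
have [th' cth' H'] := angle_exists fr1 l0' (ltW lr') r1'.
have W' : th' (h r) - th' (h l) = tau * (windex K' (h c.1, h c.2))%:~R.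
  have := winding_angle hc' (windexP hc') fr1; rewrite /= minE maxE; exact.
have hin s : l <= s <= r -> h l <= h s <= h r.
  move=> /andP[s1 s2]; have le a b : 0 <= a -> a <= b -> b <= 1 -> h a <= h b.
    move=> a0; rewrite le_eqVlt => /orP[/eqP->//|ab] b1; exact: ltW (repar_lt a0 ab b1).
  by rewrite !le ?(ltW l0) ?(ltW r1) // ?(le_trans s2 (ltW r1)) // (le_trans (ltW l0) s1).
(* At the end of the isotopy, [th' \o h] and [th (1, _)] lift the same map, since
   [K' (h s) = phi 1 (K s)]. *)
have E1 : th (1, r) - th (1, l) = th' (h r) - th' (h l).
  apply: (@lift_uniq R (fun s => f e1 (1, s)) (fun s => f e2 (1, s)) (fun s => th (1, s))
    (fun s => th' (h s)) l r (ltW lr)).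
    by move=> s hs; split; [exact: cth1|exact: (Hth (1, s))].
  move=> s hs; have /andP[s0 s1] := Klr01 s hs.
  have s01 : 0 <= s <= 1 by rewrite !ltW.
  split; first exact: (@cont_comp _ _ _ s h th' (repar_cont s01) (cth' (h s))).
  have fE e : f e (1, s) = dot (stereo (K' 0) (K' 1) (K' (h s))) ('d (phi 1) q e).
    have -> : K' (h s) = phi 1 (K s) by exact: K'h.
    by rewrite K'0 K'1 /f /= (ctE 1 i11) (csE s hs).
  rewrite !fE; exact: (H' (h s) (hin s hs)).2.
apply/eqP; rewrite -(eqr_int R); apply/eqP.
have tau0 : tau != 0 by rewrite mulf_neq0 // gt_eqF // pi_gt0.
by apply: (mulfI tau0); rewrite -W' -E1 -E01.
Qed.

End IsotopicDiagrams.

(** * Invariance of the signed count *)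

Section Invariance.
Variable R : realType.
Implicit Types (K : diagram R) (n : int).

Lemma writhe_sum_isotopic K K' n : isotopic K K' -> writhe_sum K' n = writhe_sum K n.
Proof.
move=> [phi [h [phi_iso h_rep K'h ch]]].
rewrite /writhe_sum (perm_big _ ch) big_map big_seq_cond [in RHS]big_seq_cond.
have main c : c \in crossings K -> windex K' (h c.1, h c.2) = windex K c.
  by move=> hc; have := isotopic_winding phi_iso h_rep K'h ch hc.
have main' c : c \in crossings K -> crossing_sign K' (h c.1, h c.2) = crossing_sign K c.
  by move=> hc; have := isotopic_sign phi_iso h_rep K'h ch hc.
apply: eq_big => [c|c /andP[hc _]]; last exact: main'.
by apply: andb_id2l => hc; rewrite main.
Qed.

Lemma writhe_sum_equiv K K' n : n != 0 -> knotoid_equiv K K' ->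
  writhe_sum K n = writhe_sum K' n.
Proof.
move=> n0; elim=> {K K'}.
- by move=> K K' /writhe_sum_isotopic->.
- by move=> K K' /(writhe_sum_R1 n0)->.
- by move=> K K' /writhe_sum_R2->.
- by move=> K K' /writhe_sum_R3->.
- by [].
- by move=> K K' _ ->.
- by move=> K K' K'' _ -> _ ->.
Qed.

End Invariance.

(** * Degrees of the index polynomial *)
Section Degrees.

(** Common treatment of the maximum and the minimum, each of which returns one of its arguments. *)
Lemma big_pick_mem (op : int -> int -> int) (x0 : int) (s : seq int) :
  (forall x y, op x y = x \/ op x y = y) -> \big[op/x0]_(n <- s) n \in x0 :: s.
Proof.
move=> opP; elim: s => [|x s IH]; first by rewrite big_nil mem_head.
rewrite big_cons; have [->|->] := opP x (\big[op/x0]_(n <- s) n).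
  by rewrite !inE eqxx orbT.
by move: IH; rewrite !inE => /orP[->//|->]; rewrite !orbT.
Qed.

Lemma big_pick_msupp (op : int -> int -> int) (p : laurent) (s : seq int) :
  s = enum_fset (msupp p) ->
  (forall x y, op x y = x \/ op x y = y) -> p != 0 ->
  \big[op/head 0 s]_(n <- s) n \in msupp p.
Proof.
move=> sE opP p0; have mem n : (n \in msupp p) = (n \in s) by rewrite sE.
have {sE} : s != [::].
  apply: contra_neq p0 => s0; apply/malgP => n; rewrite mcoeff0; apply/eqP.
  by rewrite mcoeff_eq0 mem s0.
rewrite mem; case: (s) => // x s' _ /=.
by have := big_pick_mem x (x :: s') opP; rewrite inE => /orP[/eqP->|//]; exact: mem_head.
Qed.

Lemma deg_plus_msupp (p : laurent) : 0 < deg_plus p -> deg_plus p \in msupp p.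
Proof.
rewrite /deg_plus; have [->|p0] := eqVneq p 0; first by rewrite ltxx.
have maxP (x y : int) : Num.max x y = x \/ Num.max x y = y by case: leP; [right|left].
have := big_pick_msupp erefl maxP p0; rewrite -/(maxdeg p) => m.
by case: (leP (maxdeg p) 0); rewrite ?ltxx.
Qed.

Lemma deg_minus_msupp (p : laurent) : 0 < deg_minus p -> - deg_minus p \in msupp p.
Proof.
rewrite /deg_minus; have [->|p0] := eqVneq p 0; first by rewrite ltxx.
have minP (x y : int) : Num.min x y = x \/ Num.min x y = y by case: leP; [left|right].
have := big_pick_msupp erefl minP p0; rewrite -/(mindeg p) => m.
by case: (leP (- mindeg p) 0); rewrite ?ltxx ?opprK.
Qed.

Lemma deg_plus_ge0 (p : laurent) : 0 <= deg_plus p.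
Proof. by rewrite /deg_plus; case: ifP => // _; rewrite le_max lexx orbT. Qed.

Lemma deg_minus_ge0 (p : laurent) : 0 <= deg_minus p.
Proof. by rewrite /deg_minus; case: ifP => // _; rewrite le_max lexx orbT. Qed.

Lemma index_polynomial_msupp (R : realType) (k : knotoid R) (m : int) : m != 0 ->
  m \in msupp (index_polynomial k) -> writhe k m != 0.
Proof.
move=> m0; rewrite -mcoeff_neq0 /index_polynomial.
(* The implication is stable under sums, so single terms suffice. As [m != 0], the constant monomial
   does not contribute to the coefficient of [m]. *)
apply: (big_ind (fun p : laurent => mcoeff m p != 0 -> writhe k m != 0)).
- by rewrite mcoeff0 eqxx.
- move=> p q hp hq; rewrite mcoeffD => h.
  have [p0|/hp//] := eqVneq (mcoeff m p) 0.
  by apply: hq; move: h; rewrite p0 add0r.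
- move=> n _; rewrite (raddfMz (mcoeff m)) raddfB /= !mcoeffU [0 == m]eq_sym (negPf m0) subr0.
  by have [->|_] := eqVneq n m; [apply: contra => /eqP->|rewrite mulr0n mul0rz eqxx].
Qed.

End Degrees.

(** * Hits in a time interval are consecutive *)

Section Infix.

Lemma prefix_filter_lt (R : realType) (T : eqType) (f : T -> R) (l r : R) (s : seq T) :
  sorted <%R (map f s) -> all (fun x => l < f x) s ->
  prefix [seq x <- s | l < f x < r] s.
Proof.
elim: s => //= x s IH xs /andP[lx ls].
rewrite lx /=; case: (ltP (f x) r) => xr /=.
  by rewrite eqxx IH // (path_sorted xs).
suff -> : [seq y <- s | l < f y < r] = [::] by [].
apply/eqP; rewrite -(negbK (_ == _)) -has_filter; apply/hasPn => y ys.
have /allP/(_ _ (map_f f ys)) xy := order_path_min (@lt_trans _ _) xs.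
by rewrite negb_and -!leNgt (le_trans xr (ltW xy)) orbT.
Qed.

Lemma infix_filter_lt (R : realType) (T : eqType) (f : T -> R) (l r : R) (s : seq T) :
  sorted <%R (map f s) -> infix [seq x <- s | l < f x < r] s.
Proof.
elim: s => //= x s IH xs; have ss := path_sorted xs.
have [lx|xl] := ltP l (f x); last first.
  by rewrite /=; exact: infix_trans (IH ss) (infix_cons _ _).
have ls : all (fun y => l < f y) (x :: s).
  rewrite /= lx; apply/allP => y ys.
  have /allP/(_ _ (map_f f ys)) xy := order_path_min (@lt_trans _ _) xs.
  exact: lt_trans lx xy.
have := prefixW (prefix_filter_lt r (s := x :: s) xs ls).
by rewrite /= lx.
Qed.

End Infix.

(** * From a nonzero writhe to a consecutive subsequence *)

Section Attainable.
Variable R : realType.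
Implicit Types (K : diagram R) (n : int).

Lemma Ind_infix K (a : shortcut K) (c : R * R) :
  exists2 s, infix s (Seq a) & sign_sum s = Ind a c.
Proof.
exists [seq hit_sign a h | h <- hits a & Num.min c.1 c.2 < h.1 < Num.max c.1 c.2].
  have /infixP[s1 [s2 E]] := @infix_filter_lt R _ fst (Num.min c.1 c.2) (Num.max c.1 c.2) _ (hits_sorted a).
  by rewrite /Seq {2}E !map_cat infix_catl // prefix_infix // prefix_prefix.
by rewrite /sign_sum big_map big_filter.
Qed.

(** The nonzero value of [writhe] comes from some diagram of [k], whose count equals that of [K] by
    invariance. Half of an empty sum is 0, so [K] has a crossing of index [n]. *)
Lemma writhe_neq0_Ind (k : knotoid R) K (a : shortcut K) n : represents k K ->
  n != 0 -> writhe k n != 0 -> exists c, Ind a c = n.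
Proof.
move=> kK n0; rewrite /writhe.
case: xgetP => [m _ [K1 [kK1 [a1 ->]]]|_]; last by rewrite eqxx.
have [K0 kE] := knotoid_class k.
have E : writhe_sum K1 n = writhe_sum K n.
  rewrite kE in kK kK1; apply: writhe_sum_equiv n0 _.
  exact: Defs.equiv_trans (Defs.equiv_sym kK1) kK.
rewrite diagram_writheE E => w0.
have [/hasP[c hc /eqP cn]|/hasPn none] := boolP (has (fun c => windex K c == n) (crossings K)).
  by exists c; exact: etrans (esym (windexE hc (Ind_winding a hc))) cn.
move: w0; rewrite /writhe_sum big_seq_cond big1 ?div0z ?eqxx // => c /andP[hc].
by rewrite (negPf (none c hc)).
Qed.

End Attainable.

Theorem theorem1p7 (R : realType) (k : knotoid R) (s : seq bool)
    (Hs : attainable k s) :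
  (exists2 s' : seq bool, infix s' s &
     sign_sum s' = deg_plus (index_polynomial k)) /\
  (exists2 s' : seq bool, infix s' s &
     sign_sum s' = - deg_minus (index_polynomial k)).
Proof.
have [K [kK [a ->]]] := Hs.
have main n : n != 0 -> n \in msupp (index_polynomial k) ->
    exists2 s', infix s' (Seq a) & sign_sum s' = n.
  move=> n0 /(index_polynomial_msupp n0) /(writhe_neq0_Ind a kK n0)[c <-].
  exact: Ind_infix.
(* A degree 0 need not come from a crossing; the empty subsequence realizes it. *)
have empty : exists2 s', infix s' (Seq a) & sign_sum s' = 0.
  by exists [::]; rewrite ?infix0s // /sign_sum big_nil.
split.
- have := deg_plus_ge0 (index_polynomial k); rewrite le_eqVlt => /orP[/eqP<- //|d].
  by apply: main (deg_plus_msupp d); rewrite gt_eqF.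
- have := deg_minus_ge0 (index_polynomial k).
  rewrite le_eqVlt => /orP[/eqP<-|d]; first by rewrite oppr0.
  by apply: main (deg_minus_msupp d); rewrite oppr_eq0 gt_eqF.
Qed.
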